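(* Let $\mathcal G$ be a metric graph and let $\mathbf H_0$ be the corresponding minimal Kirchhoff Laplacian, with maximal Kirchhoff Laplacian $\mathbf H=\mathbf H_0^*$. Then the deficiency indices of $\mathbf H_0$ satisfy $$\mathrm n_\pm(\mathbf H_0)\ \ge\ \#\mathfrak C_0(\mathcal G).$$ Moreover, the equality $\mathrm n_\pm(\mathbf H_0)=\#\mathfrak C_0(\mathcal G)$ holds true if and only if either $\#\mathfrak C_0(\mathcal G)=\infty$ or $\mathrm{dom}(\mathbf H)\subset H^1(\mathcal G)$.
   Context: Metric graphs. Let $\mathcal G_d=(\mathcal V,\mathcal E)$ be an unoriented graph with countably infinite vertex and edge sets which is locally finite (each vertex $v$ has finite degree), connected and simple (no loops or multiple edges). Given edge lengths $|e|\in(0,\infty)$, $e\in\mathcal E$, the metric graph $\mathcal G=(\mathcal G_d,|\cdot|)$ is the topological space obtained by identifying each edge $e$ with the interval $[0,|e|]$ and gluing together endpoints corresponding to the same vertex. It carries the natural path metric and the Lebesgue measure on its edges, denoted $\mathrm{vol}$. $\mathcal E_v$ is the set of edges incident to $v$; a function $f$ on $\mathcal G$ has edge components $f_e=f|_e$; $f_e'(v)$ denotes the derivative of $f_e$ at the vertex $v$ of $e$ taken in the direction pointing from $v$ into $e$. $L^2(\mathcal G)=\bigoplus_{e}L^2(e)$. Ends. Consider sequences $(U_n)_{n\ge0}$ of non-empty open connected subsets of $\mathcal G$ with compact boundaries, $U_{n+1}\subseteq U_n$ and $\bigcap_n\overline{U_n}=\emptyset$. Two such sequences $(U_n),(U_n')$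 are equivalent if for every $n$ there are $j,k$ with $U_n\supseteq U_j'$ and $U_n'\supseteq U_k$. Equivalence classes are called topological ends of $\mathcal G$. A topological end $\gamma$ has finite volume if there is a sequence $(U_n)$ representing $\gamma$ with $\mathrm{vol}(U_n)<\infty$ for some $n$; $\mathfrak C_0(\mathcal G)$ is the set of finite volume ends. $\#S$ is the cardinality of $S$ if $S$ is finite and $\#S=\infty$ otherwise; likewise dimensions are either finite or $\infty$. Operators. The maximal Kirchhoff Laplacian $\mathbf H$ in $L^2(\mathcal G)$ acts by $f\mapsto -f''$ edgewise on the domain of all $f\in L^2(\mathcal G)$ with $f_e\in H^2(e)$ for all $e$, $f''\in L^2(\mathcal G)$, and satisfying at every vertex $v$ the Kirchhoff conditions: $f$ is continuous at $v$ and $\sum_{e\in\mathcal E_v}f_e'(v)=0$. $\mathbf H_0^0$ is its restriction to functions that are non-zero only on finitely many edges, and the minimal Kirchhoff Laplacian $\mathbf H_0$ is the closure of $\mathbf H_0^0$; it is symmetric and non-negative. The deficiency indices are $\mathrm n_\pm(\mathbf H_0)=\dim\ker(\mathbf H\mp \mathrm i)$, which are equal to each other. $H^1(\mathcal G)$ is the space of continuous $f\in L^2(\mathcal G)$ with $f_e\in H^1(e)$ for all $e$ and $\|f'\|_{L^2(\mathcal G)}^2=\sum_e\|f_e'\|^2_{L^2(e)}<\infty$. *)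

(* Defs.v *)
From HB Require Import structures.
From mathcomp Require Import all_boot all_order all_algebra.
From mathcomp Require Import all_classical all_reals all_analysis.
From mathcomp Require Import complex.

Set Implicit Arguments.
Unset Strict Implicit.
Unset Printing Implicit Defensive.

Import Order.TTheory GRing.Theory Num.Theory.
Import numFieldNormedType.Exports.

Local Open Scope classical_set_scope.
Local Open Scope ring_scope.
Local Open Scope complex_scope.

(* The graph is unoriented: [src] and [tgt] only record which end of the edge e
   is glued to the endpoint 0, resp. |e|, of the interval [0, |e|]. *)
Record metric_graph (R : realType) := MetricGraph {
  vertex : choiceType;
  edge : choiceType;
  src : edge -> vertex;
  tgt : edge -> vertex;
  len : edge -> R;
  joins (e : edge) (u v : vertex) : bool :=
    ((src e == u) && (tgt e == v)) || ((src e == v) && (tgt e == u));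
  incident (v : vertex) : set edge := [set e | src e = v \/ tgt e = v];
  countable_vertex : countable [set: vertex];
  infinite_vertex : infinite_set [set: vertex];
  countable_edge : countable [set: edge];
  infinite_edge : infinite_set [set: edge];
  no_loop : forall e, src e <> tgt e;
  no_multi_edge : forall e e' u v, joins e u v -> joins e' u v -> e = e';
  locally_finite : forall v, finite_set (incident v);
  graph_connected : forall u v, exists p : seq vertex,
    path (fun x y => `[< exists e, joins e x y >]) u p /\ last u p = v;
  len_gt0 : forall e, 0 < len e
}.

Section mpoints.
Context {R : realType} (G : metric_graph R).

Variant mpoint : Type :=
  | Vertex of vertex G
  | Inner (e : edge G) (t : R) of 0 < t < len e.

HB.instance Definition _ := gen_eqMixin mpoint.
HB.instance Definition _ := gen_choiceMixin mpoint.

(* The map from [0, |e|] onto the closed edge e; its values for t outside of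
   [0, |e|] are never used. *)
Definition chart (e : edge G) (t : R) : mpoint :=
  match pselect (0 < t < len e) with
  | left t_in => Inner t_in
  | right _ => Vertex (if t <= 0 then src e else tgt e)
  end.

(* The quotient topology of the disjoint union of the intervals [0, |e|]: every
   vertex is an endpoint of some edge, so the charts are jointly surjective. *)
Definition open_mpoint (U : set mpoint) : Prop :=
  forall e, open (chart e @^-1` U : set (subspace `[0, len e])).

Lemma open_mpointT : open_mpoint setT.
Proof. by move=> e; rewrite preimage_setT; exact: openT. Qed.

Lemma open_mpointI : setI_closed open_mpoint.
Proof. by move=> A B oA oB e; rewrite preimage_setI; exact: openI. Qed.

Lemma open_mpoint_bigU (I : Type) (f : I -> set mpoint) :
  (forall i, open_mpoint (f i)) -> open_mpoint (\bigcup_i f i).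
Proof.
by move=> of_ e; rewrite preimage_bigcup; apply: bigcup_open => i _; exact: of_.
Qed.

HB.instance Definition _ := isOpenTopological.Build mpoint
  open_mpointT open_mpointI open_mpoint_bigU.

End mpoints.

Section ends.
Context {R : realType} (G : metric_graph R).

Definition vol (U : set (mpoint G)) : \bar R :=
  \esum_(e in [set: edge G])
    lebesgue_measure (`[0, len e] `&` chart e @^-1` U).

Definition boundary (T : topologicalType) (U : set T) : set T :=
  closure U `\` interior U.

Definition end_sequence (U : nat -> set (mpoint G)) : Prop :=
  [/\ forall n, U n !=set0 /\ open (U n),
      forall n, connected (U n),
      forall n, compact (boundary (U n)),
      forall n, U n.+1 `<=` U n &
      \bigcap_n closure (U n) = set0].

Definition end_equiv (U U' : nat -> set (mpoint G)) : Prop :=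
  forall n, exists j k, U' j `<=` U n /\ U k `<=` U' n.

Definition topological_end : set (set (nat -> set (mpoint G))) :=
  [set gamma | exists2 U, end_sequence U &
     gamma = [set U' | end_sequence U' /\ end_equiv U U']].

Definition finite_volume_end : set (set (nat -> set (mpoint G))) :=
  [set gamma | topological_end gamma /\
     exists2 U, gamma U & exists n, (vol (U n) < +oo)%E].

(* [counting] is the number of elements of a finite set and +oo on infinite
   sets. *)
Definition num_finite_volume_ends : \bar R := counting finite_volume_end.

End ends.

Section Sobolev.
Context {R : realType}.

Definition Cmeasurable (D : set R) (u : R -> R[i]) : Prop :=
  measurable_fun D (fun t => complex.Re (u t)) /\
  measurable_fun D (fun t => complex.Im (u t)).

Definition integralC (D : set R) (u : R -> R[i]) : R[i] :=
  (\int[lebesgue_measure]_(t in D) complex.Re (u t)) +i*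
  (\int[lebesgue_measure]_(t in D) complex.Im (u t)).

Definition sqnormL2 (l : R) (u : R -> R[i]) : \bar R :=
  (\int[lebesgue_measure]_(t in `[0%R, l])
     (complex.Re (u t) ^+ 2 + complex.Im (u t) ^+ 2)%:E)%E.

Definition inL2 (l : R) (u : R -> R[i]) : Prop :=
  Cmeasurable `[0, l] u /\ (sqnormL2 l u < +oo)%E.

(* u is the absolutely continuous representative of a function in H^1(0, l) and
   du represents its derivative. *)
Definition derivL2 (l : R) (u du : R -> R[i]) : Prop :=
  inL2 l du /\ forall x, 0 <= x <= l -> u x = u 0 + integralC `[0, x] du.

End Sobolev.

Section Laplacian.
Context {R : realType} (G : metric_graph R).

Definition edge_component (f : mpoint G -> R[i]) (e : edge G) : R -> R[i] :=
  fun t => f (chart e t).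

(* An element of L^2(G) is given by its edge components. *)
Definition inL2G (h : edge G -> R -> R[i]) : Prop :=
  (forall e, Cmeasurable `[0, len e] (h e)) /\
  (\esum_(e in [set: edge G]) sqnormL2 (len e) (h e) < +oo)%E.

Definition Ccontinuous_at (f : mpoint G -> R[i]) (x : mpoint G) : Prop :=
  {for x, continuous (f : mpoint G -> R[i]^o)}.

(* dh is the derivative of the edge component on e; the result is the
   derivative at v in the direction pointing from v into e. *)
Definition outward_derivative (dh : R -> R[i]) (v : vertex G) (e : edge G) :
    R[i] :=
  if src e == v then dh 0 else - dh (len e).

(* The graph of the maximal Kirchhoff Laplacian H: f is the continuous
   representative of an element of dom(H) and g is a representative of Hf, which
   is only determined up to null sets.  On each edge, df is the absolutely
   continuous representative of f', so that its values at the endpoints are the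
   derivatives there. *)
Definition max_Laplacian (f g : mpoint G -> R[i]) : Prop :=
  exists df : edge G -> R -> R[i],
  [/\ inL2G (edge_component f),
      inL2G (edge_component g),
      forall e, derivL2 (len e) (edge_component f e) (df e) /\
                derivL2 (len e) (df e) (fun t => - edge_component g e t),
      forall v, Ccontinuous_at f (Vertex v) &
      forall v, \sum_(e \in incident v) outward_derivative (df e) v e = 0].

Definition dom_max_Laplacian : set (mpoint G -> R[i]) :=
  [set f | exists g, max_Laplacian f g].

(* ker(H - z) *)
Definition ker_max_Laplacian (z : R[i]) : set (mpoint G -> R[i]) :=
  [set f | max_Laplacian f (fun x => z * f x)].

(* Dimension of the complex vector space V, +oo if it is infinite. *)
Definition cdim (T : Type) (V : set (T -> R[i])) : \bar R :=
  ereal_sup [set (n%:R)%:E | n in [set n : nat |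
    exists2 v : 'I_n -> T -> R[i], forall i, V (v i) &
      forall c : 'I_n -> R[i],
        (forall x, \sum_(i < n) c i * v i x = 0) -> forall i, c i = 0]].

(* The deficiency indices of the minimal Kirchhoff Laplacian H_0, whose adjoint
   is H: n_+ = dim ker(H - i) and n_- = dim ker(H + i). *)
Definition deficiency_plus : \bar R := cdim (ker_max_Laplacian 'i%C).
Definition deficiency_minus : \bar R := cdim (ker_max_Laplacian (- 'i%C)).

Definition sobolevH1 : set (mpoint G -> R[i]) :=
  [set f | [/\ forall x, Ccontinuous_at f x,
               inL2G (edge_component f) &
               exists df : edge G -> R -> R[i],
                 (forall e, derivL2 (len e) (edge_component f e) (df e)) /\
                 inL2G df]].

End Laplacian.
Arguments deficiency_plus {R} G.
Arguments deficiency_minus {R} G.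
Arguments dom_max_Laplacian {R} G.
Arguments sobolevH1 {R} G.
Arguments topological_end {R} G.
Arguments finite_volume_end {R} G.
Arguments num_finite_volume_ends {R} G.

(* Main.v *)
(* On H^1(G) the form <u',v'> - z<u,v>, with z = i or -i, splits off ker(H - z):
   for f in dom(H), solve the homogeneous equation with boundary values f outside
   an exhausting sequence of finite vertex sets F_n.  The difference with f is
   bounded in H^1, so a cluster point v of the solutions lies in ker(H - z),
   f - v is in H^1(G), and f - v vanishes at every end of finite volume, since
   there it is at most (volume)^(1/2) times the H^1 norm.  Starting from cutoff
   functions equal to 1 near one of finitely many given finite volume ends and to
   0 near the others, this produces as many independent elements of ker(H - z).
   If they span ker(H - z), then dom(H) is contained in H^1(G).

   Conversely, for u in ker(H - z) the function |u|^2 is subharmonic because Re z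
   = 0.  If moreover u is in H^1(G) and vanishes at the finite volume ends, then
   every set {|u| >= eps} contains finitely many vertices: by Konig's lemma it
   would otherwise accumulate at an end, near which |u|^2 oscillates by at most
   the H^1 energy and thus stays away from 0, so that the volume is finite.  So
   |u|^2 attains its maximum and is 0 by the maximum principle.  This bounds the
   dimension of ker(H - z) in H^1(G) by the number of finite volume ends.

   Combinatorially, an end is a decreasing sequence of components of the graph
   deprived of its first n vertices, n = 0, 1, ... *)

Require Import Defs.
From mathcomp Require Import all_boot all_order all_algebra.
From mathcomp Require Import finmap all_classical all_reals all_analysis.
From mathcomp Require Import measurable_realfun complex ring lra.

Set Implicit Arguments.
Unset Strict Implicit.
Unset Printing Implicit Defensive.

Import Order.TTheory GRing.Theory Num.Theory.
Import numFieldNormedType.Exports.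

Local Open Scope classical_set_scope.
Local Open Scope ring_scope.

(** * Sobolev functions on an interval *)

(** Everything is reduced to vertex values: on an edge, an element of ker(H - z) is a combination of
    two explicit solutions with endpoint values 1, 0 and 0, 1, so the Dirichlet problem at n
    vertices is an n by n linear system. For z = i s with s = 1 or -1, testing -u'' = z u + g with u
    gives the integral of |u'|^2 in the real part and, up to the factor -s, that of |u|^2 in the
    imaginary part. Together they bound the H^1 norm by g and boundary terms, and the latter cancel
    at the vertices by the Kirchhoff conditions. With g = 0 this makes the linear system injective.
    The solutions for growing n need not converge, but energies over finitely many edges and
    Kirchhoff sums depend continuously on finitely many vertex values, so a cluster point of these
    values suffices. The delicate point is that vanishing at a finite volume end has to survive this
    limit, which takes an estimate uniform in n: along a simple path to a vertex outside F_n, where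
    the solution equals f, the increments of the difference add up to at most (lam * volume + energy
    / lam) / 2, with a free weight lam. *)

Section product_rule.
Context {R : realType}.
Local Notation mu := (@lebesgue_measure R).

(** Both sides integrate p(s) q(t) over the triangle 0 <= s < t <= x. Integration by parts is
    reduced to this identity. *)
Lemma Fubini_triangle (p q : R -> R) (x : R) : 0 <= x ->
  mu.-integrable `[0, x] (EFin \o p) -> mu.-integrable `[0, x] (EFin \o q) ->
  (\int[mu]_(t in `[0%R, x]) (q t * \int[mu]_(s in `[0, t]) p s)%R%:E =
   \int[mu]_(s in `[0%R, x]) (p s * \int[mu]_(t in `]s, x]) q t)%R%:E)%E.
Proof.
move=> x0 ip iq.
set D := [set` `[0, x]].
have mD : measurable D by exact: measurable_itv.
pose pD := p \_ D; pose qD := q \_ D.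
have ipD : mu.-integrable setT (EFin \o pD).
  by rewrite -restrict_EFin; apply/integrable_restrict => //=; rewrite setTI.
have iqD : mu.-integrable setT (EFin \o qD).
  by rewrite -restrict_EFin; apply/integrable_restrict => //=; rewrite setTI.
have mpD : measurable_fun setT pD by move/measurable_int : ipD => /measurable_EFinP.
have mqD : measurable_fun setT qD by move/measurable_int : iqD => /measurable_EFinP.
(* The strict inequality matches the half-open []s, x]]; on the other side the endpoint t of
   [[0, t]] is a null set and is dropped. *)
pose ind (z : R * R) : R := (z.1 < z.2)%R%:R.
pose f (z : R * R) : \bar R := (pD z.1 * qD z.2 * ind z)%:E.
have mind : measurable_fun setT ind.
  apply: (@measurableT_comp _ _ _ _ _ _ (fun b : bool => b%:R : R)) => //.
  by apply: measurable_fun_ltr => //; exact: measurable_fst.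
have mf : measurable_fun setT f.
  apply/measurable_EFinP; apply: measurable_funM => //; apply: measurable_funM.
    exact: (measurableT_comp mpD measurable_fst).
  exact: (measurableT_comp mqD measurable_snd).
have fle a b : (`|f (a, b)| <= `|pD a|%:E * `|qD b|%:E)%E.
  rewrite /f /ind /= lee_fin normrM normrM.
  by case: (a < b)%R; rewrite ?normr1 ?normr0 ?mulr1 ?mulr0// mulr_ge0.
have mnp : measurable_fun setT (fun a => `|pD a|%:E).
  by apply/measurable_EFinP; exact: measurableT_comp.
have mnq : measurable_fun setT (fun a => `|qD a|%:E).
  by apply/measurable_EFinP; exact: measurableT_comp.
have intf : (mu \x mu)%E.-integrable setT f.
  apply/integrable12ltyP => //.
  apply: (@le_lt_trans _ _ (\int[mu]_a (`|pD a|%:E * \int[mu]_b `|qD b|%:E)%E)%E).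
    apply: ge0_le_integral => //.
    - by move=> a _; exact: integral_ge0.
    - have := @measurable_fun_fubini_tonelli_F _ _ _ _ R mu (fun z => `|f z|%E).
      by apply => //; exact: measurableT_comp.
    - apply: emeasurable_funM => //; exact: measurable_cst.
    - move=> a _; rewrite -ge0_integralZl//.
      apply: ge0_le_integral => //.
      + apply: measurableT_comp => //.
        by apply: (measurableT_comp mf); exact: measurable_pair1.
      + by apply: emeasurable_funM => //; exact: measurable_cst.
  rewrite ge0_integralZr//; last exact: integral_ge0.
  apply: lte_mul_pinfty => //.
  - exact: integral_ge0.
  - rewrite ge0_fin_numE; last exact: integral_ge0.
    by have /integrableP[_] := ipD.
  - by have /integrableP[_] := iqD.
transitivity (\int[mu]_b \int[mu]_a f (a, b))%E.
  rewrite integral_mkcond; apply: eq_integral => b _.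
  rewrite patchE; case: ifPn => [bD|bD]; last first.
    rewrite -[LHS](integral0 mu setT); apply: eq_integral => a _.
    by rewrite /f /qD /= patchE (negbTE bD) mulr0 mul0r.
  have bx : 0 <= b <= x by move: bD; rewrite inE /D /= in_itv.
  transitivity ((qD b)%:E * \int[mu]_a (pD a * ind (a, b))%:E)%E; last first.
    rewrite -integralZl//.
      by apply: eq_integral => a _; rewrite /f -EFinM; congr EFin => /=; ring.
    apply: le_integrable ipD => //.
      apply/measurable_EFinP; apply: measurable_funM => //.
      by apply: (measurableT_comp mind); exact: measurable_pair2.
    move=> a _; rewrite /= lee_fin normrM /ind /=.
    by case: (a < b)%R; rewrite ?normr1 ?normr0 ?mulr1 ?mulr0.
  have ib : mu.-integrable `[0, b] (EFin \o p).
    apply: integrableS ip => //; apply: subset_itvl.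
    by rewrite bnd_simp; case/andP : bx.
  rewrite EFinM /qD patchE bD; congr (_ * _)%E.
  rewrite -Rintegral_itv_bndo_bndc; last first.
    by apply: integrableS ib => //; apply: subset_itvl; rewrite bnd_simp.
  rewrite /Rintegral fineK; last first.
    apply: integrable_fin_num => //.
    by apply: integrableS ib => //; apply: subset_itvl; rewrite bnd_simp.
  rewrite integral_mkcond; apply: eq_integral => a _.
  rewrite patchE /pD patchE /ind /= !mem_setE /D /= !in_itv /=.
  case: (ltP a b) => ab; rewrite ?andbF ?mulr0// mulr1 !andbT.
  by rewrite (le_trans (ltW ab)) ?andbT; [case: ifP|case/andP : bx].
rewrite -(Fubini intf).
rewrite [RHS]integral_mkcond; apply: eq_integral => a _.
rewrite patchE; case: ifPn => [aD|aD]; last first.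
  rewrite -[RHS](integral0 mu setT); apply: eq_integral => b _.
  by rewrite /f /pD /= patchE (negbTE aD) !mul0r.
have ax : 0 <= a <= x by move: aD; rewrite inE /D /= in_itv.
transitivity ((pD a)%:E * \int[mu]_b (qD b * ind (a, b))%:E)%E.
  rewrite -integralZl//.
    by apply: eq_integral => b _; rewrite /f -EFinM; congr EFin => /=; ring.
  apply: le_integrable iqD => //.
    apply/measurable_EFinP; apply: measurable_funM => //.
    by apply: (measurableT_comp mind); exact: measurable_pair1.
  move=> b _; rewrite /= lee_fin normrM /ind /=.
  by case: (a < b)%R; rewrite ?normr1 ?normr0 ?mulr1 ?mulr0.
rewrite EFinM /pD patchE aD; congr (_ * _)%E.
have ia : mu.-integrable `]a, x] (EFin \o q).
  apply: integrableS iq => //; apply: subset_itvr.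
  by rewrite bnd_simp; case/andP : ax.
rewrite /Rintegral fineK; last exact: integrable_fin_num.
rewrite [RHS]integral_mkcond; apply: eq_integral => b _.
rewrite patchE /qD patchE /ind /= !mem_setE /D /= !in_itv /=.
case: (ltP a b) => ab; rewrite ?mulr0// mulr1.
by rewrite (le_trans _ (ltW ab)) /=; [case: ifP|case/andP : ax].
Qed.

End product_rule.

Section square_integrable.
Context {R : realType}.
Local Notation mu := (@lebesgue_measure R).
Implicit Types (l x : R) (p q P Q : R -> R).

Lemma measurable_itv0 l : measurable ([set` `[0, l]] : set (measurableTypeR R)).
Proof. exact: measurable_itv. Qed.

Definition L2 l q := measurable_fun `[0, l] q /\
  mu.-integrable `[0, l] (EFin \o (fun t => q t ^+ 2)).

(** The real counterpart of [derivL2], to which complex statements are reduced by taking real and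
    imaginary parts. *)
Definition ac l P p := L2 l p /\
  forall x, 0 <= x <= l -> P x = P 0 + \int[mu]_(t in `[0, x]) p t.

Lemma L2M l p q : L2 l p -> L2 l q -> mu.-integrable `[0, l] (EFin \o (p \* q)).
Proof.
move=> [mp ip] [mq iq]; have ipq := integrableD (measurable_itv0 l) ip iq.
apply: le_integrable ipq => //.
  by apply/measurable_EFinP; exact: measurable_funM.
move=> t _; rewrite /= lee_fin ler_norml ger0_norm ?addr_ge0 ?sqr_ge0//.
by nra.
Qed.

Lemma within_L2 l q : {within `[0, l], continuous q} -> L2 l q.
Proof.
move=> cq; split; first exact: subspace_continuous_measurable_fun.
apply: continuous_compact_integrable; first exact: segment_compact.
by move=> t; apply: continuousM; exact: cq.
Qed.

Lemma L2_cst l c : L2 l (fun=> c).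
Proof. by apply: within_L2 => t; exact: cst_continuous. Qed.

Lemma Rintegral_cst_itv0 l (c : R) : 0 < l ->
  \int[mu]_(t in `[0, l]) (cst c t) = c * l.
Proof.
move=> l0; rewrite Rintegral_cst; last exact: measurable_itv0.
by rewrite /= lebesgue_measure_itv/= lte_fin l0 /= subr0.
Qed.

Lemma L2_int l q : L2 l q -> mu.-integrable `[0, l] (EFin \o q).
Proof.
move=> hq; have := L2M hq (L2_cst l 1).
by apply: eq_integrable => // t _ /=; rewrite mulr1.
Qed.

Lemma L2Z l c q : L2 l q -> L2 l (fun t => c * q t).
Proof.
move=> [mq iq]; split; first exact: measurable_funM.
have := integrableZl (measurable_itv0 l) (c ^+ 2) iq.
by apply: eq_integrable => // t _ /=; rewrite -EFinM exprMn.
Qed.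

Lemma L2D l p q : L2 l p -> L2 l q -> L2 l (fun t => p t + q t).
Proof.
move=> hp hq; have ipq := L2M hp hq; move: hp hq => [mp ip] [mq iq].
split; first exact: measurable_funD.
have := integrableD (measurable_itv0 l) (integrableD (measurable_itv0 l) ip iq)
   (integrableZl (measurable_itv0 l) 2 ipq).
by apply: eq_integrable => // t _ /=; congr EFin; ring.
Qed.

Lemma L2N l q : L2 l q -> L2 l (fun t => - q t).
Proof. by move=> /(L2Z (-1)); under eq_fun do rewrite mulN1r. Qed.

Lemma L2B l p q : L2 l p -> L2 l q -> L2 l (fun t => p t - q t).
Proof. by move=> hp /L2N; exact: L2D. Qed.

Lemma sub_itv0 x l : 0 <= x <= l -> `[0, x] `<=` `[0, l].
Proof. by case/andP=> _ xl; apply: subset_itvl; rewrite bnd_simp. Qed.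

Lemma int_sub x l q : 0 <= x <= l -> mu.-integrable `[0, l] (EFin \o q) ->
  mu.-integrable `[0, x] (EFin \o q).
Proof. by move=> xl; apply: integrableS => //; exact: sub_itv0. Qed.

Lemma L2_sub x l q : 0 <= x <= l -> L2 l q -> L2 x q.
Proof.
move=> xl [mq iq]; split; last exact: (int_sub xl).
by apply: measurable_funS mq => //; exact: sub_itv0.
Qed.

Lemma eq_L2 l p q : (forall t, 0 <= t <= l -> p t = q t) -> L2 l p -> L2 l q.
Proof.
move=> pq [mp ip]; have pqD : {in `[0, l]%classic, p =1 q}.
  by move=> t; rewrite inE /= in_itv; exact: pq.
split; first exact: eq_measurable_fun mp.
by apply: eq_integrable ip => // t /pqD /= ->.
Qed.

Lemma ac_within l P p : 0 <= l -> ac l P p -> {within `[0, l], continuous P}.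
Proof.
move=> l0 [hp hP].
have cI := parameterized_integral_continuous l0 (L2_int hp).
apply: (@subspace_eq_continuous _ _ _
  (fun x => P 0 + parameterized_integral mu 0 x p)).
  by move=> x; rewrite inE /= in_itv /= => xl; rewrite /from_subspace (hP x).
by move=> t; apply: (@cvgD _ R^o); [exact: cvg_cst|exact: cI].
Qed.

Lemma ac_L2 l P p : 0 <= l -> ac l P p -> L2 l P.
Proof. by move=> l0 /ac_within => /(_ l0); exact: within_L2. Qed.

Lemma ac_sub x l P p : 0 <= x <= l -> ac l P p -> ac x P p.
Proof.
move=> xl [hp hP]; split; first exact: (L2_sub xl).
move=> y /andP[y0 yx]; apply: hP; rewrite y0 (le_trans yx)//.
by case/andP : xl.
Qed.

Lemma eq_ac l P Q p q : 0 <= l -> (forall t, 0 <= t <= l -> P t = Q t) ->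
  (forall t, 0 <= t <= l -> p t = q t) -> ac l P p -> ac l Q q.
Proof.
move=> l0 PQ pq [hp hP]; split; first exact: eq_L2 hp.
move=> x xl; rewrite -!PQ ?lexx//= hP//; congr (_ + _).
apply: eq_Rintegral => t; rewrite inE /= in_itv /= => /andP[t0 tx].
by apply: pq; rewrite t0 (le_trans tx)//; case/andP : xl.
Qed.

Lemma acD l P Q p q : ac l P p -> ac l Q q ->
  ac l (fun t => P t + Q t) (fun t => p t + q t).
Proof.
move=> [hp hP] [hq hQ]; split; first exact: L2D.
move=> x xl; rewrite hP// hQ// RintegralD//; first ring.
  exact: (int_sub xl (L2_int hp)).
exact: (int_sub xl (L2_int hq)).
Qed.

Lemma acZ l c P p : ac l P p -> ac l (fun t => c * P t) (fun t => c * p t).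
Proof.
move=> [hp hP]; split; first exact: L2Z.
move=> x xl; rewrite hP// RintegralZl//; first ring.
exact: (int_sub xl (L2_int hp)).
Qed.

(** Writing P and Q as integrals of p and q leaves the two iterated integrals over a triangle that
    [Fubini_triangle] identifies. *)
Lemma acM l P Q p q x : ac l P p -> ac l Q q -> 0 <= x <= l ->
  P x * Q x = P 0 * Q 0 + \int[mu]_(t in `[0, x]) (p t * Q t + P t * q t).
Proof.
move=> aP aQ xl; have x0 : 0 <= x by case/andP : xl.
have {}aP := ac_sub xl aP; have {}aQ := ac_sub xl aQ.
have LP := ac_L2 x0 aP; have LQ := ac_L2 x0 aQ.
case: (aP) (aQ) => [Lp hP] [Lq hQ].
have ip := L2_int Lp; have iq := L2_int Lq.
have F := congr1 fine (Fubini_triangle x0 ip iq).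
have xx : 0 <= x <= x by rewrite x0 lexx.
have eL : \int[mu]_(t in `[0, x]) (q t * (P t - P 0)) =
          \int[mu]_(s in `[0, x]) (p s * (Q x - Q s)).
  transitivity (\int[mu]_(t in `[0, x]) (q t * \int[mu]_(s in `[0, t]) p s)).
    apply: eq_Rintegral => t; rewrite inE /= in_itv /= => tx.
    by rewrite (hP _ tx) addrC addKr.
  rewrite [LHS]F; apply: eq_Rintegral => t; rewrite inE /= in_itv /= => tx.
  case/andP : (tx) => t0 tlex.
  rewrite (hQ _ xx) (hQ _ tx) -(@Rintegral_itvB _ q (BLeft 0) (BRight x) t iq).
  - by ring.
  - by rewrite bnd_simp.
  - by rewrite bnd_simp.
have L1 := L2_cst x.
rewrite (RintegralD (measurable_itv0 x) (L2M Lp LQ) (L2M LP Lq)) /=.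
move: eL.
under eq_Rintegral do rewrite mulrBr.
under [in RHS]eq_Rintegral do rewrite mulrBr.
rewrite (RintegralB (measurable_itv0 x) (L2M Lq LP) (L2M Lq (L1 _))) /=.
rewrite (RintegralB (measurable_itv0 x) (L2M Lp (L1 _)) (L2M Lp LQ)) /=.
rewrite (RintegralZr _ (measurable_itv0 x) iq) (RintegralZr _ (measurable_itv0 x) ip).
under [X in X - _ = _]eq_Rintegral do rewrite mulrC.
rewrite (hP _ xx) (hQ _ xx) => /eqP; rewrite subr_eq => /eqP ->; ring.
Qed.

End square_integrable.

(** * Complex functions on an edge and the energy inequality *)

Section complex_edge.
Context {R : realType}.
Local Notation mu := (@lebesgue_measure R).
Implicit Types (l x : R) (u du g : R -> R[i]).

Definition sqabs (z : R[i]) : R := complex.Re z ^+ 2 + complex.Im z ^+ 2.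

Lemma sqabs_ge0 z : 0 <= sqabs z.
Proof. by rewrite addr_ge0 ?sqr_ge0. Qed.

Lemma sqabs0 : sqabs 0 = 0.
Proof. by rewrite /sqabs /= expr0n addr0. Qed.

Lemma sqabs_eq0 z : (sqabs z == 0) = (z == 0).
Proof.
rewrite /sqabs; case: z => a b /=.
by rewrite eq_complex /= paddr_eq0 ?sqr_ge0// !sqrf_eq0.
Qed.

Lemma sqabsM z w : sqabs (z * w) = sqabs z * sqabs w.
Proof. by case: z w => [a b] [c d]; rewrite /sqabs /=; ring. Qed.

Lemma sqabsN z : sqabs (- z) = sqabs z.
Proof. by case: z => a b; rewrite /sqabs /=; ring. Qed.

Lemma sqabsD_le z w : sqabs (z + w) <= 2 * sqabs z + 2 * sqabs w.
Proof. case: z w => [a b] [c d]; rewrite /sqabs /=.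
have := sqr_ge0 (a - c); have := sqr_ge0 (b - d); rewrite !expr2; lra. Qed.

Definition itv_integrable l (f : R -> R) := mu.-integrable `[0, l] (EFin \o f).

Lemma itv_integrableD l (f g : R -> R) :
  itv_integrable l f -> itv_integrable l g ->
  itv_integrable l (fun t => f t + g t).
Proof. by move=> hf hg; have := integrableD (measurable_itv0 l) hf hg; exact: eq_integrable. Qed.

Lemma itv_integrableZ l c (f : R -> R) : itv_integrable l f -> itv_integrable l (fun t => c * f t).
Proof. by move=> hf; have := integrableZl (measurable_itv0 l) c hf; exact: eq_integrable. Qed.

Lemma itv_integrable_L2M l (f g : R -> R) :
  L2 l f -> L2 l g -> itv_integrable l (fun t => f t * g t).
Proof. exact: L2M. Qed.

Let IRD l (f g : R -> R) : itv_integrable l f -> itv_integrable l g ->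
  \int[mu]_(t in `[0, l]) (f t + g t) =
  \int[mu]_(t in `[0, l]) f t + \int[mu]_(t in `[0, l]) g t.
Proof. by move=> hf hg; exact: RintegralD. Qed.

Lemma inL2P l u : inL2 l u <->
  L2 l (fun t => complex.Re (u t)) /\ L2 l (fun t => complex.Im (u t)).
Proof.
split=> [[[m1 m2] h]|[[m1 i1] [m2 i2]]].
  have ms : measurable_fun `[0, l] (fun t => sqabs (u t)).
    by apply: measurable_funD; exact: measurable_funX.
  have iS : itv_integrable l (fun t => sqabs (u t)).
    apply/integrableP; split; first exact/measurable_EFinP.
    under eq_integral do rewrite /= ger0_norm ?sqabs_ge0//.
    exact: h.
  split; split => //.
    apply: (le_integrable (measurable_itv0 l) _ _ iS).
      by apply/measurable_EFinP; exact: measurable_funX.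
    move=> t _ /=; rewrite lee_fin !ger0_norm ?sqabs_ge0 ?sqr_ge0//.
    by rewrite lerDl sqr_ge0.
  apply: (le_integrable (measurable_itv0 l) _ _ iS).
    by apply/measurable_EFinP; exact: measurable_funX.
  move=> t _ /=; rewrite lee_fin !ger0_norm ?sqabs_ge0 ?sqr_ge0//.
  by rewrite lerDr sqr_ge0.
split; first by split.
have /integrableP[_] := itv_integrableD i1 i2.
under eq_integral do rewrite /= ger0_norm ?sqabs_ge0//.
exact: id.
Qed.

Lemma inL2_sq l u : inL2 l u -> itv_integrable l (fun t => sqabs (u t)).
Proof.
move=> /inL2P[h1 h2].
have := itv_integrableD (itv_integrable_L2M h1 h1) (itv_integrable_L2M h2 h2).
by apply: eq_integrable => // t _ /=; rewrite /sqabs !expr2.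
Qed.

Lemma sqnormL2E l u : inL2 l u ->
  sqnormL2 l u = (\int[mu]_(t in `[0, l]) sqabs (u t))%:E.
Proof.
by move=> /inL2_sq h; rewrite /Rintegral fineK//; exact: integrable_fin_num.
Qed.

Lemma derivL2P l u du : derivL2 l u du <->
  ac l (fun t => complex.Re (u t)) (fun t => complex.Re (du t)) /\
  ac l (fun t => complex.Im (u t)) (fun t => complex.Im (du t)).
Proof.
split=> [[/inL2P[h1 h2] h]|[[h1 H1] [h2 H2]]].
  by split; split => // x xl; rewrite h//; case: (u 0).
split; first exact/inL2P.
move=> x xl; move: (H1 x xl) (H2 x xl) => {H1 H2}.
by case: (u x) => a b /= -> ->; case: (u 0).
Qed.

Lemma derivL2_inL2 l u du : 0 <= l -> derivL2 l u du -> inL2 l u.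
Proof.
by move=> l0 /derivL2P[/ac_L2 h1 /ac_L2 h2]; apply/inL2P; split; auto.
Qed.

Lemma eq_inL2 l u v : (forall t, 0 <= t <= l -> u t = v t) ->
  inL2 l u -> inL2 l v.
Proof.
move=> uv /inL2P[h1 h2]; apply/inL2P.
by split; [apply: eq_L2 h1|apply: eq_L2 h2] => t tl; rewrite uv.
Qed.

Lemma eq_derivL2 l u v du dv : 0 <= l ->
  (forall t, 0 <= t <= l -> u t = v t) -> (forall t, 0 <= t <= l -> du t = dv t) ->
  derivL2 l u du -> derivL2 l v dv.
Proof.
move=> l0 uv duv /derivL2P[h1 h2]; apply/derivL2P; split.
  by apply: eq_ac h1 => // t tl; rewrite (uv, duv).
by apply: eq_ac h2 => // t tl; rewrite (uv, duv).
Qed.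

Lemma inL2D l u v : inL2 l u -> inL2 l v -> inL2 l (fun t => u t + v t).
Proof.
move=> /inL2P[u1 u2] /inL2P[v1 v2]; apply/inL2P; split.
  by apply: eq_L2 (L2D u1 v1) => t _; rewrite raddfD.
by apply: eq_L2 (L2D u2 v2) => t _; rewrite raddfD.
Qed.

Lemma inL2Z l c u : inL2 l u -> inL2 l (fun t => c * u t).
Proof.
case: c => a b /inL2P[u1 u2]; apply/inL2P; split.
  by apply: eq_L2 (L2B (L2Z a u1) (L2Z b u2)) => t _; case: (u t).
by apply: eq_L2 (L2D (L2Z a u2) (L2Z b u1)) => t _; case: (u t).
Qed.

Lemma derivL2D l u v du dv : 0 <= l -> derivL2 l u du -> derivL2 l v dv ->
  derivL2 l (fun t => u t + v t) (fun t => du t + dv t).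
Proof.
move=> l0 /derivL2P[u1 u2] /derivL2P[v1 v2]; apply/derivL2P; split.
  by apply: eq_ac (acD u1 v1) => // t _; rewrite raddfD.
by apply: eq_ac (acD u2 v2) => // t _; rewrite raddfD.
Qed.

Lemma derivL2Z l c u du : 0 <= l -> derivL2 l u du ->
  derivL2 l (fun t => c * u t) (fun t => c * du t).
Proof.
move=> l0; case: c => a b /derivL2P[u1 u2]; apply/derivL2P; split.
  apply: eq_ac (acD (acZ a u1) (acZ (- b) u2)) => // t _.
    by case: (u t) => p q /=; ring.
  by case: (du t) => p q /=; ring.
apply: eq_ac (acD (acZ a u2) (acZ b u1)) => // t _; first by case: (u t).
by case: (du t).
Qed.

Definition h1sq l u du : R :=
  \int[mu]_(t in `[0, l]) (sqabs (u t) + sqabs (du t)).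

Lemma h1sq_ge0 l u du : 0 <= h1sq l u du.
Proof. by apply: Rintegral_ge0 => t _; rewrite addr_ge0 ?sqabs_ge0. Qed.

Lemma h1sq_integrable l u du : 0 <= l -> derivL2 l u du ->
  itv_integrable l (fun t => sqabs (u t) + sqabs (du t)).
Proof.
move=> l0 h; apply: itv_integrableD; apply: inL2_sq; last by case: h.
exact: derivL2_inL2 h.
Qed.

(** The derivative of |u|^2 is 2 Re (conj u * u'), whose modulus is at most |u|^2 + |u'|^2. *)
Lemma sqabs_osc l u du x : 0 <= x <= l -> derivL2 l u du ->
  `|sqabs (u x) - sqabs (u 0)| <= h1sq x u du.
Proof.
move=> xl /derivL2P[a1 a2].
have x0 : 0 <= x by case/andP : xl.
have {}a1 := ac_sub xl a1; have {}a2 := ac_sub xl a2.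
have xx : 0 <= x <= x by rewrite x0 lexx.
have L1 := ac_L2 x0 a1; have L2' := ac_L2 x0 a2.
have iE : itv_integrable x (fun t => sqabs (u t) + sqabs (du t)).
  by apply: h1sq_integrable => //; apply/derivL2P.
pose F t := complex.Re (du t) * complex.Re (u t) + complex.Re (u t) * complex.Re (du t)
  + (complex.Im (du t) * complex.Im (u t) + complex.Im (u t) * complex.Im (du t)).
have iF : itv_integrable x F.
  case: a1 => d1 _; case: a2 => d2 _.
  by do !apply: itv_integrableD; apply: itv_integrable_L2M.
have -> : sqabs (u x) - sqabs (u 0) = \int[mu]_(t in `[0, x]) F t.
  rewrite /F RintegralD//.
  - rewrite /sqabs !expr2 (acM a1 a1 xx) (acM a2 a2 xx); ring.
  - by case: a1 => d1 _; apply: itv_integrableD; apply: itv_integrable_L2M.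
  - by case: a2 => d2 _; apply: itv_integrableD; apply: itv_integrable_L2M.
apply: (le_trans (le_normr_Rintegral (measurable_itv0 _) iF)).
apply: le_Rintegral => //; first exact: (integrable_norm iF).
move=> t _; rewrite /F /sqabs ler_norml.
case: (u t) => p q; case: (du t) => r w /=.
have := sqr_ge0 (p + r); have := sqr_ge0 (q + w).
have := sqr_ge0 (p - r); have := sqr_ge0 (q - w).
by rewrite !expr2 => h1 h2 h3 h4; apply/andP; split; lra.
Qed.

Lemma h1sq_mono l u du x : 0 <= x <= l -> derivL2 l u du ->
  h1sq x u du <= h1sq l u du.
Proof.
move=> xl h; have l0 : 0 <= l by case/andP: xl; exact: le_trans.
have iE := h1sq_integrable l0 h.
have := @Rintegral_itvB _ (fun t => sqabs (u t) + sqabs (du t)) (BLeft 0) (BRight l) x iE.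
case/andP: (xl) => x0 xll; rewrite !bnd_simp => /(_ x0 xll) e.
rewrite -subr_ge0 [X in 0 <= X]e; apply: Rintegral_ge0 => t _.
by rewrite addr_ge0 ?sqabs_ge0.
Qed.

Lemma sqabs_osc2 l u du x y : 0 <= x <= l -> 0 <= y <= l -> derivL2 l u du ->
  sqabs (u x) <= sqabs (u y) + 2 * h1sq l u du.
Proof.
move=> xl yl h; have := sqabs_osc xl h; have := sqabs_osc yl h.
have := h1sq_mono xl h; have := h1sq_mono yl h.
rewrite !ler_norml => h1 h2 /andP[h3 h4] /andP[h5 h6]; lra.
Qed.

(** Averaging [sqabs_osc2] over the second point turns |u(y)|^2 into the L^2 norm divided by l; the
    summand 2 is the oscillation. *)
Lemma sqabs_sup l u du x : 0 < l -> 0 <= x <= l -> derivL2 l u du ->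
  sqabs (u x) <= (l^-1 + 2) * h1sq l u du.
Proof.
move=> l0 xl h; rewrite mulrDl -lerBlDr -ler_pdivrMl ?invr_gt0// invrK.
have iE := h1sq_integrable (ltW l0) h.
pose c := sqabs (u x) - 2 * h1sq l u du.
have -> : l * (sqabs (u x) - 2 * h1sq l u du) = \int[mu]_(t in `[0, l]) (cst c t).
  by rewrite Rintegral_cst_itv0// mulrC.
apply: le_Rintegral => //; first exact: (L2_int (L2_cst l c)).
move=> t; rewrite /= in_itv /= => tl; have := sqabs_osc2 xl tl h.
have := sqabs_ge0 (du t); rewrite /c; lra.
Qed.

(* Re (conj u * d) - s * Im (conj u * d): the boundary term in the identity
   obtained by testing -u'' = (i s) u + g with u. *)
Definition bracket (s : R) (u d : R[i]) : R :=
  complex.Re u * complex.Re d + complex.Im u * complex.Im d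
  - s * (complex.Re u * complex.Im d - complex.Im u * complex.Re d).

(** The derivative of the bracket is |u'|^2 + s^2 |u|^2 plus cross terms in g: the factor -s turns
    the imaginary part of -i s |u|^2 into s^2 |u|^2. The cross terms are absorbed by completing a
    square. *)
Lemma energy_le l (s : R) u du g : 0 <= l -> s ^+ 2 = 1 -> inL2 l g ->
  derivL2 l u du -> derivL2 l du (fun t => - ((0 +i* s)%C * u t + g t)) ->
  h1sq l u du <= 2 * (\int[mu]_(t in `[0, l]) sqabs (g t)) +
    2 * (bracket s (u l) (du l) - bracket s (u 0) (du 0)).
Proof.
move=> l0 s2 hg hu hdu; have hgsq := inL2_sq hg.
have iE := h1sq_integrable l0 hu.
move/derivL2P : hu => [a1 a2]; move/derivL2P : hdu => [b1 b2].
have ll : 0 <= l <= l by rewrite l0 lexx.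
have u1 := ac_L2 l0 a1; have u2 := ac_L2 l0 a2.
have d1 := ac_L2 l0 b1; have d2 := ac_L2 l0 b2.
have M11 := acM a1 b1 ll; have M22 := acM a2 b2 ll.
have M12 := acM a1 b2 ll; have M21 := acM a2 b1 ll.
case: (b1) => e1 _; case: (b2) => e2 _.
have I11 := itv_integrableD (itv_integrable_L2M d1 d1) (itv_integrable_L2M u1 e1).
have I22 := itv_integrableD (itv_integrable_L2M d2 d2) (itv_integrable_L2M u2 e2).
have I12 := itv_integrableD (itv_integrable_L2M d1 d2) (itv_integrable_L2M u1 e2).
have I21 := itv_integrableD (itv_integrable_L2M d2 d1) (itv_integrable_L2M u2 e1).
rewrite -lerBlDl.
rewrite -RintegralZl// /h1sq -RintegralB//; last exact: itv_integrableZ.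
have -> : bracket s (u l) (du l) - bracket s (u 0) (du 0) =
  \int[mu]_(t in `[0, l])
    ((complex.Re (du t) * complex.Re (du t)
      + complex.Re (u t) * complex.Re (- ((0 +i* s)%C * u t + g t)))
   + (complex.Im (du t) * complex.Im (du t)
      + complex.Im (u t) * complex.Im (- ((0 +i* s)%C * u t + g t)))
   + (- s * (complex.Re (du t) * complex.Im (du t)
             + complex.Re (u t) * complex.Im (- ((0 +i* s)%C * u t + g t)))
      + s * (complex.Im (du t) * complex.Re (du t)
             + complex.Im (u t) * complex.Re (- ((0 +i* s)%C * u t + g t))))).
  rewrite (IRD (itv_integrableD I11 I22)
    (itv_integrableD (itv_integrableZ _ I12) (itv_integrableZ _ I21))).
  rewrite (IRD I11 I22) (IRD (itv_integrableZ _ I12) (itv_integrableZ _ I21)).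
  rewrite !RintegralZl// /bracket M11 M12 M21 M22; ring.
rewrite -RintegralZl//; last first.
  by apply: itv_integrableD; apply: itv_integrableD => //; exact: itv_integrableZ.
apply: le_Rintegral => //.
- have := itv_integrableD iE (itv_integrableZ (- 1) (itv_integrableZ 2 hgsq)).
  by apply: eq_integrable => // t _ /=; rewrite mulN1r.
- by apply: itv_integrableZ; apply: itv_integrableD; apply: itv_integrableD => //; exact: itv_integrableZ.
move=> t _; rewrite /sqabs.
case: (u t) => x1 x2; case: (du t) => y1 y2; case: (g t) => z1 z2 /=.
(* The two squares add up to |u - (1 + i s) g|^2, and |1 + i s|^2 = 2 is the factor in front of
   |g|^2. *)
have E1 := sqr_ge0 (x1 - z1 + s * z2); have E2 := sqr_ge0 (x2 - z2 - s * z1).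
rewrite -subr_ge0.
set A := (X in 0 <= X).
have -> : A = y1 ^+ 2 + y2 ^+ 2 + (x1 - z1 + s * z2) ^+ 2 + (x2 - z2 - s * z1) ^+ 2
   + (s ^+ 2 - 1) * (2 * x1 ^+ 2 + 2 * x2 ^+ 2 - z1 ^+ 2 - z2 ^+ 2) by rewrite /A; ring.
by rewrite s2 subrr mul0r addr0 !addr_ge0 ?sqr_ge0.
Qed.

End complex_edge.

(** * Convexity of the squared modulus and increments on an edge *)

Section edge_solutions.
Context {R : realType}.
Local Notation mu := (@lebesgue_measure R).
Implicit Types (l x : R) (u du g : R -> R[i]).

(** The derivative of |u|^2 when d is the derivative of u. *)
Definition redot (u d : R[i]) : R :=
  2 * (complex.Re u * complex.Re d + complex.Im u * complex.Im d).

Let redotI l u du : 0 <= l -> derivL2 l u du ->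
  itv_integrable l (fun t => redot (u t) (du t)) /\
  sqabs (u l) = sqabs (u 0) + \int[mu]_(t in `[0, l]) redot (u t) (du t).
Proof.
move=> l0 /derivL2P[a1 a2].
have ll : 0 <= l <= l by rewrite l0 lexx.
have L1 := ac_L2 l0 a1; have L2' := ac_L2 l0 a2.
case: (a1) => d1 _; case: (a2) => d2 _.
have J1 := itv_integrableD (itv_integrable_L2M d1 L1) (itv_integrable_L2M L1 d1).
have J2 := itv_integrableD (itv_integrable_L2M d2 L2') (itv_integrable_L2M L2' d2).
have E t : redot (u t) (du t) = (complex.Re (du t) * complex.Re (u t) + complex.Re (u t) * complex.Re (du t))
  + (complex.Im (du t) * complex.Im (u t) + complex.Im (u t) * complex.Im (du t)).
  by rewrite /redot; ring.
split.
  by apply: eq_integrable (itv_integrableD J1 J2) => // t _ /=; rewrite E.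
under eq_Rintegral do rewrite E.
rewrite RintegralD// /sqabs !expr2 (acM a1 a1 ll) (acM a2 a2 ll); ring.
Qed.

(** The second derivative of |u|^2 is 2 |u'|^2 + 2 Re (conj u * u''), and u'' = -i s u makes conj u
    * u'' purely imaginary. *)
Let redot_mono l (s : R) u du x : 0 <= x <= l -> derivL2 l u du ->
  derivL2 l du (fun t => - ((0 +i* s)%C * u t)) ->
  redot (u x) (du x) - redot (u 0) (du 0) =
  2 * \int[mu]_(t in `[0, x]) sqabs (du t).
Proof.
move=> xl /derivL2P[a1 a2] /derivL2P[b1 b2].
have l0 : 0 <= l by case/andP: xl; exact: le_trans.
have x0 : 0 <= x by case/andP: xl.
have {}a1 := ac_sub xl a1; have {}a2 := ac_sub xl a2.
have {}b1 := ac_sub xl b1; have {}b2 := ac_sub xl b2.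
have xx : 0 <= x <= x by rewrite x0 lexx.
have u1 := ac_L2 x0 a1; have u2 := ac_L2 x0 a2.
have d1 := ac_L2 x0 b1; have d2 := ac_L2 x0 b2.
case: (b1) => e1 _; case: (b2) => e2 _.
have I11 := itv_integrableD (itv_integrable_L2M d1 d1) (itv_integrable_L2M u1 e1).
have I22 := itv_integrableD (itv_integrable_L2M d2 d2) (itv_integrable_L2M u2 e2).
rewrite /redot (acM a1 b1 xx) (acM a2 b2 xx).
set X := \int[mu]_(t in `[0, x]) _; set Y := \int[mu]_(t in `[0, x]) _.
have -> : \int[mu]_(t in `[0, x]) sqabs (du t) = X + Y.
  rewrite /X /Y -RintegralD//; apply: eq_Rintegral => t _.
  by rewrite /sqabs; case: (u t) => a b; case: (du t) => c d /=; ring.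
ring.
Qed.

(** Tangent inequalities at both ends for |u|^2, whose slope [redot] is nondecreasing; they involve
    only data at the endpoints, which is what the Kirchhoff conditions see. *)
Lemma sqabs_convex l (s : R) u du : 0 < l -> derivL2 l u du ->
  derivL2 l du (fun t => - ((0 +i* s)%C * u t)) ->
  sqabs (u 0) + l * redot (u 0) (du 0) <= sqabs (u l) /\
  sqabs (u l) - l * redot (u l) (du l) <= sqabs (u 0).
Proof.
move=> l0 hu hdu; have [iK ->] := redotI (ltW l0) hu.
have ll : 0 <= l <= l by rewrite (ltW l0) lexx.
have icst c : l * c = \int[mu]_(t in `[0, l]) (cst c t).
  by rewrite Rintegral_cst_itv0// mulrC.
have cI c : itv_integrable l (cst c) by exact: (L2_int (L2_cst l c)).
have int0 x : 0 <= \int[mu]_(t in `[0, x]) sqabs (du t).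
  by apply: Rintegral_ge0 => t _; exact: sqabs_ge0.
split.
  rewrite lerD2l icst; apply: (le_Rintegral (measurable_itv0 l) (cI _) iK) => t.
  rewrite /= in_itv /= => tl.
  by rewrite -subr_ge0 (redot_mono tl hu hdu) mulr_ge0.
rewrite lerBlDr lerD2l icst; apply: (le_Rintegral (measurable_itv0 l) iK (cI _)) => t.
rewrite /= in_itv /= => tl.
have := redot_mono ll hu hdu; have := redot_mono tl hu hdu.
have iE : itv_integrable l (fun t => sqabs (du t)) by apply: inL2_sq; case: hu.
have := @Rintegral_itvB _ (fun t => sqabs (du t)) (BLeft 0) (BRight l) t iE.
case/andP: tl => t0 tl; rewrite !bnd_simp => /(_ t0 tl) e h1 h2.
have : 0 <= \int[mu]_(t in `]t, l]) sqabs (du t).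
  by apply: Rintegral_ge0 => ? _; exact: sqabs_ge0.
rewrite -[X in 0 <= X]e; lra.
Qed.

(** Integrate 2 |p| <= lam + p^2 / lam. Compared with Cauchy-Schwarz, this form adds up over the
    edges of a path, and the choice of [lam] balances length against energy. *)
Let ac_diff l (lam : R) (P p : R -> R) : 0 < l -> 0 < lam -> ac l P p ->
  `|P l - P 0| <= (lam * l + lam^-1 * \int[mu]_(t in `[0, l]) (p t ^+ 2)) / 2.
Proof.
move=> l0 lam0 [hp hP]; have ll : 0 <= l <= l by rewrite (ltW l0) lexx.
rewrite (hP l)// [_ + _ - _]addrC addKr.
have ip := L2_int hp.
apply: (le_trans (le_normr_Rintegral (measurable_itv0 _) ip)).
have ip2 : itv_integrable l (fun t => p t ^+ 2) by case: hp.
have cI c : itv_integrable l (cst c) by exact: (L2_int (L2_cst l c)).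
rewrite -(Rintegral_cst_itv0 _ l0) -RintegralZl// -RintegralD//; [|exact: cI|exact: itv_integrableZ].
rewrite -RintegralZr//; last exact: (itv_integrableD (cI lam) (itv_integrableZ lam^-1 ip2)).
apply: le_Rintegral => //; first exact: (integrable_norm ip).
  apply: eq_integrable (itv_integrableZ 2^-1 (itv_integrableD (cI lam) (itv_integrableZ lam^-1 ip2))) => //.
  by move=> t _ /=; rewrite mulrC.
move=> t _ /=; rewrite ler_pdivlMr// -(ler_pM2l lam0) [leRHS]mulrDr mulVKf ?gt_eqF//=.
have := sqr_ge0 (lam - `|p t|); have : `|p t| ^+ 2 = p t ^+ 2 by rewrite real_normK ?num_real.
by nra.
Qed.

Lemma derivL2_diff l (lam : R) u du : 0 < l -> 0 < lam -> derivL2 l u du ->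
  `|complex.Re (u l) - complex.Re (u 0)| <= (lam * l + lam^-1 * h1sq l u du) / 2 /\
  `|complex.Im (u l) - complex.Im (u 0)| <= (lam * l + lam^-1 * h1sq l u du) / 2.
Proof.
move=> l0 lam0 hu; have /derivL2P[a1 a2] := hu.
have iE := h1sq_integrable (ltW l0) hu.
have key (P p : R -> R) : ac l P p ->
    (forall t, p t ^+ 2 <= sqabs (u t) + sqabs (du t)) ->
    `|P l - P 0| <= (lam * l + lam^-1 * h1sq l u du) / 2.
  move=> a h; apply: (le_trans (ac_diff l0 lam0 a)).
  rewrite ler_pM2r ?invr_gt0// lerD2l ler_pM2l ?invr_gt0//.
  by apply: le_Rintegral => //; case: a => -[].
split; [apply: (key _ _ a1) => t|apply: (key _ _ a2) => t]; rewrite /sqabs.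
  by rewrite -[leLHS]add0r lerD ?addr_ge0 ?sqr_ge0// lerDl sqr_ge0.
by rewrite -[leLHS]add0r lerD ?addr_ge0 ?sqr_ge0// lerDr sqr_ge0.
Qed.

Lemma is_derive_continuous (f g : R -> R) :
  (forall x, is_derive x (1 : R) f (g x)) -> continuous f.
Proof.
move=> df x; apply/differentiable_continuous/derivable1_diffP.
by have [] := df x.
Qed.

Lemma ac_C1 l (P p : R -> R) : 0 < l -> continuous p ->
  (forall x : R, is_derive x (1 : R) P (p x)) -> ac l P p.
Proof.
move=> l0 cp dP.
have cP : continuous P by exact: is_derive_continuous dP.
split.
  by apply: within_L2; exact: continuous_subspaceT.
move=> x /andP[x0 xl]; move: x0; rewrite le_eqVlt => /predU1P[<-|x0].
  by rewrite set_itv1 Rintegral_set1 addr0.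
rewrite /Rintegral (@continuous_FTC2 _ p P).
- by rewrite /=; ring.
- by [].
- exact: continuous_subspaceT.
- split.
  + by move=> y _; have [] := dP y.
  + exact/cvg_at_right_filter/cP.
  + exact/cvg_at_left_filter/cP.
- by move=> y _; rewrite derive1E; have [_ ->] := dP y.
Qed.

End edge_solutions.

(** * Explicit solutions of the equation on an edge *)

Section two_point_problem.
Context {R : realType}.
Implicit Types (l x : R) (u du g : R -> R[i]).

(** For s^2 = 1 the square of al (1 - i s) is -i s, so that sinh (al (1 - i s) x) solves -u'' = i s
    u. *)
Let al : R := Num.sqrt 2^-1.
Let al2 : al ^+ 2 = 2^-1. Proof. by rewrite sqr_sqrtr// invr_ge0. Qed.
Let al_gt0 : 0 < al. Proof. by rewrite sqrtr_gt0 invr_gt0. Qed.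

Let e1 x := expR (al * x).
Let e2 x := expR (- (al * x)).
Let c x := cos (al * x).
Let n x := sin (al * x).

(* Found by type class inference in the next proofs. *)
Let dal x : is_derive x (1 : R) (fun y => al * y) al.
Proof.
have : is_derive x (1 : R) (al *: (id : R -> R)) (al *: (1 : R)) by apply: is_deriveZ.
by rewrite /GRing.scale /= mulr1.
Qed.

Let de1 x : is_derive x (1 : R) e1 (al * e1 x).
Proof. by rewrite mulrC; apply: (@is_derive1_comp _ expR (fun y => al * y)). Qed.
Let de2 x : is_derive x (1 : R) e2 (- (al * e2 x)).
Proof.
rewrite -mulNr mulrC.
by apply: (@is_derive1_comp _ expR (fun y => - (al * y))); exact: is_deriveN.
Qed.
Let dc x : is_derive x (1 : R) c (- (al * n x)).
Proof. by rewrite mulrC -mulNr; apply: (@is_derive1_comp _ cos (fun y => al * y)). Qed.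
Let dn x : is_derive x (1 : R) n (al * c x).
Proof. by rewrite mulrC; apply: (@is_derive1_comp _ sin (fun y => al * y)). Qed.

(** [s1] = sinh (al x) cos (al x) and [s2] = cosh (al x) sin (al x) are, up to the factor -s on the
    second, the real and imaginary parts of sinh (al (1 - i s) x); [c1] and [c2] are their
    derivatives. *)
Let s1 x := 2^-1 * ((e1 x - e2 x) * c x).
Let s2 x := 2^-1 * ((e1 x + e2 x) * n x).
Let c1 x := al / 2 * ((e1 x + e2 x) * c x - (e1 x - e2 x) * n x).
Let c2 x := al / 2 * ((e1 x - e2 x) * n x + (e1 x + e2 x) * c x).

Let dM (f g : R -> R) x a b : is_derive x (1 : R) f a -> is_derive x (1 : R) g b ->
  is_derive x (1 : R) (fun y => f y * g y) (a * g x + f x * b).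
Proof.
move=> h1 h2; apply: is_derive_eq (@is_deriveM _ _ f g x 1 a b h1 h2) _.
by rewrite /GRing.scale /=; ring.
Qed.
Let dD (f g : R -> R) x a b : is_derive x (1 : R) f a -> is_derive x (1 : R) g b ->
  is_derive x (1 : R) (fun y => f y + g y) (a + b).
Proof. by move=> h1 h2; exact: is_deriveD. Qed.
Let dB (f g : R -> R) x a b : is_derive x (1 : R) f a -> is_derive x (1 : R) g b ->
  is_derive x (1 : R) (fun y => f y - g y) (a - b).
Proof. by move=> h1 h2; exact: is_deriveB. Qed.
Let dZ (f : R -> R) x a k : is_derive x (1 : R) f a ->
  is_derive x (1 : R) (fun y => k * f y) (k * a).
Proof. by move=> h1; exact: is_deriveZ. Qed.

Let ds1 x : is_derive x (1 : R) s1 (c1 x).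
Proof.
apply: is_derive_eq (dZ 2^-1 (dM (dB (de1 x) (de2 x)) (dc x))) _.
by rewrite /c1; field.
Qed.
Let ds2 x : is_derive x (1 : R) s2 (c2 x).
Proof.
apply: is_derive_eq (dZ 2^-1 (dM (dD (de1 x) (de2 x)) (dn x))) _.
by rewrite /c2; field.
Qed.
Let dc1 x : is_derive x (1 : R) c1 (- s2 x).
Proof.
apply: is_derive_eq (dZ (al / 2) (dB (dM (dD (de1 x) (de2 x)) (dc x))
  (dM (dB (de1 x) (de2 x)) (dn x)))) _.
transitivity (- (al ^+ 2 * 2) * s2 x); last by rewrite al2 mulVf// mulN1r.
by rewrite /s2; field.
Qed.
Let dc2 x : is_derive x (1 : R) c2 (s1 x).
Proof.
apply: is_derive_eq (dZ (al / 2) (dD (dM (dB (de1 x) (de2 x)) (dn x))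
  (dM (dD (de1 x) (de2 x)) (dc x)))) _.
transitivity ((al ^+ 2 * 2) * s1 x); last by rewrite al2 mulVf// mul1r.
by rewrite /s1; field.
Qed.

Let S (s : R) x : R[i] := (s1 x +i* (- s * s2 x))%C.
Let C (s : R) x : R[i] := (c1 x +i* (- s * c2 x))%C.

Let dS s l : 0 < l -> derivL2 l (S s) (C s).
Proof.
move=> l0; apply/derivL2P; split; rewrite /=.
  by apply: ac_C1 => //; exact: is_derive_continuous dc1.
by apply: acZ; apply: ac_C1 => //; exact: is_derive_continuous dc2.
Qed.

Let dC s l : 0 < l -> s ^+ 2 = 1 -> derivL2 l (C s) (fun t => - ((0 +i* s)%C * S s t)).
Proof.
move=> l0 hs; apply/derivL2P; split => /=.
  apply: eq_ac (ac_C1 l0 _ dc1) => //; first exact: ltW.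
    move=> t _; transitivity (- (s ^+ 2) * s2 t); last by ring.
    by rewrite hs mulN1r.
  by move=> x; apply: (@continuousN _ R^o); exact: is_derive_continuous ds2 x.
apply: eq_ac (acZ (- s) (ac_C1 l0 _ dc2)) => //; first exact: ltW.
  by move=> t _; ring.
exact: is_derive_continuous ds1.
Qed.

(** A zero would force cos (al x) = 0, since sinh (al x) is nonzero for x > 0, and also sin (al x) =
    0, since cosh and s do not vanish. *)
Let S_neq0 s x : 0 < x -> s ^+ 2 = 1 -> S s x != 0.
Proof.
move=> x0 hs; have s0 : s != 0.
  apply/eqP => s0; move: hs; rewrite s0 expr0n => /eqP.
  by rewrite eq_sym oner_eq0.
rewrite eq_complex /= negb_and -implybE; apply/implyP.
rewrite !mulf_eq0 !negb_or invr_eq0 pnatr_eq0 /= => /orP[/eqP|/eqP h0].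
  move/eqP; rewrite subr_eq0 => /eqP/expR_inj h.
  by have := mulr_gt0 al_gt0 x0; lra.
rewrite oppr_eq0 s0 /=; rewrite gt_eqF ?addr_gt0 ?expR_gt0//=.
apply/eqP => n0; have := cos2Dsin2 (al * x); rewrite -/(c x) -/(n x) h0 n0.
by rewrite expr0n /= addr0 => /eqP; rewrite eq_sym oner_eq0.
Qed.

Let S0 s : S s 0 = 0.
Proof. by rewrite /S /s1 /s2 /e1 /e2 /n mulr0 oppr0 sin0 subrr !(mulr0, mul0r). Qed.

Let C0 s : C s 0 != 0.
Proof.
rewrite eq_complex /= negb_and; apply/orP; left.
rewrite /c1 /e1 /e2 /n /c !mulr0 oppr0 expR0 sin0 cos0 mulr0 subr0 mulr1.
by rewrite mulf_neq0// ?mulf_neq0// ?invr_eq0 ?pnatr_eq0// gt_eqF.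
Qed.

Lemma two_point_basis l (s : R) : 0 < l -> s ^+ 2 = 1 ->
  exists A dA B dB : R -> R[i],
  [/\ derivL2 l A dA /\ derivL2 l dA (fun t => - ((0 +i* s)%C * A t)),
      derivL2 l B dB /\ derivL2 l dB (fun t => - ((0 +i* s)%C * B t)),
      A 0 = 1 /\ A l = 0 & B 0 = 0 /\ B l = 1].
Proof.
move=> l0 hs; have l0' := ltW l0.
have hS := dS s l0; have hC := dC l0 hs.
have hC' : derivL2 l (fun t => - ((0 +i* s)%C * S s t)) (fun t => - ((0 +i* s)%C * C s t)).
  by apply: eq_derivL2 (derivL2Z (- (0 +i* s)%C) l0' hS) => // t _; rewrite mulNr.
(* In a C + b S, [a] normalizes the value at 0, where S vanishes, and [b] then cancels the value at
   l. *)
pose a := (C s 0)^-1; pose b := - (C s l / S s l / C s 0).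
exists (fun t => a * C s t + b * S s t),
  (fun t => a * - ((0 +i* s)%C * S s t) + b * C s t),
  (fun t => (S s l)^-1 * S s t), (fun t => (S s l)^-1 * C s t).
have Sl := S_neq0 l0 hs.
split.
- split; first by apply: derivL2D => //; exact: derivL2Z.
  have := derivL2D l0' (derivL2Z a l0' hC') (derivL2Z b l0' hC).
  by apply: eq_derivL2 => // t _; ring.
- split; first exact: derivL2Z.
  have := derivL2Z (S s l)^-1 l0' hC.
  by apply: eq_derivL2 => // t _; ring.
- split; first by rewrite S0 mulr0 addr0 /a mulVf.
  by rewrite /a /b; field; rewrite Sl C0.
- by split; rewrite ?S0 ?mulr0// mulVf.
Qed.

End two_point_problem.

(** * Components of the graph without its first n vertices *)

Section combinatorics.
Context {R : realType} (G : metric_graph R).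
Local Notation V := (vertex G).
Local Notation E := (edge G).

Lemma vertex_numbering :
  {f : (V -> nat) * (nat -> V) | cancel f.1 f.2 /\ cancel f.2 f.1}.
Proof.
apply: cid; have : ([set: V] #= [set: nat])%card.
  apply: eq_card_nat; first exact: countable_vertex.
  exact: infinite_vertex.
move=> /card_set_bijP[f]; rewrite setTT_bijective => -[g fg gf].
by exists (f, g).
Qed.

Definition vidx : V -> nat := (sval vertex_numbering).1.
Definition vnum : nat -> V := (sval vertex_numbering).2.
Lemma vidxK : cancel vidx vnum. Proof. by case: (svalP vertex_numbering). Qed.
Lemma vnumK : cancel vnum vidx. Proof. by case: (svalP vertex_numbering). Qed.

Definition adjacent (x y : V) : Prop := exists e : E, joins e x y.

Lemma joins_sym (e : E) x y : joins e x y = joins e y x.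
Proof. by rewrite /joins orbC. Qed.

Lemma joins_ends (e : E) : joins e (src e) (tgt e).
Proof. by rewrite /joins !eqxx. Qed.

Lemma joinsP (e : E) x y : joins e x y ->
  (src e = x /\ tgt e = y) \/ (src e = y /\ tgt e = x).
Proof. by case/orP => /andP[/eqP-> /eqP->]; [left|right]. Qed.

(** Only the target is tested, so that every vertex of a path is tested once; [reach] tests the
    starting vertex. *)
Definition step n (x y : V) : bool := `[< adjacent x y >] && (n <= vidx y)%N.

(* The component of [u] in the graph from which the vertices of index < n have
   been removed. *)
Definition reach n (u v : V) : Prop :=
  (n <= vidx u)%N /\ exists p, path (step n) u p /\ last u p = v.

Lemma reach_refl n u : (n <= vidx u)%N -> reach n u u.
Proof. by move=> nu; split => //; exists [::]. Qed.

Lemma reach_trans n u v w : reach n u v -> reach n v w -> reach n u w.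
Proof.
move=> [nu [p [pp <-]]] [_ [q [pq <-]]]; split => //; exists (p ++ q).
by rewrite cat_path pp pq last_cat.
Qed.

Lemma reach_idx n u v : reach n u v -> (n <= vidx v)%N.
Proof.
move=> [nu [p [pp <-]]]; elim: p u nu pp => //= y p ih u nu /andP[/andP[_ ny] pp].
exact: ih.
Qed.

Lemma reach_edge n (e : E) x y : joins e x y -> (n <= vidx x)%N ->
  (n <= vidx y)%N -> reach n x y.
Proof.
move=> j nx ny; split => //; exists [:: y]; split => //=.
by rewrite /step ny !andbT; apply/asboolP; exists e.
Qed.

Lemma reach_sym n u v : reach n u v -> reach n v u.
Proof.
move=> [nu [p [pp <-]]]; elim: p u nu pp => /= [u nu _|y p ih u nu].
  exact: reach_refl.
move=> /andP[/andP[/asboolP[e j] ny] pp]; apply: reach_trans (ih _ ny pp) _.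
by apply: (@reach_edge _ e) => //; rewrite joins_sym.
Qed.

Lemma reach_le m n u v : (m <= n)%N -> reach n u v -> reach m u v.
Proof.
move=> mn [nu [p [pp <-]]]; split; first exact: leq_trans nu.
exists p; split => //; apply: sub_path pp => x y /andP[h1 h2].
by rewrite /step h1 (leq_trans mn).
Qed.

Lemma reach0 u v : reach 0 u v.
Proof.
split => //; have [p [pp lp]] := graph_connected u v; exists p; split => //.
by apply: sub_path pp => x y h; apply/andP; split.
Qed.

(** Every vertex of the path belongs to the component, hence differs from [vnum n] and has index
    greater than n. *)
Lemma reach_avoid n u v : reach n u v -> ~ reach n u (vnum n) -> reach n.+1 u v.
Proof.
move=> [nu [p [pp <-]]]; elim: p u nu pp => [|y p ih] u nu /= pp hn.
  apply: reach_refl; rewrite ltn_neqAle nu andbT; apply/eqP => e.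
  by apply: hn; rewrite e vidxK; apply: reach_refl; rewrite -e.
case/andP: pp => /andP[/asboolP[e j] ny] pp.
have uy : reach n u y by exact: reach_edge j nu ny.
have hn' : ~ reach n y (vnum n) by move=> h; apply: hn; exact: reach_trans h.
have S x : (n <= vidx x)%N -> ~ reach n x (vnum n) -> (n < vidx x)%N.
  move=> nx hx; rewrite ltn_neqAle nx andbT; apply/eqP => ex.
  by apply: hx; rewrite ex vidxK; apply: reach_refl; rewrite -ex.
apply: reach_trans (ih _ ny pp hn').
by apply: reach_edge j _ _; exact: S.
Qed.

Lemma adjacent_finite x : finite_set [set y | adjacent x y].
Proof.
apply: (@sub_finite_set _ _ ((@src _ G) @` incident x `|` (@tgt _ G) @` incident x)).
  move=> y [e /joinsP[[sx ty]|[sy tx]]]; [right|left]; exists e => //.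
  - by left.
  - by right.
have fx := @locally_finite _ _ x.
by rewrite finite_setU; split; exact: finite_image.
Qed.

Lemma incident_nonempty x : exists e : E, incident x e.
Proof.
have : exists y, y != x.
  exists (vnum (vidx x).+1); apply/eqP => /(congr1 vidx).
  by rewrite vnumK => /eqP; rewrite eqn_leq ltnn.
case=> y yx; have [_ [[|z p] /= [pp lp]]] := reach0 x y.
  by rewrite lp eqxx in yx.
case/andP: pp => /andP[/asboolP[e /joinsP[[sx ty]|[sy tx]]] _] _; exists e.
  by left.
by right.
Qed.

Definition touches (C : set V) (e : E) : Prop := C (src e) \/ C (tgt e).

(* All finite sums of [b] over edges touching [C] are bounded by [B]; for a
   nonnegative [b] this is a bound on the total sum. *)
Definition sum_bound (b : E -> R) (C : set V) (B : R) : Prop :=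
  forall s : seq E, uniq s -> (forall e, e \in s -> touches C e) ->
    \sum_(e <- s) b e <= B.

Lemma sum_boundS (b : E -> R) (C D : set V) B : C `<=` D ->
  sum_bound b D B -> sum_bound b C B.
Proof.
by move=> CD h s us hs; apply: h => // e /hs[/CD|/CD]; [left|right].
Qed.

Lemma sum_bound1 (b : E -> R) (C : set V) B e : sum_bound b C B ->
  touches C e -> b e <= B.
Proof.
move=> h te; have := h [:: e] isT; rewrite big_seq1; apply.
by move=> e'; rewrite inE => /eqP->.
Qed.

(** Shortening the path to a simple one makes its edges distinct, so each increment is paid by its
    own term of a sum that [sum_bound] controls. This plays the role of integrating a derivative
    along a path in the metric graph. *)
Lemma path_sum (a : V -> R) (b : E -> R) n u v B :
  (forall e x y, joins e x y -> a x <= a y + b e) ->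
  sum_bound b (reach n u) B -> reach n u v -> a u <= a v + B.
Proof.
move=> hab hB [nu [p [pp <-]]]; case/shortenP: pp => q pq uq _ {p}.
suff [s [us hs hq]] : exists s : seq E, [/\ uniq s,
    forall e, e \in s -> (src e \in u :: q) && (tgt e \in u :: q) &
    a u <= a (last u q) + \sum_(e <- s) b e].
  apply: (le_trans hq); rewrite lerD2l; apply: hB => // e /hs/andP[es _]; left.
  have : all (fun x => `[< reach n u x >]) (u :: q).
    elim: q u nu pq {us hs hq uq es} => [|y q ih] u nu /= pq.
      by rewrite andbT; apply/asboolP; exact: reach_refl.
    case/andP: pq => /andP[/asboolP[f j] ny] pq.
    have uy : reach n u y by exact: reach_edge j nu ny.
    apply/andP; split; first by apply/asboolP; exact: reach_refl.
    have /allP h : all (fun x => `[< reach n y x >]) (y :: q) by exact: ih.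
    apply/(@allP _ (fun x => `[< reach n u x >]) (y :: q)) => x /h/asboolP yx.
    by apply/asboolP; exact: reach_trans yx.
  by move=> /allP/(_ _ es)/asboolP.
elim: q u {nu hB} pq uq => [|y q ih] u /= pq.
  by exists [::]; split => //; rewrite big_nil addr0.
move=> /andP[uyq uq]; case/andP: pq => /andP[/asboolP[f j] ny] pq.
have [s [us hs hq]] := ih y pq uq.
(* [f] is new: it has [u] as an endpoint, whereas the edges of [s] have both ends in [y :: q], which
   avoids [u]. *)
exists (f :: s); split.
- rewrite /= us andbT; apply/negP => /hs.
  by case/joinsP: j => -[-> ->] /andP[h1 h2]; move: uyq; rewrite ?h1 ?h2.
- move=> e; rewrite inE => /predU1P[->|/hs/andP[h1 h2]].
    by case/joinsP: j => -[-> ->]; rewrite !inE !eqxx ?orbT.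
  by rewrite in_cons h1 orbT in_cons h2 orbT.
- by rewrite big_cons /=; have := hab _ _ _ j; move: hq => /=; lra.
Qed.

(** [w n] is merely a representative of the n-th component; the components decrease because [w n.+1]
    lies in that of [w n]. *)
Definition vertex_end (w : nat -> V) : Prop := forall n, reach n (w n) (w n.+1).

Lemma vertex_end_idx w n : vertex_end w -> (n <= vidx (w n))%N.
Proof. by move=> ew; case: (ew n). Qed.

Lemma vertex_end_le w m n : vertex_end w -> (m <= n)%N -> reach m (w m) (w n).
Proof.
move=> ew; elim: n => [|n ih]; first by rewrite leqn0 => /eqP->; apply: reach_refl.
rewrite leq_eqVlt => /predU1P[->|mn].
  by apply: reach_refl; exact: vertex_end_idx.
by apply: reach_trans (ih mn) _; apply: reach_le (ew n).
Qed.

Lemma vertex_end_sub w m n : vertex_end w -> (m <= n)%N ->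
  reach n (w n) `<=` reach m (w m).
Proof.
move=> ew mn x nx; apply: reach_trans (vertex_end_le ew mn) _.
exact: reach_le nx.
Qed.

(** The supremum of the finite sums is attained up to d by a finite set of edges, and late
    components touch none of them. *)
Lemma tail_sum (b : E -> R) w N B (d : R) : (forall e, 0 <= b e) ->
  vertex_end w -> sum_bound b (reach N (w N)) B -> 0 < d ->
  exists2 n, (N <= n)%N & sum_bound b (reach n (w n)) d.
Proof.
move=> b0 ew hB d0.
pose P (s : seq E) := uniq s /\ forall e, e \in s -> touches (reach N (w N)) e.
pose S := [set r | exists2 s, P s & r = \sum_(e <- s) b e].
have hS : has_sup S.
  split; first by exists 0; exists [::]; rewrite ?big_nil.
  by exists B => r [s [us hs] ->]; exact: hB.
have [_ [s [us hs] ->] hsup] := sup_adherent d0 hS.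
(* [n] exceeds the indices of both ends of every edge of [s], so an edge touching the component at
   level n lies outside [s]. *)
pose n := maxn N (\max_(e <- s) maxn (vidx (src e)) (vidx (tgt e))).+1.
exists n; first exact: leq_maxl.
have Nn : (N <= n)%N by exact: leq_maxl.
move=> t ut ht.
have hn e : e \in s -> (vidx (src e) < n)%N && (vidx (tgt e) < n)%N.
  move=> es; rewrite -!gtn_max.
  apply: (@leq_trans (\max_(e <- s) maxn (vidx (src e)) (vidx (tgt e))).+1).
    by rewrite ltnS; exact: leq_bigmax_seq.
  exact: leq_maxr.
have : \sum_(e <- s ++ t) b e <= sup S.
  apply: sup_ubound => //; first by case: hS.
  exists (s ++ t) => //; split.
    rewrite cat_uniq us ut andbT /=; apply/hasPn => e et; apply/negP => es.
    have /andP[h1 h2] := hn e es.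
    by case: (ht e et) => /reach_idx; rewrite leqNgt ?h1 ?h2.
  move=> e; rewrite mem_cat => /orP[/hs//|/ht[h|h]]; [left|right];
    exact: vertex_end_sub h.
rewrite big_cat /=; lra.
Qed.

(** Removing [vnum n] from its component leaves pieces that each contain a neighbour of it. Local
    finiteness makes them finitely many, so one of them contains infinitely many points of [S]. *)
Lemma infinite_component_step (S : set V) n v : (n <= vidx v)%N ->
  infinite_set (S `&` reach n v) ->
  exists v', [/\ (n < vidx v')%N, infinite_set (S `&` reach n.+1 v') &
    reach n v v'].
Proof.
move=> nv infS; have [h|h] := pselect (reach n v (vnum n)); last first.
  exists v; split.
  - rewrite ltn_neqAle nv andbT; apply/eqP => e.
    by apply: h; rewrite e vidxK; apply: reach_refl; rewrite -e.
  - apply: contra_not infS; apply: sub_finite_set => y [Sy vy].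
    by split => //; exact: reach_avoid.
  - exact: reach_refl.
pose N := [set z | adjacent (vnum n) z].
apply: contrapT => hno; apply: infS.
apply: (@sub_finite_set _ _ ([set vnum n] `|`
   \bigcup_(z in N `&` [set z | (n < vidx z)%N]) (S `&` reach n.+1 z))).
  move=> y [Sy vy]; have := reach_trans (reach_sym h) vy.
  (* A simple path from [vnum n] never returns there, so after its first step it stays within one
     piece. *)
  move=> [_ [p [pp ly]]]; move: ly; case/shortenP: pp => -[|z q] /= pq uq _ ly.
    by left.
  right; case/andP: pq => /andP[adj nz] pq.
  have S' x : x \in z :: q -> (n <= vidx x)%N -> (n < vidx x)%N.
    move=> xq nx; rewrite ltn_neqAle nx andbT; apply/eqP => ex.
    by move/andP: uq => [/negP+ _]; apply; rewrite ex vidxK.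
  have lz : (n < vidx z)%N by apply: S' => //; exact: mem_head.
  exists z; first by split => //; exact/asboolP.
  split => //; split => //; exists q; split => //.
  elim: (q) (z) pq S' {ly uq lz nz adj} => //= x r ih z' /andP[/andP[a nx] pr] S'.
  rewrite /step a S' ?nx ?inE ?eqxx ?orbT//=; apply: ih => // x' x'r.
  by apply: S'; rewrite in_cons x'r orbT.
rewrite finite_setU; split; first exact: finite_set1.
apply: bigcup_finite; first exact: finite_setIl (adjacent_finite _).
move=> z [Nz nz]; apply: contrapT => infz; apply: hno; exists z; split => //.
apply: reach_trans h _; case: Nz => e j.
by apply: reach_edge j _ _; rewrite ?vnumK// ltnW.
Qed.

Lemma infinite_vertex_end (S : set V) : infinite_set S ->
  exists2 w, vertex_end w & forall n, infinite_set (S `&` reach n (w n)).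
Proof.
move=> infS.
pose P n v := (n <= vidx v)%N /\ infinite_set (S `&` reach n v).
have /choice[f hf] : forall nv : nat * V, exists v', P nv.1 nv.2 ->
    P nv.1.+1 v' /\ reach nv.1 nv.2 v'.
  move=> [n v] /=; have [[nv inf]|h] := pselect (P n v); last by exists v.
  by have [v' [h1 h2 h3]] := infinite_component_step nv inf; exists v'.
pose w := fix w n := if n is m.+1 then f (m, w m) else vnum 0.
have Pw n : P n (w n).
  elim: n => [|n ih] /=; last by have [] := hf (n, w n) ih.
  split => //; apply: contra_not infS; apply: sub_finite_set => x Sx.
  by split => //; exact: reach0.
by exists w => [n|n]; [have [] := hf (n, w n) (Pw n)|have [] := Pw n].
Qed.

End combinatorics.

(** * Ends as sequences of components *)

Section ends_of_metric_graph.
Context {R : realType} (G : metric_graph R).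
Local Notation V := (vertex G).
Local Notation E := (edge G).
Local Notation M := (mpoint G).

Lemma chart_inner (e : E) t (h : 0 < t < len e) : chart e t = Inner h.
Proof.
rewrite /chart; case: pselect => [h'|//].
by congr Inner; exact: bool_irrelevance.
Qed.

Lemma chart0 (e : E) : chart e 0 = Vertex (src e).
Proof.
rewrite /chart; case: pselect => [h|_]; last by rewrite lexx.
by case/andP: (h); rewrite ltxx.
Qed.

Lemma chart_len (e : E) : chart e (len e) = Vertex (tgt e).
Proof.
rewrite /chart; case: pselect => [h|_]; last by rewrite leNgt len_gt0.
by case/andP: (h); rewrite ltxx.
Qed.

Lemma chart_ends (e : E) t : 0 <= t <= len e ->
  [\/ t = 0, t = len e | 0 < t < len e].
Proof.
move=> /andP[]; rewrite le_eqVlt => /predU1P[->|t0]; first by constructor 1.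
by rewrite le_eqVlt => /predU1P[->|tl]; [constructor 2|constructor 3; rewrite t0].
Qed.

(** In each chart the preimage is either empty or all of [0, |e|] up to endpoints, hence open in the
    subspace topology. The sets built from vertices and whole edge interiors are of this kind. *)
Lemma open_edgewise (U : set M) :
  (forall e, (forall t, 0 <= t <= len e -> ~ U (chart e t)) \/
             (forall t, 0 < t < len e -> U (chart e t))) -> open U.
Proof.
move=> hU; change (open_mpoint U) => e; apply/open_subspaceP.
have [h|h] := hU e.
  exists set0; first exact: open0.
  by apply/seteqP; split=> // t /= []; rewrite in_itv /= => Ut /h.
(* [A] is the whole line or the complement of 0, according to whether [U] contains that endpoint;
   likewise [B] for |e|. *)
pose A := [set t : R | t = 0 -> U (chart e t)].
pose B := [set t : R | t = len e -> U (chart e t)].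
have aux (c : R) : open [set t : R | t = c -> U (chart e t)].
  have [Uc|Uc] := pselect (U (chart e c)).
    rewrite (_ : [set _ | _] = setT); first exact: openT.
    by apply/seteqP; split=> // t _ /= ->.
  rewrite (_ : [set _ | _] = ~` [set c]); last first.
    apply/seteqP; split=> t /=; first by move=> tc ct; apply: Uc; rewrite -ct; exact: tc.
    by move=> ct /ct.
  by apply: closed_openC; apply: accessible_closed_set1; apply: hausdorff_accessible; exact: Rhausdorff.
exists (A `&` B); first by apply: openI; exact: aux.
apply/seteqP; split=> t /= [tU tl]; split => //; last by split=> _.
move: tl tU; rewrite in_itv /= => tl [tA tB].
by case: (chart_ends tl) => [te|te|/h//]; [exact: tA|exact: tB].
Qed.

(** The interiors of edges with a single end in [C] are included, which makes the set open; its
    closure adds only vertices. *)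
Definition comp_set (C : set V) : set M :=
  [set x | match x with
    | Vertex v => C v
    | Inner e t _ => touches C e
    end].

Lemma comp_setS (C D : set V) : C `<=` D -> comp_set C `<=` comp_set D.
Proof. by move=> CD [v|e t h] /= => [/CD//|[/CD|/CD]]; [left|right]. Qed.

Lemma comp_set_chart (C : set V) e t : 0 <= t <= len e ->
  comp_set C (chart e t) -> touches C e.
Proof.
move=> tl; case: (chart_ends tl) => [->|->|h].
- by rewrite chart0; left.
- by rewrite chart_len; right.
- by rewrite (chart_inner h).
Qed.

Lemma comp_set_open (C : set V) : open (comp_set C).
Proof.
apply: open_edgewise => e; have [te|te] := pselect (touches C e); last first.
  by left => t tl /(comp_set_chart tl).
by right => t h; rewrite (chart_inner h).
Qed.

Definition ecomp n (u : V) : set M := comp_set (reach n u).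

Lemma ecomp_open n u : open (ecomp n u). Proof. exact: comp_set_open. Qed.

(** An edge leaving the component ends at a vertex of index < n. So the boundary of [ecomp n u] is
    finite, and its trace on a set avoiding these vertices is relatively clopen. *)
Lemma ecomp_closed_off n u :
  closed (ecomp n u `|` [set x | if x is Vertex v then (vidx v < n)%N else false]).
Proof.
rewrite -openC; apply: open_edgewise => e.
have [te|te] := pselect (touches (reach n u) e); last first.
  by right => t h; rewrite (chart_inner h) => -[|].
left => t tl; apply; case: (chart_ends tl) => [->|->|h].
- rewrite chart0; case: te => [ue|ue]; first by left.
  case: (ltnP (vidx (src e)) n) => h; first by right.
  left; apply: (reach_trans ue); apply: reach_edge (h).
    by rewrite joins_sym; exact: joins_ends.
  exact: reach_idx ue.
- rewrite chart_len; case: te => [ue|ue]; last by left.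
  case: (ltnP (vidx (tgt e)) n) => h; first by right.
  left; apply: (reach_trans ue); apply: reach_edge (h); first exact: joins_ends.
  exact: reach_idx ue.
- by rewrite (chart_inner h); left.
Qed.

(** A common inner point lies on an edge touching both components; if it touches them at different
    ends, these have index at least m and the edge itself connects them. *)
Lemma ecomp_inter m n u v x : (m <= n)%N -> ecomp m u x -> ecomp n v x ->
  reach m u v.
Proof.
move=> mn; case: x => [y|e t h] /=.
  by move=> uy vy; apply: reach_trans uy (reach_sym _); exact: reach_le vy.
move=> ue ve; suff [y uy vy] : exists2 y, reach m u y & reach n v y.
  by apply: reach_trans uy (reach_sym _); exact: reach_le vy.
case: ue ve => ue [ve|ve]; try (by eexists; eassumption).
  exists (tgt e) => //; apply: (reach_trans ue).
  apply: reach_edge (joins_ends e) _ _; first exact: reach_idx ue.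
  by apply: leq_trans mn _; exact: reach_idx ve.
exists (src e) => //; apply: (reach_trans ue).
apply: (@reach_edge _ _ _ e); first by rewrite joins_sym; exact: joins_ends.
  exact: reach_idx ue.
by apply: leq_trans mn _; exact: reach_idx ve.
Qed.

Lemma ecomp_sub m n u v : (m <= n)%N -> reach m u v -> ecomp n v `<=` ecomp m u.
Proof.
move=> mn uv; apply: comp_setS => x vx; apply: reach_trans uv _.
exact: reach_le vx.
Qed.

(** The union of the sets [ecomp n u] over the vertices u of index at least n. *)
Definition late n : set M := comp_set [set v | (n <= vidx v)%N].

Lemma ecomp_late n u : ecomp n u `<=` late n.
Proof. by apply: comp_setS => v; exact: reach_idx. Qed.

Lemma late_sub m n : (m <= n)%N -> late n `<=` late m.
Proof. by move=> mn; apply: comp_setS => v; exact: leq_trans. Qed.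

Lemma late_ecomp n x : late n x -> exists u, ecomp n u x.
Proof.
case: x => [v|e t h] /=; first by exists v; exact: reach_refl.
by case=> he; [exists (src e); left|exists (tgt e); right]; exact: reach_refl.
Qed.

Lemma finite_vidx_bound (A : set V) : finite_set A ->
  exists n, forall v, A v -> (vidx v < n)%N.
Proof.
move=> /finite_seqP[s ->]; exists (\max_(v <- s) vidx v).+1 => v /= vs.
by rewrite ltnS; exact: leq_bigmax_seq.
Qed.

(** The open star of a vertex v is a neighbourhood of x for a suitable v. It meets [late N] only if
    v or one of its neighbours has index at least N, and local finiteness bounds these indices. *)
Lemma closure_late (x : M) : exists N, ~ closure (late N) x.
Proof.
have [v vx] : exists v, comp_set [set v] x.
  by case: x => [v|e t h]; [exists v|exists (src e); left].
have : finite_set ([set v] `|` [set y | adjacent v y]).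
  by rewrite finite_setU; split; [exact: finite_set1|exact: adjacent_finite].
move=> /finite_vidx_bound[N hN]; exists N => /(_ (comp_set [set v])).
have nx : nbhs x (comp_set [set v]).
  by apply: open_nbhs_nbhs; split => //; exact: comp_set_open.
case/(_ nx) => -[y|e t h] /= [].
  by move=> + yv; rewrite yv leqNgt hN//; left.
have hv : (N <= vidx v)%N -> False by rewrite leqNgt hN//; left.
have hadj y : adjacent v y -> (N <= vidx y)%N -> False.
  by move=> vy; rewrite leqNgt hN//; right.
move=> [n1|n1] [ev|ev] /=; move: n1; rewrite ?ev//.
- by apply: hadj; exists e; rewrite -ev joins_sym; exact: joins_ends.
- by apply: hadj; exists e; rewrite -ev; exact: joins_ends.
Qed.

Lemma compact_avoid (K : set M) (A : nat -> set M) : compact K ->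
  (forall m n, (m <= n)%N -> A n `<=` A m) ->
  (forall x, K x -> exists N, ~ closure (A N) x) ->
  exists N, forall n, (N <= n)%N -> K `&` A n = set0.
Proof.
move=> /compact_near_coveringP cK Amono hA.
have := cK nat \oo (fun n x => ~ A n x) _; case.
  move=> x Kx; have [N hN] := hA x Kx.
  exists (~` closure (A N), [set n | (N <= n)%N]); last first.
    by move=> [y n] /= [ny Nn] ny'; apply: ny; apply: subset_closure; exact: Amono ny'.
  split => /=; last by exists N.
  apply: open_nbhs_nbhs; split => //; exact/closed_openC/closed_closure.
move=> N _ hN; exists N => n Nn; apply/seteqP; split=> // x [Kx Ax].
exact: (hN n Nn x Kx).
Qed.

Lemma chart_within (e : E) : {within `[0, len e], continuous (chart e : R -> M)}.
Proof. by apply/continuousP => U oU; exact: oU. Qed.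

(** The part of each touching edge inside the set is the image of an interval, and consecutive edges
    of a path share a vertex. *)
Lemma ecomp_connected n u : (n <= vidx u)%N -> connected (ecomp n u).
Proof.
move=> nu.
pose I (e : E) : set R := [set t | 0 <= t <= len e /\ ecomp n u (chart e t)].
have cI (e : E) : touches (reach n u) e -> connected (chart e @` I e).
  move=> te; apply: connected_continuous_connected; last first.
    apply: (@continuous_subspaceW _ _ _ `[0, len e]) (@chart_within e).
    by move=> t [tl _]; rewrite /= in_itv.
  apply/connected_intervalP => x y [xl Ix] [yl Iy] z /andP[xz zy].
  have zl : 0 <= z <= len e.
    by case/andP: xl => x0 _; case/andP: yl => _ yl; rewrite (le_trans x0)//= (le_trans zy).
  split => //; case: (chart_ends zl) => [z0|zl'|h].
  - suff -> : z = x by []. by apply/le_anti; rewrite xz andbT z0; case/andP: xl.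
  - suff -> : z = y by []. by apply/le_anti; rewrite zy zl'; case/andP: yl.
  - by rewrite (chart_inner h).
have IO (e : E) : chart e @` I e `<=` ecomp n u by move=> _ [t [_ h] <-].
have I0 (e : E) : reach n u (src e) -> (chart e @` I e) (Vertex (src e)).
  move=> ue; exists 0; last exact: chart0.
  by split; [rewrite lexx (ltW (len_gt0 e))|rewrite chart0].
have Il (e : E) : reach n u (tgt e) -> (chart e @` I e) (Vertex (tgt e)).
  move=> ue; exists (len e); last exact: chart_len.
  by split; [rewrite lexx (ltW (len_gt0 e))|rewrite chart_len].
pose CC := connected_component (ecomp n u).
have ev v : reach n u v -> CC (Vertex u) (Vertex v).
  move=> uv; have {uv} : reach n u u /\ reach n u v by split => //; exact: reach_refl.
  move=> [uu [_ [p [pp <-]]]]; rewrite /CC.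
  have : forall x, reach n u x -> path (step n) x p -> CC (Vertex x) (Vertex (last x p)).
    elim: p {pp} => [|y p ih] x ux /= pp; first exact: connected_component_refl.
    case/andP: pp => /andP[/asboolP[e j] ny] pp.
    have uy : reach n u y by apply: (reach_trans ux); exact: reach_edge j (reach_idx ux) ny.
    apply: connected_component_trans (ih y uy pp).
    exists (chart e @` I e).
      split; [|exact: IO|apply: cI]; case/joinsP: j => -[se te].
      + by rewrite -se; apply: I0; rewrite se.
      + by rewrite -te; apply: Il; rewrite te.
      + by left; rewrite se.
      + by left; rewrite se.
    by case/joinsP: j => -[se te]; [rewrite -te; apply: Il; rewrite te|rewrite -se; apply: I0; rewrite se].
  by apply.
suff -> : ecomp n u = CC (Vertex u) by exact: component_connected.
apply/seteqP; split; last exact: connected_component_sub.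
move=> [v|e t h]; first exact: ev.
move=> te; have ct : (chart e @` I e) (Inner h).
  exists t; last exact: chart_inner.
  by split; [case/andP: (h) => h1 h2; rewrite !ltW|rewrite (chart_inner h)].
have [te'|te'] := te.
  apply: connected_component_trans (ev _ te') _.
  by exists (chart e @` I e) => //; split; [exact: I0|exact: IO|exact: cI].
apply: connected_component_trans (ev _ te') _.
by exists (chart e @` I e) => //; split; [exact: Il|exact: IO|exact: cI].
Qed.

Lemma ecomp_end_sequence w : vertex_end w ->
  end_sequence (fun n => ecomp n (w n)).
Proof.
move=> ew; split.
- move=> n; split; last exact: ecomp_open.
  by exists (Vertex (w n)); apply: reach_refl; exact: vertex_end_idx.
- by move=> n; apply: ecomp_connected; exact: vertex_end_idx.
- move=> n; apply: finite_compact.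
  apply: (@sub_finite_set _ _ (@Vertex _ G @` [set v | (vidx v < n)%N])).
    move=> x [cx ix].
    have : closure (ecomp n (w n) `|` [set x | if x is Vertex v then (vidx v < n)%N else false]) x.
      by apply: closureS cx => y; left.
    rewrite -(closure_id _).1; last exact: ecomp_closed_off.
    case=> [ox|]; last by case: x {cx ix} => // v /= vn; exists v.
    exfalso; apply: ix; move: ox; have /interior_id -> := @ecomp_open n (w n).
    by [].
  apply: finite_image; apply: (@sub_finite_set _ _ (@vnum _ G @` `I_n)).
    by move=> v vn; exists (vidx v) => //; exact: vidxK.
  exact: finite_image (finite_II n).
- by move=> n; apply: ecomp_sub => //; case: (ew n) => nu h; split.
- apply/seteqP; split=> // x hx; have [N hN] := closure_late x.
  apply: hN; apply: closureS (hx N I); exact: ecomp_late.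
Qed.

Lemma end_sequence_mono (U : nat -> set M) m n : end_sequence U ->
  (m <= n)%N -> U n `<=` U m.
Proof.
move=> [_ _ _ hU _]; elim: n => [|n ih]; first by rewrite leqn0 => /eqP->.
rewrite leq_eqVlt => /predU1P[->//|/ih h]; exact: subset_trans (hU n) h.
Qed.

(** The trace of [W] on [A] is nonempty and relatively clopen. *)
Lemma connected_clopen_sub (A W Z : set M) : connected A -> open W -> closed Z ->
  A `&` W = A `&` Z -> A `&` W !=set0 -> A `<=` W.
Proof.
move=> cA oW cZ AWZ ne x Ax; have e := cA (A `&` W) ne.
suff : (A `&` W) x by case.
by rewrite e//; [exists W|exists Z].
Qed.

(** The closed edges at the first m vertices form a compact set, and decreasing sets whose closures
    have empty intersection eventually leave it. *)
Lemma end_sequence_late (U : nat -> set M) m : end_sequence U ->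
  exists N, forall n, (N <= n)%N -> U n `<=` late m.
Proof.
move=> hU; case: (hU) => [_ _ _ _ Ucl].
have fe : finite_set (\bigcup_(i in `I_m) incident (vnum G i)).
  by apply: bigcup_finite; [exact: finite_II|move=> i _; exact: locally_finite].
have /finite_seqP[s hs] := fe.
pose K : set M := \big[setU/set0]_(e <- s) (chart e @` `[0, len e]).
have cK : compact K.
  apply: bigsetU_compact => e _; apply: continuous_compact (@chart_within e) _.
  exact: segment_compact.
have [N hN] : exists N, forall n, (N <= n)%N -> K `&` U n = set0.
  apply: compact_avoid => // [p q pq|x Kx]; first exact: end_sequence_mono hU pq.
  apply: contrapT => hx; suff : (\bigcap_n closure (U n)) x by rewrite Ucl.
  by move=> n _; apply: contrapT => hn; apply: hx; exists n.
exists N => n Nn x Ux.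
have nKx : ~ K x by move=> Kx; have : (K `&` U n) x by []; rewrite hN.
have Kc (e : E) t : e \in s -> 0 <= t <= len e -> K (chart e t).
  move=> es tl; rewrite /K -bigcup_seq; exists e => //; exists t => //.
have ins (e : E) v : (vidx v < m)%N -> incident v e -> e \in s.
  move=> vm ve; suff : [set` s] e by [].
  by rewrite -hs; exists (vidx v) => //; rewrite vidxK.
case: x Ux nKx => [v|e t h] _ nKx /=.
  rewrite leqNgt; apply/negP => vm; apply: nKx.
  have [e ve] := incident_nonempty v.
  case: (ve) => <-; [rewrite -chart0|rewrite -chart_len]; apply: Kc;
    by rewrite ?(ins _ _ vm ve)// lexx ltW ?len_gt0.
left; rewrite /= leqNgt; apply/negP => vm; apply: nKx.
rewrite -(chart_inner h); apply: Kc; first by apply: (ins _ _ vm); left.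
by case/andP: (h) => h1 h2; rewrite !ltW.
Qed.

(** Once [U n] avoids the first m vertices, every component at level m is relatively clopen in it,
    so the connected set [U n] lies in a single one. *)
Lemma end_sequence_ecomp (U : nat -> set M) m : end_sequence U ->
  exists N, exists2 u, (m <= vidx u)%N & forall n, (N <= n)%N -> U n `<=` ecomp m u.
Proof.
move=> hU; have [N hN] := end_sequence_late m hU.
case: (hU) => [Uo Uc _ _ _]; have [x Ux] := (Uo N).1.
have [u ux] := late_ecomp (hN N (leqnn N) x Ux).
have mu : (m <= vidx u)%N by case: x ux {Ux} => [v|e t h] /=; [case|case; case].
exists N; exists u => // n Nn; apply: subset_trans (end_sequence_mono hU Nn) _.
apply: connected_clopen_sub (Uc N) (@ecomp_open m u) (@ecomp_closed_off m u) _ _.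
  apply/seteqP; split=> y [Uy h]; split => //; first by left.
  case: h => // hy; have := hN N (leqnn N) y Uy.
  by case: y hy {Uy} => // v /= vm; rewrite leqNgt vm.
by exists x.
Qed.

(** One inclusion is [end_sequence_ecomp]. For the other, a component far out avoids the compact
    boundary of [U n] but meets [U n]; being connected, it lies inside. *)
Lemma end_sequence_vertex_end (U : nat -> set M) : end_sequence U ->
  exists2 w, vertex_end w & end_equiv U (fun n => ecomp n (w n)).
Proof.
move=> hU; case: (hU) => [Uo Uc Ub Ud Ucl].
have /choice[f hf] : forall m, exists Nu : nat * V, (m <= vidx Nu.2)%N /\
    forall n, (Nu.1 <= n)%N -> U n `<=` ecomp m Nu.2.
  move=> m; have [N [u mu h]] := end_sequence_ecomp m hU.
  by exists (N, u).
pose w m := (f m).2.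
have ww p q : (p <= q)%N -> reach p (w p) (w q).
  move=> pq; pose n := maxn (f p).1 (f q).1; have [x Ux] := (Uo n).1.
  apply: (ecomp_inter pq) ((hf p).2 n _ x Ux) ((hf q).2 n _ x Ux).
    exact: leq_maxl.
  exact: leq_maxr.
have ew : vertex_end w by move=> n; exact: ww.
exists w => // n.
have [m hm] : exists m, boundary (U n) `&` late m = set0.
  have [] := @compact_avoid (boundary (U n)) late (Ub n) late_sub.
    by move=> x _; exact: closure_late.
  by move=> m /(_ m (leqnn m)); exists m.
exists m, (f n).1; split; last exact: (hf n).2.
apply: (@connected_clopen_sub _ _ (closure (U n))).
- by apply: ecomp_connected; exact: vertex_end_idx.
- by case: (Uo n).
- exact: closed_closure.
- apply/seteqP; split=> x [ox h]; split => //; first exact: subset_closure.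
  apply: contrapT => nU; suff : (boundary (U n) `&` late m) x by rewrite hm.
  split; last exact: ecomp_late ox.
  by split => // /interior_subset.
- pose k := maxn n (f m).1; have [x Ux] := (Uo k).1.
  exists x; split; first by apply: (hf m).2 Ux; exact: leq_maxr.
  by apply: end_sequence_mono hU _ _ Ux; exact: leq_maxl.
Qed.

End ends_of_metric_graph.

(** * Finite volume, equality of ends, and continuity *)

Section volumes_and_continuity.
Context {R : realType} (G : metric_graph R).
Local Notation V := (vertex G).
Local Notation E := (edge G).
Local Notation M := (mpoint G).

(** With [sum_bound_esum], this trades extended sums for bounds on finite real sums, the form in
    which the estimates are carried out. *)
Lemma esum_sum_bound (T : choiceType) (a : T -> \bar R) (b : T -> R) (P : T -> Prop) :
  (forall e, 0 <= a e)%E -> (forall e, P e -> (b e)%:E <= a e)%E ->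
  (\esum_(e in [set: T]) a e < +oo)%E ->
  exists B, forall s : seq T, uniq s -> (forall e, e \in s -> P e) ->
    \sum_(e <- s) b e <= B.
Proof.
move=> a0 ba fa; exists (fine (\esum_(e in [set: T]) a e)) => s us hs.
rewrite -lee_fin fineK; last by rewrite ge0_fin_numE// esum_ge0.
rewrite -sumEFin; apply: (@le_trans _ _ (\sum_(e <- s) a e)%E).
  by rewrite big_seq [leRHS]big_seq; apply: lee_sum => e /hs/ba.
rewrite fsbig_seq//; apply: ereal_sup_ubound; exists [set` s] => //.
Qed.

Lemma sum_bound_esum (T : choiceType) (a : T -> \bar R) (b : T -> R) (P : T -> Prop) B :
  (forall e, 0 <= b e) ->
  (forall e, P e -> a e <= (b e)%:E)%E -> (forall e, ~ P e -> a e = 0)%E ->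
  (forall s : seq T, uniq s -> (forall e, e \in s -> P e) -> \sum_(e <- s) b e <= B) ->
  (\esum_(e in [set: T]) a e < +oo)%E.
Proof.
move=> b0 ab aN hB; apply: (@le_lt_trans _ _ B%:E); last exact: ltry.
apply: ge_ereal_sup => _ [A [fA _] <-]; rewrite fsbig_finite//=.
pose p e := `[< P e >].
apply: (@le_trans _ _ (\sum_(e <- fset_set A | p e) (b e)%:E)%E).
  rewrite [leRHS]big_mkcond; apply: lee_sum => e _; case: ifPn => [/asboolP/ab//|/asboolP/aN->//].
rewrite sumEFin lee_fin -big_filter; apply: hB; first exact: filter_uniq.
by move=> e; rewrite mem_filter => /andP[/asboolP].
Qed.

Local Notation mu := (@lebesgue_measure R).

Lemma bounded_vol (C : set V) B : sum_bound (@len _ G) C B ->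
  (vol (comp_set C) < +oo)%E.
Proof.
move=> hB; apply: (sum_bound_esum (b := @len _ G) (P := touches C)) hB.
- by move=> e; rewrite ltW// len_gt0.
- move=> e te; have -> : (len e)%:E = mu `[0%R, len e].
    by rewrite lebesgue_measure_itv/= lte_fin len_gt0 sube0.
  rewrite /mu; apply: le_outer_measure.
  by move=> t [].
- move=> e te; rewrite (_ : _ `&` _ = set0) ?measure0//.
  apply/seteqP; split => // t [/=]; rewrite in_itv /= => tl ct; apply: te.
  exact: comp_set_chart tl ct.
Qed.

Lemma vol_bounded (C : set V) (U : set M) : comp_set C `<=` U ->
  (vol U < +oo)%E -> exists B, sum_bound (@len _ G) C B.
Proof.
move=> CU; apply: esum_sum_bound => // e te.
have -> : (len e)%:E = mu `]0%R, len e[.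
  by rewrite lebesgue_measure_itv/= lte_fin len_gt0 sube0.
apply: le_outer_measure => t /=; rewrite in_itv /= => h; split.
  by rewrite in_itv /=; case/andP: h => h1 h2; rewrite !ltW.
by apply: CU; rewrite (chart_inner h).
Qed.

Definition end_class (w : nat -> V) : set (nat -> set M) :=
  [set U | end_sequence U /\ end_equiv (fun n => ecomp n (w n)) U].

Lemma end_equiv_sym (U U' : nat -> set M) : end_equiv U U' -> end_equiv U' U.
Proof. by move=> h n; have [j [k []]] := h n; exists k, j. Qed.

Lemma end_equiv_trans (U1 U2 U3 : nat -> set M) :
  end_equiv U1 U2 -> end_equiv U2 U3 -> end_equiv U1 U3.
Proof.
move=> h12 h23 n; have [j [_ [h1 _]]] := h12 n; have [_ [k [_ h2]]] := h23 n.
have [j' [_ [h3 _]]] := h23 j; have [_ [k' [_ h4]]] := h12 k.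
by exists j', k'; split; [exact: subset_trans h3 h1|exact: subset_trans h4 h2].
Qed.

Lemma end_class_self w : vertex_end w -> end_class w (fun n => ecomp n (w n)).
Proof.
move=> ew; split; first exact: ecomp_end_sequence.
by move=> n; exists n, n; split.
Qed.

Lemma end_class_topological w : vertex_end w -> topological_end G (end_class w).
Proof. by move=> ew; exists (fun n => ecomp n (w n)); first exact: ecomp_end_sequence. Qed.

Lemma topological_end_class gamma : topological_end G gamma ->
  exists2 w, vertex_end w & gamma = end_class w.
Proof.
move=> [U hU ->]; have [w ew Uw] := end_sequence_vertex_end hU; exists w => //.
apply/seteqP; split=> U' [hU' UU']; split => //.
  exact: end_equiv_trans (end_equiv_sym Uw) UU'.
exact: end_equiv_trans Uw UU'.
Qed.

Definition finite_volume_vertex_end (w : nat -> V) : Prop :=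
  exists n B, sum_bound (@len _ G) (reach n (w n)) B.

Lemma finite_volume_endP w : vertex_end w ->
  finite_volume_end G (end_class w) <-> finite_volume_vertex_end w.
Proof.
move=> ew; split=> [[_ [U [hU Uw] [n Un]]]|[n [B hB]]].
  have [_ [k [_ h]]] := Uw n; have [B hB] := vol_bounded h Un.
  by exists k, B.
split; first exact: end_class_topological.
exists (fun n => ecomp n (w n)); first exact: end_class_self.
by exists n; exact: bounded_vol hB.
Qed.

Lemma end_class_eq w w' : vertex_end w -> vertex_end w' ->
  end_class w = end_class w' -> forall n, reach n (w n) (w' n).
Proof.
move=> ew ew' ww n.
have : end_class w (fun n => ecomp n (w' n)) by rewrite ww; exact: end_class_self.
move=> [_ /(_ n)[j [_ [h _]]]].
have hx m : ecomp m (w' m) (Vertex (w' m)) by apply: reach_refl; exact: vertex_end_idx.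
have h1 := h _ (hx j); have [nj|jn] := leqP n j.
  apply: reach_trans h1 (reach_sym _); exact: vertex_end_le.
exact: (h (Vertex (w' n)) (vertex_end_le ew' (ltnW jn))).
Qed.

(** If the components of w and w' agreed at every level, the two sequences [ecomp] would coincide;
    components that differ at one level stay disjoint afterwards. *)
Lemma end_class_neq w w' : vertex_end w -> vertex_end w' ->
  end_class w <> end_class w' -> exists n, forall m x, (n <= m)%N ->
    reach m (w m) x -> reach m (w' m) x -> False.
Proof.
move=> ew ew' ww; apply: contrapT => h; apply: ww.
have hw n : reach n (w n) (w' n).
  apply: contrapT => hn; apply: h; exists n => m x nm mx m'x; apply: hn.
  apply: reach_trans (vertex_end_le ew nm) _.
  apply: reach_trans (_ : reach n (w m) x) _; first exact: reach_le mx.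
  apply: reach_trans (reach_sym (reach_le nm m'x)) _.
  by apply: reach_sym; exact: vertex_end_le.
have e n : ecomp n (w n) = ecomp n (w' n).
  by apply/seteqP; split; apply: ecomp_sub => //; exact: reach_sym.
by rewrite /end_class (_ : (fun n => _) = fun n => ecomp n (w' n))//; apply/funext.
Qed.

(** The topology is a quotient of the edges, so continuity is checked in the charts; agreement at
    the vertices is built into [f] being a function on [mpoint]. *)
Lemma Ccontinuous_edgewise (f : M -> R[i]) :
  (forall e, exists du, derivL2 (len e) (edge_component f e) du) ->
  forall x, Ccontinuous_at f x.
Proof.
move=> hf; suff : continuous (f : M -> R[i]^o) by [].
apply/continuousP => U oU; change (open_mpoint (f @^-1` U)) => e.
have [du /derivL2P[a1 a2]] := hf e.
have l0 : 0 <= len e := ltW (len_gt0 e).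
have c1 := ac_within l0 a1; have c2 := ac_within l0 a2.
suff /continuousP : {within `[0, len e], continuous (edge_component f e : R -> R[i]^o)}.
  by apply.
move=> t; apply/cvgrPdist_lt => -[eps eps'] /=; rewrite ltcE /= => /andP[/eqP-> eps0].
have e2 : 0 < eps / 2 by rewrite divr_gt0.
have /cvgrPdist_lt/(_ _ e2) h1 := c1 t.
have /cvgrPdist_lt/(_ _ e2) h2 := c2 t.
near=> s.
rewrite normc_def ltcR -[ltRHS](@ger0_norm _ eps) ?ltW// -sqrtr_sqr ltr_sqrt ?exprn_gt0//.
have k1 : `|complex.Re (edge_component f e t - edge_component f e s)| < eps / 2.
  by rewrite raddfB; near: s; exact: h1.
have k2 : `|complex.Im (edge_component f e t - edge_component f e s)| < eps / 2.
  by rewrite raddfB; near: s; exact: h2.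
move: k1 k2; set p := complex.Re _; set q := complex.Im _.
rewrite !ltr_norml => /andP[k1 k1'] /andP[k2 k2']; nra.
Unshelve. all: by end_near.
Qed.

End volumes_and_continuity.

(** * The Dirichlet problem *)

Section cluster_family.
Context {R : realType}.

(** Along an ultrafilter finer than the filter of eventual events all these bounded sequences
    converge at once. The conclusion keeps the simultaneous approximation of finitely many of them
    at arbitrarily late indices. *)
Lemma cluster_family (T : eqType) (a : nat -> T -> R) (B : T -> R) (N : T -> nat) :
  (forall t n, (N t <= n)%N -> `|a n t| <= B t) ->
  exists b : T -> R, forall (s : seq T) (d : R) m, 0 < d ->
    exists2 n, (m <= n)%N & forall t, t \in s -> `|a n t - b t| < d.
Proof.
move=> hB; have [F [FU Foo]] := ultraFilterLemma (@eventually_filter).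
have hF m : F [set n | (m <= n)%N] by apply: Foo; exists m.
have /choice[b hb] : forall t, exists p : R, a n t @[n --> F] --> p.
  move=> t; have FA : F [set n | [set` `[- B t, B t]] (a n t)].
    apply: filterS (hF (N t)) => n /= Nn.
    by have := hB t n Nn; rewrite ler_norml in_itv.
  have [p [_ hp]] := @segment_compact R (- B t) (B t) ((a ^~ t) @ F) _ FA.
  exists p => W nW.
  have [//|hW] := in_ultra_setVsetC ((a ^~ t) @^-1` W) FU.
  by have [x [h1 h2]] := hp (~` W) W hW nW.
exists b => s d m d0.
suff : F [set n | forall t, t \in s -> `|a n t - b t| < d].
  move=> h; have [n [h1 h2]] := filter_ex (filterI h (hF m)).
  by exists n.
elim: s => [|t s ih]; first by apply: filterS (hF 0%N).
have /cvgrPdist_lt/(_ _ d0) ht := hb t.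
apply: filterS2 ih ht => n h1 h2 t'; rewrite inE => /predU1P[->|/h1//].
by rewrite distrC.
Qed.

End cluster_family.

Section function_spaces.
Context {R : realType} (G : metric_graph R).
Local Notation V := (vertex G).
Local Notation E := (edge G).
Local Notation M := (mpoint G).
Local Notation mu := (@lebesgue_measure R).

Definition sqint (l : R) (u : R -> R[i]) : R := \int[mu]_(t in `[0, l]) sqabs (u t).

Lemma sqint_ge0 l u : 0 <= sqint l u.
Proof. by apply: Rintegral_ge0 => t _; exact: sqabs_ge0. Qed.

Lemma sqint0 l : sqint l (fun=> 0) = 0.
Proof.
rewrite /sqint (@eq_Rintegral _ _ _ _ _ (cst 0)); last by move=> t _; rewrite sqabs0.
by rewrite Rintegral_cst// mul0r.
Qed.

Lemma inL2GP (h : E -> R -> R[i]) : inL2G h <->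
  (forall e, inL2 (len e) (h e)) /\
  exists B, forall s : seq E, uniq s -> \sum_(e <- s) sqint (len e) (h e) <= B.
Proof.
split=> [[mh fh]|[hh [B hB]]].
  have hh e : inL2 (len e) (h e).
    split => //; apply: le_lt_trans fh.
    rewrite -(@esum_set1 _ _ e (fun e => sqnormL2 (len e) (h e))); last first.
      by apply: integral_ge0 => t _; rewrite lee_fin addr_ge0 ?sqr_ge0.
    apply: esum_ge; exists [set e]; first by split.
    by rewrite esum_set1 ?fsbig_set1//; apply: integral_ge0 => t _; rewrite lee_fin addr_ge0 ?sqr_ge0.
  split => //.
  have [||B hB] := @esum_sum_bound R E _ (fun e => sqint (len e) (h e)) (fun=> True) _ _ fh.
  - by move=> e; apply: integral_ge0 => t _; rewrite lee_fin addr_ge0 ?sqr_ge0.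
  - by move=> e _; rewrite sqnormL2E.
  - by exists B => s us; apply: hB.
split; first by move=> e; case: (hh e).
apply: (@sum_bound_esum R E _ (fun e => sqint (len e) (h e)) (fun=> True) B).
- by move=> e; exact: sqint_ge0.
- by move=> e _; rewrite sqnormL2E.
- by [].
- by move=> s us _; exact: hB.
Qed.

End function_spaces.

(** * Energy estimate at finitely many vertices *)

Section finite_subgraph.
Context {R : realType} (G : metric_graph R) (s : R).
Hypothesis s2 : s ^+ 2 = 1.
Local Notation V := (vertex G).
Local Notation E := (edge G).
Local Notation M := (mpoint G).
Local Notation z := (0 +i* s)%C.

Definition incseq (v : V) : seq E := fset_set (incident v).

Lemma incseq_uniq v : uniq (incseq v). Proof. exact: fset_uniq. Qed.

Lemma mem_incseq v e : (e \in incseq v) = (src e == v) || (tgt e == v).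
Proof.
rewrite /incseq in_fset_set; last exact: locally_finite.
apply/idP/orP => [/set_mem[->|->]|[/eqP h|/eqP h]]; first by left; exact: eqxx.
- by right; exact: eqxx.
- by apply/mem_set; left.
- by apply/mem_set; right.
Qed.

Lemma fsum_incident (W : nmodType) v (F : E -> W) :
  \sum_(e \in incident v) F e = \sum_(e <- incseq v) F e.
Proof. by rewrite fsbig_finite//; exact: locally_finite. Qed.

Lemma incseq_sum (W : nmodType) (D : seq E) v (F : E -> W) : uniq D ->
  {subset incseq v <= D} -> (forall e, e \notin incseq v -> F e = 0) ->
  \sum_(e <- D) F e = \sum_(e <- incseq v) F e.
Proof.
move=> uD sD F0; rewrite (bigID (mem (incseq v))) /= [X in _ + X]big1 ?addr0; last first.
  by move=> e /F0.
rewrite -big_filter; apply: perm_big; apply: uniq_perm.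
- exact: filter_uniq.
- exact: incseq_uniq.
- move=> e; rewrite mem_filter; apply/andP/idP => [[]//|h]; split => //; exact: sD.
Qed.

Definition touchseq n : seq E := fset_set (\bigcup_(i in `I_n) incident (vnum G i)).

Lemma mem_touchseq n e :
  (e \in touchseq n) = (vidx (src e) < n)%N || (vidx (tgt e) < n)%N.
Proof.
rewrite /touchseq in_fset_set; last first.
  by apply: bigcup_finite; [exact: finite_II|move=> i _; exact: locally_finite].
apply/idP/orP => [/set_mem[i /= ni [->|->]]|[h|h]].
- by left; rewrite vnumK.
- by right; rewrite vnumK.
- by apply/mem_set; exists (vidx (src e)) => //=; rewrite vidxK; left.
- by apply/mem_set; exists (vidx (tgt e)) => //=; rewrite vidxK; right.
Qed.

Lemma touchseq_uniq n : uniq (touchseq n). Proof. exact: fset_uniq. Qed.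

Lemma bracketD u d d' : bracket s u (d + d') = bracket s u d + bracket s u d' :> R.
Proof. by rewrite /bracket !raddfD /=; ring. Qed.
Lemma bracketN u d : bracket s u (- d) = - bracket s u d :> R.
Proof. by rewrite /bracket !raddfN /=; ring. Qed.
Lemma bracket0r u : bracket s u 0 = 0 :> R.
Proof. by rewrite /bracket /=; ring. Qed.
Lemma bracket0l d : bracket s 0 d = 0 :> R.
Proof. by rewrite /bracket /=; ring. Qed.

(** When [energy_le] is added over the edges, the boundary terms regroup by vertex into brackets of
    [U v] with the sum of the outward derivatives. They vanish at the first n vertices by Kirchhoff
    and elsewhere because [U v] = 0. *)
Lemma energy_finite_subgraph n (u du h : E -> R -> R[i]) (U : V -> R[i]) :
  (forall e, u e 0 = U (src e) /\ u e (len e) = U (tgt e)) ->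
  (forall e, derivL2 (len e) (u e) (du e)) ->
  (forall e, derivL2 (len e) (du e) (fun t => - (z * u e t + h e t))) ->
  (forall e, inL2 (len e) (h e)) ->
  (forall v, (n <= vidx v)%N -> U v = 0) ->
  (forall v, (vidx v < n)%N ->
     \sum_(e <- incseq v) outward_derivative (du e) v e = 0) ->
  \sum_(e <- touchseq n) h1sq (len e) (u e) (du e) <=
  2 * \sum_(e <- touchseq n) sqint (len e) (h e).
Proof.
move=> uU hu hdu hh U0 K.
(* [F e v] is the share of [v] in minus the boundary term of [e], written with outward
   derivatives. *)
pose F e v := (if src e == v then bracket s (U v) (du e 0) else 0)
  + (if tgt e == v then bracket s (U v) (- du e (len e)) else 0).
have FE e : \sum_(i < n) F e (vnum G i) =
    bracket s (u e 0) (du e 0) - bracket s (u e (len e)) (du e (len e)).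
  have aux (x : V) (d : R[i]) :
      \sum_(i < n) (if x == vnum G i then bracket s (U (vnum G i)) d else 0) =
      bracket s (U x) d.
    have [xn|xn] := ltnP (vidx x) n; last first.
      rewrite U0// bracket0l big1// => i _; case: eqP => // xi; exfalso.
      by move: xn; rewrite xi vnumK leqNgt ltn_ord.
    rewrite (bigD1 (Ordinal xn))//= vidxK eqxx big1 ?addr0// => i ine.
    by case: eqP => // xi; case/eqP: ine; apply: val_inj; rewrite /= xi vnumK.
  by rewrite big_split /= !aux bracketN; have [-> ->] := uU e.
have Fsum : \sum_(e <- touchseq n) \sum_(i < n) F e (vnum G i) = 0.
  rewrite exchange_big /= big1// => i _.
  rewrite (@incseq_sum _ _ (vnum G i)).
  - transitivity (bracket s (U (vnum G i)) (\sum_(e <- incseq (vnum G i))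
       outward_derivative (du e) (vnum G i) e)); last first.
      by rewrite K ?bracket0r// vnumK.
    rewrite (big_morph _ (bracketD (U (vnum G i))) (bracket0r _)).
    rewrite big_seq [RHS]big_seq; apply: eq_bigr => e.
    rewrite mem_incseq /F /outward_derivative.
    case: (eqVneq (src e) (vnum G i)) => [<-|_] /=.
      rewrite [tgt e == _]eq_sym; case: (eqVneq (src e) (tgt e)) => [h'|_].
        by have := @no_loop _ _ e.
      by rewrite addr0.
    by move=> ->; rewrite add0r.
  - exact: touchseq_uniq.
  - move=> e; rewrite mem_incseq mem_touchseq => /orP[|] /eqP ->;
      by rewrite vnumK ltn_ord ?orbT.
  - move=> e; rewrite mem_incseq negb_or /F => /andP[/negbTE-> /negbTE->].
    exact: addr0.
apply: (@le_trans _ _ (\sum_(e <- touchseq n) (2 * sqint (len e) (h e)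
   + 2 * (- \sum_(i < n) F e (vnum G i))))).
  apply: ler_sum => e _; rewrite FE opprB.
  apply: energy_le => //; exact: ltW (len_gt0 e).
by rewrite big_split /= -!mulr_sumr sumrN Fsum oppr0 mulr0 addr0.
Qed.

Definition sub_touch n (t : seq E) := forall e, e \in t ->
  (vidx (src e) < n)%N || (vidx (tgt e) < n)%N.

Lemma sum_touchseq n (b : E -> R) t : (forall e, 0 <= b e) -> uniq t ->
  sub_touch n t -> \sum_(e <- t) b e <= \sum_(e <- touchseq n) b e.
Proof.
move=> b0 ut ht; have pe : perm_eq t [seq e <- touchseq n | e \in t].
  apply: uniq_perm => //; first by apply: filter_uniq; exact: touchseq_uniq.
  move=> e; rewrite mem_filter mem_touchseq.
  by apply/idP/andP => [et|[]//]; split => //; exact: ht.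
rewrite (perm_big _ pe) big_filter [leRHS](bigID (mem t)) /= lerDl.
by apply: sumr_ge0.
Qed.

Lemma edge_basis : exists A dA B dB : E -> R -> R[i], forall e,
  [/\ derivL2 (len e) (A e) (dA e) /\
        derivL2 (len e) (dA e) (fun t => - (z * A e t)),
      derivL2 (len e) (B e) (dB e) /\
        derivL2 (len e) (dB e) (fun t => - (z * B e t)),
      A e 0 = 1 /\ A e (len e) = 0 & B e 0 = 0 /\ B e (len e) = 1].
Proof.
have /choice[A] := fun e : E => two_point_basis (len_gt0 e) s2.
move=> /choice[dA] /choice[B] /choice[dB] h.
by exists A, dA, B, dB.
Qed.

End finite_subgraph.

(** * Edgewise solutions with prescribed vertex values *)

Section harmonic_extension.
Context {R : realType} (G : metric_graph R) (s : R).
Hypothesis s2 : s ^+ 2 = 1.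
Local Notation V := (vertex G).
Local Notation E := (edge G).
Local Notation z := (0 +i* s)%C.
Context (A dA B dB : E -> R -> R[i]).
Hypothesis basis : forall e,
  [/\ derivL2 (len e) (A e) (dA e) /\
        derivL2 (len e) (dA e) (fun t => - (z * A e t)),
      derivL2 (len e) (B e) (dB e) /\
        derivL2 (len e) (dB e) (fun t => - (z * B e t)),
      A e 0 = 1 /\ A e (len e) = 0 & B e 0 = 0 /\ B e (len e) = 1].

Let l0 (e : E) : 0 <= len e. Proof. exact: ltW (len_gt0 e). Qed.

(** The solution of -u'' = z u on each edge with vertex values [p]. It matches at the vertices by
    construction, so only the Kirchhoff conditions remain to be imposed. *)
Definition ext (p : V -> R[i]) (e : E) (t : R) : R[i] :=
  p (src e) * A e t + p (tgt e) * B e t.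
Definition dext (p : V -> R[i]) (e : E) (t : R) : R[i] :=
  p (src e) * dA e t + p (tgt e) * dB e t.
Definition kirchhoff_sum (p : V -> R[i]) (v : V) : R[i] :=
  \sum_(e <- incseq v) outward_derivative (dext p e) v e.

Lemma ext_ends p e : ext p e 0 = p (src e) /\ ext p e (len e) = p (tgt e).
Proof.
by rewrite /ext; have [_ _ [-> ->] [-> ->]] := basis e;
   rewrite !mulr0 !mulr1 addr0 add0r.
Qed.

Lemma ext_deriv p e : derivL2 (len e) (ext p e) (dext p e).
Proof.
by have [[h1 _] [h2 _] _ _] := basis e; apply: derivL2D => //; exact: derivL2Z.
Qed.

Lemma dext_deriv p e : derivL2 (len e) (dext p e) (fun t => - (z * ext p e t)).
Proof.
have [[_ h1] [_ h2] _ _] := basis e.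
have := derivL2D (l0 e) (derivL2Z (p (src e)) (l0 e) h1) (derivL2Z (p (tgt e)) (l0 e) h2).
by apply: eq_derivL2 => // t _; rewrite /ext; ring.
Qed.

Lemma outwardZD (a b : R[i]) (x y : R -> R[i]) (v : V) (e : E) :
  outward_derivative (fun t => a * x t + b * y t) v e =
  a * outward_derivative x v e + b * outward_derivative y v e.
Proof. by rewrite /outward_derivative; case: ifP => _ //; ring. Qed.

Lemma kirchhoff_sumE p v : kirchhoff_sum p v = \sum_(e <- incseq v)
  (p (src e) * outward_derivative (dA e) v e + p (tgt e) * outward_derivative (dB e) v e).
Proof. by apply: eq_bigr => e _; rewrite -outwardZD. Qed.

Lemma kirchhoff_sumD p q v :
  kirchhoff_sum (fun x => p x + q x) v = kirchhoff_sum p v + kirchhoff_sum q v.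
Proof. by rewrite !kirchhoff_sumE -big_split /=; apply: eq_bigr => e _; ring. Qed.

Lemma kirchhoff_sumB p q v :
  kirchhoff_sum (fun x => p x - q x) v = kirchhoff_sum p v - kirchhoff_sum q v.
Proof. by rewrite !kirchhoff_sumE -sumrB /=; apply: eq_bigr => e _; ring. Qed.

Lemma kirchhoff_sum_sum n (c : 'I_n -> R[i]) (q : 'I_n -> V -> R[i]) v :
  kirchhoff_sum (fun x => \sum_(j < n) c j * q j x) v = \sum_(j < n) c j * kirchhoff_sum (q j) v.
Proof.
rewrite kirchhoff_sumE; under [RHS]eq_bigr do rewrite kirchhoff_sumE mulr_sumr.
rewrite exchange_big /=; apply: eq_bigr => e _.
by rewrite !mulr_suml -big_split /=; apply: eq_bigr => j _; ring.
Qed.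

(** At each vertex the Kirchhoff sum is a linear form in finitely many values of [p]; as [K] is
    independent of [p], the condition passes to limits of vertex values. *)
Lemma kirchhoff_sum_small v : exists2 K : R, 0 <= K & forall (p : V -> R[i]) (d : R),
  0 <= d -> (forall e, e \in incseq v -> sqabs (p (src e)) <= d /\ sqabs (p (tgt e)) <= d) ->
  sqabs (kirchhoff_sum p v) <= K * d.
Proof.
rewrite /kirchhoff_sum; elim: (incseq v) => [|e r [K K0 ih]].
  by exists 0 => // p d d0 _; rewrite big_nil sqabs0 mul0r.
pose Ke := 2 * (2 * sqabs (outward_derivative (dA e) v e) +
                2 * sqabs (outward_derivative (dB e) v e)).
exists (Ke + 2 * K) => [|p d d0 hp].
  by rewrite /Ke !addr_ge0 ?mulr_ge0 ?addr_ge0 ?mulr_ge0 ?sqabs_ge0.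
rewrite big_cons; apply: (le_trans (sqabsD_le _ _)).
rewrite [leRHS]mulrDl; apply: lerD; last first.
  rewrite -mulrA ler_pM2l//; apply: ih => // e' he'; apply: hp.
  by rewrite inE he' orbT.
rewrite [dext p e](_ : _ = fun t => p (src e) * dA e t + p (tgt e) * dB e t)//.
rewrite outwardZD /Ke -mulrA ler_pM2l//; apply: (le_trans (sqabsD_le _ _)).
have [h1 h2] := hp e (mem_head _ _).
rewrite [leRHS]mulrDl; apply: lerD; rewrite -mulrA ler_pM2l// sqabsM mulrC;
  apply: ler_wpM2l => //; exact: sqabs_ge0.
Qed.

(** This is a square linear system for the values at the first n vertices, so uniqueness gives
    existence, and uniqueness is the energy estimate with zero right-hand side. *)
Lemma finite_system n (f : V -> R[i]) : exists p : V -> R[i],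
  (forall v, (n <= vidx v)%N -> p v = f v) /\
  (forall v, (vidx v < n)%N -> kirchhoff_sum p v = 0).
Proof.
pose del (j : 'I_n) (v : V) : R[i] := (v == vnum G j)%:R.
pose extv (c : 'rV[R[i]]_n) (v : V) : R[i] := \sum_(j < n) c 0 j * del j v.
pose K : 'M[R[i]]_n := \matrix_(j, i) kirchhoff_sum (del j) (vnum G i).
have extv0 c v : (n <= vidx v)%N -> extv c v = 0.
  move=> nv; apply: big1 => j _; rewrite /del; case: eqP => [vj|_]; last exact: mulr0.
  by move: nv; rewrite vj vnumK leqNgt ltn_ord.
have extvn c (i : 'I_n) : extv c (vnum G i) = c 0 i.
  rewrite /extv (bigD1 i)//= /del eqxx mulr1 big1 ?addr0// => j ji.
  case: eqP => [/(congr1 (@vidx _ G))|_]; last exact: mulr0.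
  by rewrite !vnumK => /val_inj ij; rewrite ij eqxx in ji.
have kirn c (i : 'I_n) : kirchhoff_sum (extv c) (vnum G i) = (c *m K) 0 i.
  rewrite /extv kirchhoff_sum_sum mxE; apply: eq_bigr => j _.
  by rewrite mxE.
have Kunit : K \in unitmx.
  (* A row vector killed by [K] yields a solution that vanishes outside the first n vertices; its
     energy is 0, hence so are its values. *)
  rewrite -row_free_unit -kermx_eq0; apply/rowV0P => c /sub_kermxP cK.
  have U0 v : (n <= vidx v)%N -> extv c v = 0 by exact: extv0.
  have KU v : (vidx v < n)%N -> \sum_(e <- incseq v)
      outward_derivative (dext (extv c) e) v e = 0.
    move=> vn; have := kirn c (Ordinal vn); rewrite /= vidxK cK mxE; exact.
  have en := @energy_finite_subgraph _ G s s2 n (ext (extv c)) (dext (extv c))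
    (fun _ _ => 0) (extv c) (ext_ends (extv c)) (ext_deriv (extv c)) _ _ U0 KU.
  have {}en : \sum_(e <- touchseq G n) h1sq (len e) (ext (extv c) e) (dext (extv c) e) <= 0.
    apply: (le_trans (en _ _)).
    - move=> e; apply: eq_derivL2 (dext_deriv (extv c) e) => // t _.
      by rewrite addr0.
    - move=> e; apply/inL2P; split; exact: L2_cst.
    by rewrite big1 ?mulr0// => e _; exact: sqint0.
  apply/rowP => i; rewrite mxE -extvn; apply/eqP; rewrite -sqabs_eq0 eq_le sqabs_ge0 andbT.
  have [e ie] := incident_nonempty (vnum G i).
  have he : h1sq (len e) (ext (extv c) e) (dext (extv c) e) <= 0.
    apply: le_trans en; rewrite -(big_seq1 +%R e (fun e => h1sq _ (ext (extv c) e) (dext (extv c) e))).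
    apply: sum_touchseq => // [e'|e']; first exact: h1sq_ge0.
    rewrite inE => /eqP ->; case: ie => ->; by rewrite vnumK ltn_ord ?orbT.
  have hs x : 0 <= x <= len e -> sqabs (ext (extv c) e x) <= 0.
    move=> xl; apply: (le_trans (sqabs_sup (len_gt0 e) xl (ext_deriv _ e))).
    by apply: mulr_ge0_le0 => //; rewrite addr_ge0// invr_ge0.
  have [e0 el] := ext_ends (extv c) e.
  case: ie => <-; [rewrite -e0|rewrite -el]; apply: hs; by rewrite ?lexx ?l0.
(* [fo] carries the prescribed values; [b] makes the unknown part cancel its Kirchhoff sums at the
   first n vertices. *)
pose fo v := if (n <= vidx v)%N then f v else 0.
pose b : 'rV[R[i]]_n := \row_i (- kirchhoff_sum fo (vnum G i)).
pose c := b *m invmx K.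
exists (fun v => extv c v + fo v); split=> [v nv|v vn].
  by rewrite extv0// add0r /fo nv.
rewrite kirchhoff_sumD; have := kirn c (Ordinal vn); rewrite /= vidxK => ->.
by rewrite /c mulmxKV// mxE /= vidxK addNr.
Qed.

End harmonic_extension.

Section h1sq_estimates.
Context {R : realType}.
Local Notation mu := (@lebesgue_measure R).

Lemma h1sqD_le l (u v du dv : R -> R[i]) : 0 <= l ->
  derivL2 l u du -> derivL2 l v dv ->
  h1sq l (fun t => u t + v t) (fun t => du t + dv t) <=
  2 * h1sq l u du + 2 * h1sq l v dv.
Proof.
move=> l0 hu hv; have iu := h1sq_integrable l0 hu; have iv := h1sq_integrable l0 hv.
have iuv := h1sq_integrable l0 (derivL2D l0 hu hv).
rewrite /h1sq -!RintegralZl// -RintegralD//; [|exact: itv_integrableZ|exact: itv_integrableZ].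
apply: le_Rintegral => //; first exact: (itv_integrableD (itv_integrableZ 2 iu) (itv_integrableZ 2 iv)).
move=> t _ /=; have := sqabsD_le (u t) (v t); have := sqabsD_le (du t) (dv t).
lra.
Qed.

Lemma h1sqZ l (c : R[i]) (u du : R -> R[i]) : 0 <= l -> derivL2 l u du ->
  h1sq l (fun t => c * u t) (fun t => c * du t) = sqabs c * h1sq l u du.
Proof.
move=> l0 hu; have iu := h1sq_integrable l0 hu.
rewrite /h1sq -RintegralZl//; apply: eq_Rintegral => t _.
by rewrite !sqabsM -mulrDr.
Qed.

Lemma sqint_le_h1sq l (u du : R -> R[i]) : 0 <= l -> derivL2 l u du ->
  sqint l u <= h1sq l u du.
Proof.
move=> l0 hu; apply: le_Rintegral => //; first exact: inL2_sq (derivL2_inL2 l0 hu).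
  exact: h1sq_integrable.
by move=> t _; rewrite lerDl sqabs_ge0.
Qed.

Lemma sqint_deriv_le_h1sq l (u du : R -> R[i]) : 0 <= l -> derivL2 l u du ->
  sqint l du <= h1sq l u du.
Proof.
move=> l0 hu; apply: le_Rintegral => //; first by case: hu => /inL2_sq.
  exact: h1sq_integrable.
by move=> t _; rewrite lerDr sqabs_ge0.
Qed.

Lemma sqintD_le l (u v : R -> R[i]) : inL2 l u -> inL2 l v ->
  sqint l (fun t => u t + v t) <= 2 * sqint l u + 2 * sqint l v.
Proof.
move=> hu hv; have iu := inL2_sq hu; have iv := inL2_sq hv.
rewrite /sqint -!RintegralZl// -RintegralD//; [|exact: itv_integrableZ|exact: itv_integrableZ].
apply: le_Rintegral => //; first exact: inL2_sq (inL2D hu hv).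
  exact: (itv_integrableD (itv_integrableZ 2 iu) (itv_integrableZ 2 iv)).
by move=> t _ /=; exact: sqabsD_le.
Qed.

Lemma sqintZ l (c : R[i]) (u : R -> R[i]) : inL2 l u ->
  sqint l (fun t => c * u t) = sqabs c * sqint l u.
Proof.
move=> /inL2_sq iu; rewrite /sqint -RintegralZl//; apply: eq_Rintegral => t _.
exact: sqabsM.
Qed.

Lemma eq_sqint l (u v : R -> R[i]) : (forall t, 0 <= t <= l -> u t = v t) ->
  sqint l u = sqint l v.
Proof.
by move=> uv; apply: eq_Rintegral => t /set_mem; rewrite /= in_itv /= => /uv ->.
Qed.

End h1sq_estimates.

Section L2_closure.
Context {R : realType} (G : metric_graph R).
Local Notation E := (edge G).

Lemma inL2GD (h k : E -> R -> R[i]) : inL2G h -> inL2G k ->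
  inL2G (fun e t => h e t + k e t).
Proof.
move=> /inL2GP[h1 [B1 hB1]] /inL2GP[k1 [B2 hB2]]; apply/inL2GP; split.
  by move=> e; exact: inL2D.
exists (2 * B1 + 2 * B2) => r ur.
apply: (@le_trans _ _ (\sum_(e <- r) (2 * sqint (len e) (h e) + 2 * sqint (len e) (k e)))).
  by apply: ler_sum => e _; exact: sqintD_le.
rewrite big_split /= -!mulr_sumr; apply: lerD; rewrite ler_pM2l//.
  exact: hB1.
exact: hB2.
Qed.

Lemma inL2GZ (c : R[i]) (h : E -> R -> R[i]) : inL2G h ->
  inL2G (fun e t => c * h e t).
Proof.
move=> /inL2GP[h1 [B1 hB1]]; apply/inL2GP; split.
  by move=> e; exact: inL2Z.
exists (sqabs c * B1) => r ur.
under eq_bigr do rewrite sqintZ//.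
by rewrite -mulr_sumr; apply: ler_wpM2l; [exact: sqabs_ge0|exact: hB1].
Qed.

Lemma eq_inL2G (h k : E -> R -> R[i]) :
  (forall e t, 0 <= t <= len e -> h e t = k e t) -> inL2G h -> inL2G k.
Proof.
move=> hk /inL2GP[h1 [B hB]]; apply/inL2GP; split.
  by move=> e; apply: eq_inL2 (h1 e) => t; exact: hk.
exists B => r ur; apply: le_trans (hB r ur).
by apply: ler_sum => e _; rewrite (eq_sqint (hk e)).
Qed.

End L2_closure.

(** * Uniform decay at the ends of finite volume *)

Section dirichlet_solver.
Context {R : realType} (G : metric_graph R) (s : R).
Hypothesis s2 : s ^+ 2 = 1.
Local Notation V := (vertex G).
Local Notation E := (edge G).
Local Notation M := (mpoint G).
Local Notation z := (0 +i* s)%C.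

Let l0 (e : E) : 0 <= len e. Proof. exact: ltW (len_gt0 e). Qed.

Definition decays (u : V -> R[i]) : Prop := forall w, vertex_end w ->
  finite_volume_vertex_end w -> forall eps : R, 0 < eps ->
  exists n, forall x, reach n (w n) x -> sqabs (u x) <= eps.

(** Crude, from 2 |t| <= 1 + t^2; a bound of any size allows [cluster_family] to be applied. *)
Lemma Re_le_sqabs (x : R[i]) K : sqabs x <= K -> `|complex.Re x| <= 1 + K.
Proof.
rewrite /sqabs ler_norml => h; have := sqr_ge0 (complex.Im x).
have := sqr_ge0 (complex.Re x - 1); have := sqr_ge0 (complex.Re x + 1).
move=> h1 h2 h3; apply/andP; split; nra.
Qed.

Lemma Im_le_sqabs (x : R[i]) K : sqabs x <= K -> `|complex.Im x| <= 1 + K.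
Proof.
rewrite /sqabs ler_norml => h; have := sqr_ge0 (complex.Re x).
have := sqr_ge0 (complex.Im x - 1); have := sqr_ge0 (complex.Im x + 1).
move=> h1 h2 h3; apply/andP; split; nra.
Qed.

Lemma sqabs_small (x : R[i]) (d : R) : 0 <= d <= 1 -> `|complex.Re x| <= d ->
  `|complex.Im x| <= d -> sqabs x <= 2 * d.
Proof.
rewrite /sqabs !ler_norml => /andP[d0 d1] /andP[h1 h2] /andP[h3 h4]; nra.
Qed.

(** [n] can be chosen independent of [N] because the component contains [w N], where [U N] vanishes:
    the value at x is an increment along a path inside a region of small volume, and [B] bounds the
    energy for all [N]. *)
Lemma uniform_decay (U : nat -> V -> R[i]) (u du : nat -> E -> R -> R[i]) (B : R) :
  (forall n e, u n e 0 = U n (src e) /\ u n e (len e) = U n (tgt e)) ->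
  (forall n e, derivL2 (len e) (u n e) (du n e)) ->
  (forall n v, (n <= vidx v)%N -> U n v = 0) ->
  (forall n, \sum_(e <- touchseq G n) h1sq (len e) (u n e) (du n e) <= B) ->
  forall w, vertex_end w -> finite_volume_vertex_end w ->
  forall r : R, 0 < r -> exists n, forall N x, (n <= N)%N -> reach n (w n) x ->
    `|complex.Re (U N x)| <= r /\ `|complex.Im (U N x)| <= r.
Proof.
move=> uU hu U0 hB w ew [n0 [B0 hB0]] r r0.
have B_ge0 : 0 <= B.
  by apply: le_trans (hB 0%N); apply: sumr_ge0 => e _; exact: h1sq_ge0.
(* With this weight the energy contributes at most r; the tail of the lengths is then made at most r
   / lam, and (r + r) / 2 = r. The summand 1 keeps [lam] positive when B = 0. *)
pose lam := (B + 1) / r.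
have lam0 : 0 < lam by rewrite divr_gt0// ltr_wpDl.
have eta0 : 0 < r / lam by rewrite divr_gt0.
have [n n0n hn] := tail_sum (fun e => l0 e) ew hB0 eta0.
exists n => N x nN wx.
(* [B] bounds the energy only over [touchseq G N]; on the other edges both endpoint values vanish
   and there is no increment to pay for. *)
pose D e := if e \in touchseq G N then h1sq (len e) (u N e) (du N e) else 0.
pose b e := (lam * len e + lam^-1 * D e) / 2.
have D0 e : 0 <= D e by rewrite /D; case: ifP => // _; exact: h1sq_ge0.
have b0 e : 0 <= b e.
  by rewrite /b divr_ge0// addr_ge0// mulr_ge0// ?invr_ge0 ltW.
have hb : sum_bound b (reach n (w n)) r.
  move=> t ut ht; rewrite /b -mulr_suml big_split /= -!mulr_sumr.
  have h1 : lam * (\sum_(e <- t) len e) <= r.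
    by rewrite mulrC -ler_pdivlMr//; exact: hn.
  have h2 : lam^-1 * (\sum_(e <- t) D e) <= r.
    rewrite mulrC ler_pdivrMr// /lam mulrC divfK ?gt_eqF//.
    apply: (@le_trans _ _ B); last by rewrite lerDl.
    rewrite /D -big_mkcond /= -big_filter; apply: le_trans (hB N).
    apply: sum_touchseq.
    - by move=> e; exact: h1sq_ge0.
    - exact: filter_uniq.
    - by move=> e; rewrite mem_filter mem_touchseq => /andP[].
  lra.
have UD e : `|complex.Re (U N (tgt e)) - complex.Re (U N (src e))| <= b e /\
            `|complex.Im (U N (tgt e)) - complex.Im (U N (src e))| <= b e.
  have [eN|eN] := boolP (e \in touchseq G N).
    rewrite /b /D eN; have [<- <-] := uU N e.
    by apply: derivL2_diff => //; exact: len_gt0.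
  move: eN; rewrite mem_touchseq negb_or -!leqNgt => /andP[h1 h2].
  by rewrite !U0//= subrr normr0.
have key (a : V -> R) : (forall e, `|a (tgt e) - a (src e)| <= b e) ->
    (forall v, (N <= vidx v)%N -> a v = 0) -> `|a x| <= r.
  move=> ha a0.
  have xw : reach n x (w N) by apply: reach_trans (reach_sym wx) (vertex_end_le ew nN).
  have hbx : sum_bound b (reach n x) r.
    by apply: sum_boundS hb => y xy; exact: reach_trans wx xy.
  have aw : a (w N) = 0 by apply: a0; exact: vertex_end_idx.
  have h e p q : joins e p q -> `|a p - a q| <= b e.
    by move=> /joinsP[[<- <-]|[<- <-]]; rewrite // distrC.
  rewrite ler_norml; apply/andP; split.
    have := @path_sum _ G (fun v => - a v) b n x (w N) r _ hbx xw.
    rewrite aw; move=> /(_ _)/wrap[]; last by lra.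
    by move=> e p q /h; rewrite ler_norml => /andP[]; lra.
  have := @path_sum _ G a b n x (w N) r _ hbx xw.
  rewrite aw add0r; apply => e p q /h; rewrite ler_norml => /andP[]; lra.
split.
  apply: (key (fun v => complex.Re (U N v))) => [e|v Nv]; first by case: (UD e).
  by rewrite U0.
apply: (key (fun v => complex.Im (U N v))) => [e|v Nv]; first by case: (UD e).
by rewrite U0.
Qed.

End dirichlet_solver.

Section solver.
Context {R : realType} (G : metric_graph R) (s : R).
Hypothesis s2 : s ^+ 2 = 1.
Local Notation V := (vertex G).
Local Notation E := (edge G).
Local Notation M := (mpoint G).
Local Notation z := (0 +i* s)%C.

Let l0 (e : E) : 0 <= len e. Proof. exact: ltW (len_gt0 e). Qed.

(* The approximants solve the equation at the first n vertices and agree with f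
   at the others; the limit exists along a cluster point of the vertex values. *)
Lemma dirichlet_solution (f : M -> R[i]) : dom_max_Laplacian G f ->
  exists v : M -> R[i], [/\ ker_max_Laplacian z v, sobolevH1 G (fun x => f x - v x) &
    decays (fun x => f (Vertex x) - v (Vertex x))].
Proof.
move=> [g0 [df [f2 g2 hfd fc fK]]].
have [A [dA [B [dB basis]]]] := edge_basis G s2.
have ends := ext_ends basis.
have dext1 := ext_deriv basis.
have dext2 := dext_deriv basis.
pose F v := f (Vertex v).
(* The difference u of f and any edgewise solution satisfies -u'' = z u + h, with the same h in L^2
   for all of them. *)
pose h (e : E) t := edge_component g0 e t - z * edge_component f e t.
have h2 : inL2G h.
  have := inL2GD g2 (inL2GZ (- z) f2).
  by apply: eq_inL2G => e t _; rewrite /h mulNr.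
have [hh [Bh hBh]] := (inL2GP _).1 h2.
have /choice[phi hphi] := fun n => finite_system s2 basis n F.
pose U n v := F v - phi n v.
pose ue (p : V -> R[i]) e t := edge_component f e t - ext A B p e t.
pose due (p : V -> R[i]) e t := df e t - dext dA dB p e t.
have ue_ends p e : ue p e 0 = F (src e) - p (src e) /\
                   ue p e (len e) = F (tgt e) - p (tgt e).
  by rewrite /ue /edge_component chart0 chart_len; have [-> ->] := ends p e.
have ued p e : derivL2 (len e) (ue p e) (due p e).
  have := derivL2D (l0 e) (hfd e).1 (derivL2Z (-1) (l0 e) (dext1 p e)).
  by apply: eq_derivL2 => // t _; rewrite mulN1r.
have dued p e : derivL2 (len e) (due p e) (fun t => - (z * ue p e t + h e t)).
  have := derivL2D (l0 e) (hfd e).2 (derivL2Z (-1) (l0 e) (dext2 p e)).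
  by apply: eq_derivL2 => // t _; rewrite ?mulN1r// /ue /h; ring.
have outB (p : V -> R[i]) v e : outward_derivative (due p e) v e =
    outward_derivative (df e) v e - outward_derivative (dext dA dB p e) v e.
  by rewrite /outward_derivative /due; case: ifP => _ //; ring.
have fK' v : \sum_(e <- incseq v) outward_derivative (df e) v e = 0.
  by rewrite -fsum_incident.
have U0 n v : (n <= vidx v)%N -> U n v = 0.
  by move=> nv; rewrite /U (hphi n).1// subrr.
have UB n : \sum_(e <- touchseq G n) h1sq (len e) (ue (phi n) e) (due (phi n) e) <= 2 * Bh.
  apply: (le_trans (energy_finite_subgraph s2 (ue_ends (phi n)) (ued (phi n)) (dued (phi n)) hh (U0 n) _)).
    move=> v vn; under eq_bigr do rewrite outB.
    by rewrite sumrB fK' sub0r; have := (hphi n).2 v vn; rewrite /kirchhoff_sum => ->; rewrite oppr0.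
  by rewrite ler_pM2l//; apply: hBh; exact: touchseq_uniq.
have Bh0 : 0 <= Bh by apply: le_trans (hBh [::] isT); rewrite big_nil.
have [/= eo heo] : {eo : V -> E & forall v, incident v (eo v)}.
  by apply: choice => v; exact: incident_nonempty.
have Ubd n v : (vidx v < n)%N -> sqabs (U n v) <= ((len (eo v))^-1 + 2) * (2 * Bh).
  move=> vn; set e := eo v.
  have he : h1sq (len e) (ue (phi n) e) (due (phi n) e) <= 2 * Bh.
    apply: le_trans (UB n); rewrite -(big_seq1 +%R e (fun e => h1sq (len e) (ue (phi n) e) _)).
    apply: sum_touchseq => // [e'|e']; first exact: h1sq_ge0.
    by rewrite inE => /eqP ->; case: (heo v) => ->; rewrite vn ?orbT.
  have hs x : 0 <= x <= len e -> sqabs (ue (phi n) e x) <= ((len e)^-1 + 2) * (2 * Bh).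
    move=> xl; apply: (le_trans (sqabs_sup (len_gt0 e) xl (ued _ e))).
    by apply: ler_wpM2l he; rewrite addr_ge0// invr_ge0.
  have [e0 el] := ue_ends (phi n) e; rewrite /U.
  by case: (heo v) => {1 2}<-; [rewrite -e0|rewrite -el]; apply: hs; rewrite ?lexx ?l0.
(* The boolean selects real or imaginary part. The bound on [U n v] is available for n > [vidx v],
   hence the threshold passed to [cluster_family]. *)
pose a n (vb : V * bool) := if vb.2 then complex.Re (U n vb.1) else complex.Im (U n vb.1).
have [b hb] := @cluster_family R _ a (fun vb => 1 + ((len (eo vb.1))^-1 + 2) * (2 * Bh))
  (fun vb => (vidx vb.1).+1) (fun vb n vn => match vb as vb return
     (vidx vb.1 < n)%N -> `|a n vb| <= 1 + ((len (eo vb.1))^-1 + 2) * (2 * Bh) with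
   | (v, true) => fun vn => Re_le_sqabs (Ubd n v vn)
   | (v, false) => fun vn => Im_le_sqabs (Ubd n v vn) end vn).
pose Uc v := (b (v, true) +i* b (v, false))%C.
have hU (r : seq V) (d : R) m : 0 < d <= 1 -> exists2 n, (m <= n)%N &
    forall v, v \in r -> [/\ sqabs (U n v - Uc v) <= 2 * d,
      `|complex.Re (U n v) - complex.Re (Uc v)| < d &
      `|complex.Im (U n v) - complex.Im (Uc v)| < d].
  move=> /andP[d0 d1].
  have [n mn hn] := hb ([seq (v, true) | v <- r] ++ [seq (v, false) | v <- r]) d m d0.
  exists n => // v vr.
  have h1 : `|complex.Re (U n v) - complex.Re (Uc v)| < d.
    by apply: (hn (v, true)); rewrite mem_cat map_f.
  have h3 : `|complex.Im (U n v) - complex.Im (Uc v)| < d.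
    by apply: (hn (v, false)); rewrite mem_cat map_f ?orbT.
  split => //; apply: sqabs_small; rewrite ?(ltW d0)// raddfB; exact: ltW.
(* A cluster value of [phi n], whose edgewise extension is the desired kernel element. *)
pose p v := F v - Uc v.
pose v0 (x : M) : R[i] := match x with Vertex v => p v | @Inner _ _ e t _ => ext A B p e t end.
have v0E e t : 0 <= t <= len e -> edge_component v0 e t = ext A B p e t.
  move=> tl; rewrite /edge_component; case: (chart_ends tl) => [->|->|ht].
  - by rewrite chart0 /= (ends p e).1.
  - by rewrite chart_len /= (ends p e).2.
  - by rewrite (chart_inner ht).
have ueE e t : 0 <= t <= len e -> edge_component (fun x => f x - v0 x) e t = ue p e t.
  by move=> tl; rewrite /ue -(v0E e t tl).
have UpE n v : phi n v - p v = - (U n v - Uc v) by rewrite /p /U; ring.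
(* The Kirchhoff sum of [phi n] at v is 0 once n > [vidx v], and that of [phi n - p] can be made
   arbitrarily small. *)
have pK v : kirchhoff_sum dA dB p v = 0.
  have [K K0 hK] := @kirchhoff_sum_small _ _ dA dB v.
  apply/eqP; rewrite -sqabs_eq0 eq_le sqabs_ge0 andbT.
  apply/ler_addgt0Pr => eps eps0; rewrite add0r.
  pose d := Num.min 1 (eps / (2 * (K + 1))).
  have K1 : 0 < 2 * (K + 1) by rewrite mulr_gt0// ltr_wpDl.
  have d0 : 0 < d by rewrite lt_min ltr01 divr_gt0.
  have [n vn hn] := hU ([seq src e | e <- incseq v] ++ [seq tgt e | e <- incseq v]) d
    (vidx v).+1 ltac:(by rewrite d0 ge_min lexx).
  have := hK (fun x => phi n x - p x) (2 * d) ltac:(by rewrite mulr_ge0// ltW).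
  rewrite kirchhoff_sumB (hphi n).2// sub0r sqabsN => h4.
  apply: (le_trans (h4 _)).
    move=> e ev; rewrite !UpE !sqabsN.
    have [h5 _ _] := hn (src e) ltac:(by rewrite mem_cat map_f).
    have [h6 _ _] := hn (tgt e) ltac:(by rewrite mem_cat map_f ?orbT).
    by split.
  have : d <= eps / (2 * (K + 1)) by rewrite ge_min lexx orbT.
  rewrite ler_pdivlMr//; have := ltW d0; nra.
pose Ke e := 2 * (h1sq (len e) (A e) (dA e) + h1sq (len e) (B e) (dB e)).
have Ke0 e : 0 <= Ke e by rewrite mulr_ge0// addr_ge0// h1sq_ge0.
have extK (q : V -> R[i]) e d : sqabs (q (src e)) <= d -> sqabs (q (tgt e)) <= d ->
    h1sq (len e) (ext A B q e) (dext dA dB q e) <= Ke e * d.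
  move=> q1 q2; have [[h1 _] [h3 _] _ _] := basis e.
  apply: (le_trans (h1sqD_le (l0 e) (derivL2Z _ (l0 e) h1) (derivL2Z _ (l0 e) h3))).
  rewrite !h1sqZ// /Ke.
  have := ler_wpM2r (h1sq_ge0 (len e) (A e) (dA e)) q1.
  have := ler_wpM2r (h1sq_ge0 (len e) (B e) (dB e)) q2; lra.
(* Comparing with an approximant doubles its bound [2 * Bh]; the error in the vertex values
   contributes 4 * KK * d, at most 1 by the choice of [d]. *)
have Hbd (r : seq E) : uniq r -> \sum_(e <- r) h1sq (len e) (ue p e) (due p e) <= 2 * (2 * Bh) + 1.
  move=> ur.
  pose KK := \sum_(e <- r) Ke e.
  have KK0 : 0 <= KK by exact: sumr_ge0.
  pose d := (4 * (KK + 1))^-1.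
  have K4 : 1 <= 4 * (KK + 1) by lra.
  have d0 : 0 < d by rewrite invr_gt0; lra.
  have d1 : d <= 1 by rewrite invf_le1//; lra.
  pose m := (\max_(e <- r) (maxn (vidx (src e)) (vidx (tgt e)))).+1.
  have [n mn hn] := hU ([seq src e | e <- r] ++ [seq tgt e | e <- r]) d m ltac:(by rewrite d0).
  have rn : sub_touch n r.
    move=> e er; apply/orP; left; apply: leq_trans mn; rewrite ltnS.
    apply: leq_trans (leq_maxl _ (vidx (tgt e))) _.
    exact: leq_bigmax_seq.
  apply: (@le_trans _ _ (\sum_(e <- r) (2 * h1sq (len e) (ue (phi n) e) (due (phi n) e)
     + 2 * (Ke e * (2 * d))))).
    rewrite big_seq [leRHS]big_seq; apply: ler_sum => e er.
    pose q v := phi n v - p v.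
    have := h1sqD_le (l0 e) (ued (phi n) e) (dext1 q e).
    rewrite (_ : (fun t => _ + _) = ue p e); last first.
      by apply/funext => t; rewrite /ue /ext /q; ring.
    rewrite (_ : (fun t => _ + _) = due p e); last first.
      by apply/funext => t; rewrite /due /dext /q; ring.
    move=> h7; apply: (le_trans h7); apply: lerD => //; rewrite ler_pM2l//.
    have [h5 _ _] := hn (src e) ltac:(by rewrite mem_cat map_f).
    have [h6 _ _] := hn (tgt e) ltac:(by rewrite mem_cat map_f ?orbT).
    by apply: extK; rewrite /q UpE sqabsN.
  rewrite big_split /= -!mulr_sumr -mulr_suml -/KK; apply: lerD.
    rewrite ler_pM2l//; apply: le_trans (UB n); apply: sum_touchseq => // e.
    exact: h1sq_ge0.
  have : 4 * (KK + 1) * d = 1 by rewrite mulfV// gt_eqF//; lra.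
  nra.
have u2 : inL2G (ue p).
  apply/inL2GP; split; first by move=> e; exact: derivL2_inL2 (ued p e).
  exists (2 * (2 * Bh) + 1) => r ur; apply: le_trans (Hbd r ur).
  by apply: ler_sum => e _; exact: sqint_le_h1sq.
have du2 : inL2G (due p).
  apply/inL2GP; split; first by move=> e; case: (dued p e) => _ _; case: (ued p e).
  exists (2 * (2 * Bh) + 1) => r ur; apply: le_trans (Hbd r ur).
  by apply: ler_sum => e _; exact: sqint_deriv_le_h1sq.
have v2 : inL2G (edge_component v0).
  have := inL2GD f2 (inL2GZ (-1) u2).
  by apply: eq_inL2G => e t tl; rewrite v0E// /ue; ring.
have v0d e : derivL2 (len e) (edge_component v0 e) (dext dA dB p e).
  by apply: eq_derivL2 (dext1 p e) => // t tl; rewrite v0E.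
exists v0; split.
- exists (dext dA dB p); split; first exact: v2.
  + by apply: eq_inL2G (inL2GZ z v2).
  + move=> e; split => //; apply: eq_derivL2 (dext2 p e) => // t tl.
    by rewrite -v0E.
  + by move=> v; apply: Ccontinuous_edgewise => e; exists (dext dA dB p e).
  + by move=> v; rewrite fsum_incident; exact: pK.
- split.
  + apply: Ccontinuous_edgewise => e; exists (due p e).
    by apply: eq_derivL2 (ued p e) => // t tl; rewrite ueE.
  + by apply: eq_inL2G u2 => e t tl; rewrite ueE.
  + exists (due p); split => // e.
    by apply: eq_derivL2 (ued p e) => // t tl; rewrite ueE.
- move=> w ew fw eps eps0.
  (* The parts of the approximant at x are within r of 0 and of those of the cluster value. The
     latter are thus at most 2 r <= 1, and the squared modulus is at most 4 r <= eps. *)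
  pose r := Num.min (1 / 2) (eps / 4).
  have r0 : 0 < r by rewrite lt_min !divr_gt0.
  have [r1 r2] : r <= 1 / 2 /\ r <= eps / 4 by rewrite !ge_min !lexx orbT.
  have [n hn] := @uniform_decay _ G U (fun n => ue (phi n)) (fun n => due (phi n))
    (2 * Bh) (fun n e => ue_ends (phi n) e) (fun n e => ued (phi n) e) U0 UB w ew fw r r0.
  exists n => x nx.
  have [N nN hN] := hU [:: x] r n ltac:(by rewrite r0; lra).
  have [_ k1 k2] := hN x (mem_head _ _); have [k3 k4] := hn N x nN nx.
  have -> : f (Vertex x) - v0 (Vertex x) = Uc x by rewrite /v0 /p /F; ring.
  have : sqabs (Uc x) <= 2 * (2 * r).
    apply: sqabs_small; first by apply/andP; split; lra.
      have := ler_distD (complex.Re (U N x)) 0 (complex.Re (Uc x)).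
      by rewrite !sub0r !normrN; lra.
    have := ler_distD (complex.Im (U N x)) 0 (complex.Im (Uc x)).
    by rewrite !sub0r !normrN; lra.
  lra.
Qed.

End solver.

(** * Kernel elements attached to finite volume ends *)

Section cutoff.
Context {R : realType} (G : metric_graph R).
Local Notation V := (vertex G).
Local Notation E := (edge G).
Local Notation M := (mpoint G).

Let l0 (e : E) : 0 <= len e. Proof. exact: ltW (len_gt0 e). Qed.

Let dmono (k : R) n x : is_derive x (1 : R) (fun t => k * t ^+ n.+1) (k * (n.+1%:R * x ^+ n)).
Proof.
have h : is_derive x (1 : R) ((id : R -> R) ^+ n.+1) ((n.+1%:R * x ^+ n) *: (1 : R)).
  exact: is_deriveX.
have {}h : is_derive x (1 : R) (fun t => t ^+ n.+1) (n.+1%:R * x ^+ n).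
  by move: h; rewrite exprfctE /GRing.scale /= mulr1.
exact: is_deriveZ.
Qed.

(* The quintic 6x^5 - 15x^4 + 10x^3 interpolates 0 and 1 with vanishing first
   and second derivatives at both ends, so that the Kirchhoff conditions hold
   and the second derivative may be taken to be 0 at the vertices. *)
Let q l t : R := 6 / l ^+ 5 * t ^+ 5 + - 15 / l ^+ 4 * t ^+ 4 + 10 / l ^+ 3 * t ^+ 3.
Let dq l t : R := 30 / l ^+ 5 * t ^+ 4 + - 60 / l ^+ 4 * t ^+ 3 + 30 / l ^+ 3 * t ^+ 2.
Let ddq l t : R := 120 / l ^+ 5 * t ^+ 3 + - 180 / l ^+ 4 * t ^+ 2 + 60 / l ^+ 3 * t ^+ 1.
Let d3q l t : R := 360 / l ^+ 5 * t ^+ 2 + - 360 / l ^+ 4 * t ^+ 1 + 60 / l ^+ 3 * t ^+ 0.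

Let qd l x : is_derive x (1 : R) (q l) (dq l x).
Proof.
apply: is_derive_eq (is_deriveD (is_deriveD (dmono _ 4 x) (dmono _ 3 x)) (dmono _ 2 x)) _.
by rewrite /dq; ring.
Qed.
Let dqd l x : is_derive x (1 : R) (dq l) (ddq l x).
Proof.
apply: is_derive_eq (is_deriveD (is_deriveD (dmono _ 3 x) (dmono _ 2 x)) (dmono _ 1 x)) _.
by rewrite /ddq; ring.
Qed.
Let ddqd l x : is_derive x (1 : R) (ddq l) (d3q l x).
Proof.
apply: is_derive_eq (is_deriveD (is_deriveD (dmono _ 2 x) (dmono _ 1 x)) (dmono _ 0 x)) _.
by rewrite /d3q; ring.
Qed.

Let acq l : 0 < l -> ac l (q l) (dq l).
Proof. by move=> l0'; exact: ac_C1 l0' (is_derive_continuous (@dqd l)) (@qd l). Qed.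
Let acdq l : 0 < l -> ac l (dq l) (ddq l).
Proof. by move=> l0'; exact: ac_C1 l0' (is_derive_continuous (@ddqd l)) (@dqd l). Qed.

Let ac_cst l (c : R) : 0 < l -> ac l (fun=> c) (fun=> 0).
Proof.
by move=> l0'; apply: (ac_C1 l0') => x; exact: cst_continuous.
Qed.

(** An edge avoiding the first n vertices has both ends in the component or both outside, so f is
    constant on it. Hence f' and f'' live on finitely many edges, and f is in L^2 because the
    component has finite volume. *)
Lemma cutoff n (u : V) B : sum_bound (@len _ G) (reach n u) B ->
  exists f : M -> R[i], [/\ dom_max_Laplacian G f, sobolevH1 G f &
    forall v, f (Vertex v) = (`[< reach n u v >])%:R].
Proof.
move=> hB; pose c v : R := (`[< reach n u v >])%:R.
pose F e t := c (src e) + (c (tgt e) - c (src e)) * q (len e) t.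
pose dF e t := (c (tgt e) - c (src e)) * dq (len e) t.
pose ddF e t := (c (tgt e) - c (src e)) * ddq (len e) t.
pose f (x : M) : R[i] := match x with Vertex v => (c v)%:C%C | @Inner _ _ e t _ => (F e t)%:C%C end.
pose g (x : M) : R[i] := match x with Vertex v => 0 | @Inner _ _ e t _ => (- ddF e t)%:C%C end.
have ln (e : E) : len e != 0 by rewrite gt_eqF// len_gt0.
have fE e t : 0 <= t <= len e -> edge_component f e t = (F e t)%:C%C.
  move=> tl; rewrite /edge_component; case: (chart_ends tl) => [->|->|ht].
  - by rewrite chart0 /= /F /q; congr (_%:C)%C; ring.
  - by rewrite chart_len /= /F /q; congr (_%:C)%C; field.
  - by rewrite (chart_inner ht).
have gE e t : 0 <= t <= len e -> edge_component g e t = (- ddF e t)%:C%C.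
  move=> tl; rewrite /edge_component; case: (chart_ends tl) => [->|->|ht].
  - by rewrite chart0 /= -[LHS]/(0%:C)%C /ddF /ddq; congr (_%:C)%C; ring.
  - by rewrite chart_len /= -[LHS]/(0%:C)%C /ddF /ddq; congr (_%:C)%C; field.
  - by rewrite (chart_inner ht).
have aF e : ac (len e) (F e) (dF e).
  have := acD (ac_cst (c (src e)) (len_gt0 e)) (acZ (c (tgt e) - c (src e)) (acq (len_gt0 e))).
  by apply: eq_ac => // t _; rewrite add0r.
have adF e : ac (len e) (dF e) (ddF e) by apply: acZ; exact: acdq (len_gt0 e).
pose df e t : R[i] := (dF e t)%:C%C.
have hf e : derivL2 (len e) (edge_component f e) (df e).
  apply: (@eq_derivL2 _ _ (fun t => (F e t)%:C%C) _ (df e)) => //.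
    by move=> t tl; rewrite fE.
  by apply/derivL2P; split; [exact: aF|exact: ac_cst (len_gt0 e)].
have hdf e : derivL2 (len e) (df e) (fun t => - edge_component g e t).
  apply: (@eq_derivL2 _ _ (df e) _ (fun t => (ddF e t)%:C%C)) => //.
    by move=> t tl; rewrite gE// rmorphN opprK.
  by apply/derivL2P; split; [exact: adF|exact: ac_cst (len_gt0 e)].
have cE e : e \notin touchseq G n -> c (src e) = c (tgt e).
  rewrite mem_touchseq negb_or -!leqNgt => /andP[n1 n2].
  rewrite /c; congr (nat_of_bool _)%:R; apply: asbool_equiv_eq.
  have st : reach n (src e) (tgt e) by exact: reach_edge (joins_ends e) n1 n2.
  by split=> h; [exact: reach_trans h st|exact: reach_trans h (reach_sym st)].
(* Splits off the finitely many edges at the first n vertices, leaving those on which f is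
   constant. *)
have sumfin (b : E -> R) (B' : R) : (forall e, 0 <= b e) ->
    (forall r : seq E, uniq r -> (forall e, e \in r -> e \notin touchseq G n) ->
       \sum_(e <- r) b e <= B') ->
    exists B, forall r : seq E, uniq r -> \sum_(e <- r) b e <= B.
  move=> b0 hb; exists (\sum_(e <- touchseq G n) b e + B') => r ur.
  rewrite (bigID (mem (touchseq G n))) /= -[X in X + _]big_filter -[X in _ + X]big_filter.
  apply: lerD.
    apply: sum_touchseq => //; first exact: filter_uniq.
    by move=> e; rewrite mem_filter mem_touchseq => /andP[].
  by apply: hb; [exact: filter_uniq|move=> e; rewrite mem_filter => /andP[]].
have fL : inL2G (edge_component f).
  apply/inL2GP; split; first by move=> e; exact: derivL2_inL2 (hf e).
  apply: (sumfin _ B) => [e|r ur hr]; first exact: sqint_ge0.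
  apply: (@le_trans _ _ (\sum_(e <- r | `[< touches (reach n u) e >]) len e)).
    rewrite [leRHS]big_mkcond big_seq [leRHS]big_seq; apply: ler_sum => e /hr/cE ce.
    have Fe t : 0 <= t <= len e -> edge_component f e t = (c (src e))%:C%C.
      by move=> tl; rewrite fE// /F ce subrr mul0r addr0.
    rewrite (eq_sqint Fe); have -> : sqint (len e) (fun=> (c (src e))%:C%C) = c (src e) ^+ 2 * len e.
      rewrite /sqint (@eq_Rintegral _ _ _ _ _ (cst (c (src e) ^+ 2))); last first.
        by move=> t _; rewrite /sqabs /= expr0n addr0.
      by rewrite Rintegral_cst_itv0// len_gt0.
    case: asboolP => [te|te]; rewrite /c.
      by case: asboolP => _; rewrite ?expr1n ?mul1r// expr0n mul0r.
    case: asboolP => [se|_]; first by case: te; left.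
    by rewrite expr0n mul0r.
  rewrite -big_filter; apply: hB; first exact: filter_uniq.
  by move=> e; rewrite mem_filter => /andP[/asboolP].
have dfL : inL2G df.
  apply/inL2GP; split; first by move=> e; exact: derivL2_inL2 (hdf e).
  apply: (sumfin _ 0) => [e|r ur hr]; first exact: sqint_ge0.
  rewrite big_seq big1// => e /hr/cE ce; rewrite -[RHS](sqint0 (len e)).
  by apply: eq_sqint => t _; rewrite /df /dF ce subrr mul0r.
have gL : inL2G (edge_component g).
  apply/inL2GP; split.
    move=> e; have [+ _] := hdf e; move/(inL2Z (-1)); apply: eq_inL2 => t _.
    by rewrite mulN1r opprK.
  apply: (sumfin _ 0) => [e|r ur hr]; first exact: sqint_ge0.
  rewrite big_seq big1// => e /hr/cE ce; rewrite -[RHS](sqint0 (len e)).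
  by apply: eq_sqint => t tl; rewrite gE// /ddF ce subrr mul0r oppr0.
exists f; split.
- exists g, df; split => //.
    by move=> v; apply: Ccontinuous_edgewise => e; exists (df e).
  move=> v; rewrite fsum_incident big1// => e _; rewrite /outward_derivative /df /dF.
  case: ifP => _.
    rewrite [X in (X%:C)%C](_ : _ = 0)//; rewrite /dq; ring.
  rewrite [X in (X%:C)%C](_ : _ = 0) ?oppr0//; rewrite /dq; field.
  exact: ln.
- split => //; last by exists df.
  by apply: Ccontinuous_edgewise => e; exists (df e).
- by move=> v; rewrite /f /c; case: asboolP.
Qed.

End cutoff.

(** * Linear structure and independence along distinct ends *)

Section lower_bound.
Context {R : realType} (G : metric_graph R) (s : R).
Hypothesis s2 : s ^+ 2 = 1.
Local Notation V := (vertex G).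
Local Notation E := (edge G).
Local Notation M := (mpoint G).
Local Notation z := (0 +i* s)%C.

Let l0 (e : E) : 0 <= len e. Proof. exact: ltW (len_gt0 e). Qed.

Lemma sum_sqabs_small (I : Type) (r : seq I) (c : I -> R[i]) : exists2 K : R, 0 <= K &
  forall (y : I -> R[i]) (d : R), 0 <= d -> (forall i, sqabs (y i) <= d) ->
  sqabs (\sum_(i <- r) c i * y i) <= K * d.
Proof.
elim: r => [|i r [K K0 ih]].
  by exists 0 => // y d d0 _; rewrite big_nil sqabs0 mul0r.
exists (2 * sqabs (c i) + 2 * K) => [|y d d0 hy].
  by rewrite addr_ge0// mulr_ge0// sqabs_ge0.
rewrite big_cons; apply: (le_trans (sqabsD_le _ _)).
have := ih y d d0 hy; rewrite sqabsM.
have := ler_wpM2l (sqabs_ge0 (c i)) (hy i); lra.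
Qed.

Lemma sobolevH1D (f g : M -> R[i]) : sobolevH1 G f -> sobolevH1 G g ->
  sobolevH1 G (fun x => f x + g x).
Proof.
move=> [_ f2 [df [hf df2]]] [_ g2 [dg [hg dg2]]].
have hfg e : derivL2 (len e) (edge_component (fun x => f x + g x) e) (fun t => df e t + dg e t).
  exact: derivL2D.
split.
- by apply: Ccontinuous_edgewise => e; eexists; exact: hfg.
- exact: (inL2GD f2 g2).
- by exists (fun e t => df e t + dg e t); split; [exact: hfg|exact: (inL2GD df2 dg2)].
Qed.

Lemma sobolevH1Z (c : R[i]) (f : M -> R[i]) : sobolevH1 G f ->
  sobolevH1 G (fun x => c * f x).
Proof.
move=> [_ f2 [df [hf df2]]].
have hcf e : derivL2 (len e) (edge_component (fun x => c * f x) e) (fun t => c * df e t).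
  exact: derivL2Z.
split.
- by apply: Ccontinuous_edgewise => e; eexists; exact: hcf.
- exact: (inL2GZ c f2).
- by exists (fun e t => c * df e t); split; [exact: hcf|exact: (inL2GZ c df2)].
Qed.

Lemma ker_max_LaplacianD (w : R[i]) (f g : M -> R[i]) :
  ker_max_Laplacian w f -> ker_max_Laplacian w g ->
  ker_max_Laplacian w (fun x => f x + g x).
Proof.
move=> [df [f2 f3 hf _ fK]] [dg [g2 g3 hg _ gK]].
have hfg e : derivL2 (len e) (edge_component (fun x => f x + g x) e) (fun t => df e t + dg e t).
  by apply: derivL2D => //; [case: (hf e)|case: (hg e)].
exists (fun e t => df e t + dg e t); split.
- exact: (inL2GD f2 g2).
- have := inL2GD f3 g3; apply: eq_inL2G => e t _.
  by rewrite /edge_component mulrDr.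
- move=> e; split; first exact: hfg.
  have := derivL2D (l0 e) (hf e).2 (hg e).2.
  by apply: eq_derivL2 => // t _; rewrite /edge_component mulrDr opprD.
- by move=> v; apply: Ccontinuous_edgewise => e; eexists; exact: hfg.
- move=> v; rewrite fsum_incident.
  transitivity (\sum_(e <- incseq v) outward_derivative (df e) v e +
                \sum_(e <- incseq v) outward_derivative (dg e) v e); last first.
    by rewrite -!fsum_incident fK gK addr0.
  rewrite -big_split /=; apply: eq_bigr => e _.
  by rewrite /outward_derivative; case: ifP => _ //; ring.
Qed.

Lemma ker_max_LaplacianZ (w c : R[i]) (f : M -> R[i]) :
  ker_max_Laplacian w f -> ker_max_Laplacian w (fun x => c * f x).
Proof.
move=> [df [f2 f3 hf _ fK]].
have hcf e : derivL2 (len e) (edge_component (fun x => c * f x) e) (fun t => c * df e t).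
  by apply: derivL2Z => //; case: (hf e).
exists (fun e t => c * df e t); split.
- exact: (inL2GZ c f2).
- have := inL2GZ c f3; apply: eq_inL2G => e t _.
  by rewrite /edge_component mulrCA.
- move=> e; split; first exact: hcf.
  have := derivL2Z c (l0 e) (hf e).2.
  by apply: eq_derivL2 => // t _; rewrite /edge_component mulrN mulrCA.
- by move=> v; apply: Ccontinuous_edgewise => e; eexists; exact: hcf.
- move=> v; rewrite fsum_incident.
  transitivity (c * \sum_(e <- incseq v) outward_derivative (df e) v e); last first.
    by rewrite -fsum_incident fK mulr0.
  rewrite mulr_sumr; apply: eq_bigr => e _.
  by rewrite /outward_derivative; case: ifP => _ //; ring.
Qed.

Let P_sum (P : (M -> R[i]) -> Prop) :
  P (fun=> 0) -> (forall f g, P f -> P g -> P (fun x => f x + g x)) ->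
  (forall c f, P f -> P (fun x => c * f x)) ->
  forall n (c : 'I_n -> R[i]) (v : 'I_n -> M -> R[i]), (forall i, P (v i)) ->
  P (fun x => \sum_(i < n) c i * v i x).
Proof.
move=> P0 PD PZ n c v hv; rewrite /index_enum; elim: (Finite.enum _) => [|i r ih].
  by under eq_fun do rewrite big_nil.
under eq_fun do rewrite big_cons.
by apply: PD => //; exact: PZ.
Qed.

Lemma inL2G0 : inL2G (fun (e : E) (t : R) => 0 : R[i]).
Proof.
apply/inL2GP; split; first by move=> e; apply/inL2P; split; exact: L2_cst.
by exists 0 => r ur; rewrite big1// => e _; exact: sqint0.
Qed.

Lemma derivL2_0 (e : E) : derivL2 (len e) (fun t : R => 0 : R[i]) (fun t => 0).
Proof.
apply/derivL2P; split; (split; first exact: L2_cst);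
  by move=> x _; rewrite Rintegral_cst//= mul0r addr0.
Qed.

Lemma sobolevH1_sum n (c : 'I_n -> R[i]) (v : 'I_n -> M -> R[i]) :
  (forall i, sobolevH1 G (v i)) -> sobolevH1 G (fun x => \sum_(i < n) c i * v i x).
Proof.
apply: (P_sum _ sobolevH1D sobolevH1Z); split.
- apply: Ccontinuous_edgewise => e; exists (fun=> 0); exact: derivL2_0.
- exact: inL2G0.
- by exists (fun _ _ => 0); split; [exact: derivL2_0|exact: inL2G0].
Qed.

Lemma ker_max_Laplacian_sum (w : R[i]) n (c : 'I_n -> R[i]) (v : 'I_n -> M -> R[i]) :
  (forall i, ker_max_Laplacian w (v i)) ->
  ker_max_Laplacian w (fun x => \sum_(i < n) c i * v i x).
Proof.
apply: (P_sum _ (@ker_max_LaplacianD w) (@ker_max_LaplacianZ w)).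
exists (fun _ _ => 0); split.
- exact: inL2G0.
- by apply: eq_inL2G inL2G0 => e t _; rewrite /edge_component mulr0.
- move=> e; split; first exact: derivL2_0.
  by apply: eq_derivL2 (derivL2_0 e) => // t _; rewrite /edge_component mulr0 oppr0.
- move=> v0; apply: Ccontinuous_edgewise => e; exists (fun=> 0); exact: derivL2_0.
- move=> v0; rewrite fsum_incident big1// => e _.
  by rewrite /outward_derivative; case: ifP; rewrite ?oppr0.
Qed.

(** Along the i-th end, [f j] is eventually 1 if j = i and 0 otherwise, while [f j - v j] tends to
    0. Evaluating a vanishing combination of the [v j] there leaves [c i] = 0. *)
Lemma independent_kernel m (w : 'I_m -> nat -> V) :
  (forall i, vertex_end (w i)) -> (forall i, finite_volume_vertex_end (w i)) ->
  (forall i j, end_class (w i) = end_class (w j) -> i = j) ->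
  exists v : 'I_m -> M -> R[i],
    [/\ forall i, ker_max_Laplacian z (v i), forall i, sobolevH1 G (v i) &
     forall c : 'I_m -> R[i], (forall x, \sum_(i < m) c i * v i x = 0) ->
       forall i, c i = 0].
Proof.
move=> ew fw dw.
have /choice[nf hnf] := fw.
have /choice[nd hnd] : forall ij : 'I_m * 'I_m, exists n, ij.1 != ij.2 ->
    forall k x, (n <= k)%N -> reach k (w ij.1 k) x -> reach k (w ij.2 k) x -> False.
  move=> [i j] /=; have [->|ij] := eqVneq i j; first by exists 0%N.
  have [|n hn] := @end_class_neq _ _ (w i) (w j) (ew i) (ew j).
    by move=> /dw e; rewrite e eqxx in ij.
  by exists n => _.
(* From level [N] on the components have finite volume and those of distinct ends are disjoint. *)
pose N := (\max_(i < m) nf i + \max_(ij : 'I_m * 'I_m) nd ij)%N.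
have nfN i : (nf i <= N)%N.
  by apply: leq_trans (leq_addr _ _); exact: (leq_bigmax i).
have ndN ij : (nd ij <= N)%N.
  by apply: leq_trans (leq_addl _ _); exact: (leq_bigmax ij).
have /choice[f hf] : forall i, exists f : M -> R[i],
    [/\ dom_max_Laplacian G f, sobolevH1 G f &
    forall v, f (Vertex v) = (`[< reach N (w i N) v >])%:R].
  move=> i; have [B hB] := hnf i; apply: (@cutoff _ _ _ _ B).
  exact: sum_boundS (vertex_end_sub (ew i) (nfN i)) hB.
have /choice[v hv] : forall i, exists v : M -> R[i], [/\ ker_max_Laplacian z v,
    sobolevH1 G (fun x => f i x - v x) &
    decays (fun x => f i (Vertex x) - v (Vertex x))].
  by move=> i; have [df _ _] := hf i; exact: dirichlet_solution.
exists v; split.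
- by move=> i; case: (hv i).
- move=> i; have [_ h _] := hv i; have [_ h' _] := hf i.
  have := sobolevH1D h' (sobolevH1Z (-1) h).
  rewrite (_ : (fun x => _) = v i)//; apply/funext => x; ring.
move=> c hc i; apply/eqP; rewrite -sqabs_eq0 eq_le sqabs_ge0 andbT.
have [K K0 hK] := sum_sqabs_small (index_enum 'I_m) c.
apply/ler_addgt0Pr => eps eps0; rewrite add0r.
pose d := eps / (K + 1).
have K1 : 0 < K + 1 by rewrite ltr_wpDl.
have d0 : 0 < d by rewrite divr_gt0.
have /choice[nn hnn] : forall j, exists n, forall x, reach n (w i n) x ->
    sqabs (f j (Vertex x) - v j (Vertex x)) <= d.
  by move=> j; have [_ _ dj] := hv j; exact: dj (ew i) (fw i) d d0.
pose n := maxn N (\max_(j < m) nn j).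
pose x := w i n.
have xN : reach N (w i N) x by apply: vertex_end_le => //; exact: leq_maxl.
have fx j : f j (Vertex x) = (j == i)%:R.
  have [_ _ ->] := hf j; case: asboolP => [xj|xj].
    have [//|ji] := eqVneq j i.
    by exfalso; exact: (hnd (j, i) ji N x (ndN _) xj xN).
  by case: eqP => // ji; rewrite ji in xj.
have -> : c i = \sum_(j < m) c j * (f j (Vertex x) - v j (Vertex x)).
  under eq_bigr do rewrite mulrBr.
  rewrite sumrB hc subr0 (bigD1 i)//= fx eqxx mulr1 big1 ?addr0// => j /negbTE ji.
  by rewrite fx ji mulr0.
apply: le_trans (hK _ d (ltW d0) _) _.
  move=> j; apply: hnn; apply: vertex_end_le => //.
  by apply: leq_trans (leq_maxr _ _); exact: (leq_bigmax j).
have : d * (K + 1) = eps by rewrite /d divfK// gt_eqF.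
nra.
Qed.

End lower_bound.

(** * Maximum principle *)

Section upper_bound.
Context {R : realType} (G : metric_graph R) (s : R).
Hypothesis s2 : s ^+ 2 = 1.
Local Notation V := (vertex G).
Local Notation E := (edge G).
Local Notation M := (mpoint G).
Local Notation z := (0 +i* s)%C.

Let l0 (e : E) : 0 <= len e. Proof. exact: ltW (len_gt0 e). Qed.

Lemma sobolevH1_energy (f : M -> R[i]) : sobolevH1 G f ->
  exists df B, (forall e, derivL2 (len e) (edge_component f e) (df e)) /\
    forall r : seq E, uniq r ->
      \sum_(e <- r) h1sq (len e) (edge_component f e) (df e) <= B.
Proof.
move=> [_ /inL2GP[f1 [B1 hB1]] [df [hf /inL2GP[d1 [B2 hB2]]]]].
exists df, (B1 + B2); split => // r ur.
apply: (@le_trans _ _ (\sum_(e <- r) (sqint (len e) (edge_component f e) + sqint (len e) (df e)))).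
  apply: ler_sum => e _; rewrite le_eqVlt /h1sq RintegralD ?eqxx//.
    exact: (inL2_sq (f1 e)).
  exact: (inL2_sq (d1 e)).
by rewrite big_split /=; apply: lerD; [exact: hB1|exact: hB2].
Qed.

Lemma sqabs_edge_osc (f : M -> R[i]) (df : E -> R -> R[i]) e x y :
  (forall e, derivL2 (len e) (edge_component f e) (df e)) -> joins e x y ->
  sqabs (f (Vertex x)) <= sqabs (f (Vertex y)) +
    2 * h1sq (len e) (edge_component f e) (df e).
Proof.
move=> hf; have l00 : 0 <= (0 : R) <= len e by rewrite l0 lexx.
have lll : 0 <= len e <= len e by rewrite l0 lexx.
move=> /joinsP[[<- <-]|[<- <-]].
  have := sqabs_osc2 l00 lll (hf e).
  by rewrite /edge_component chart0 chart_len.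
have := sqabs_osc2 lll l00 (hf e).
by rewrite /edge_component chart0 chart_len.
Qed.

(** At level 0 no vertex is removed, so [path_sum] compares every vertex with a fixed one. *)
Lemma sobolevH1_bounded (f : M -> R[i]) : sobolevH1 G f ->
  exists C, forall v, sqabs (f (Vertex v)) <= C.
Proof.
move=> /sobolevH1_energy[df [B [hf hB]]].
exists (sqabs (f (Vertex (vnum G 0))) + 2 * B) => v.
apply: (@path_sum _ G (fun v => sqabs (f (Vertex v)))
  (fun e => 2 * h1sq (len e) (edge_component f e) (df e)) 0 v _ (2 * B)).
- by move=> e x y; exact: sqabs_edge_osc.
- by move=> r ur _; rewrite -mulr_sumr ler_pM2l//; exact: hB.
- exact: reach0.
Qed.

Lemma redotD u d d' : redot u (d + d') = redot u d + redot u d' :> R.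
Proof. by rewrite /redot !raddfD /=; ring. Qed.
Lemma redotN u d : redot u (- d) = - redot u d :> R.
Proof. by rewrite /redot !raddfN /=; ring. Qed.
Lemma redot0 u : redot u 0 = 0 :> R.
Proof. by rewrite /redot /=; ring. Qed.

(* The square modulus of f is convex along the edges and its outward slopes at
   each vertex have sum 0, so that a maximum over the vertices spreads to the
   neighbours. *)
Lemma sqabs_max_adjacent (f : M -> R[i]) v x : ker_max_Laplacian z f ->
  (forall y, sqabs (f (Vertex y)) <= sqabs (f (Vertex v))) -> adjacent v x ->
  sqabs (f (Vertex x)) = sqabs (f (Vertex v)).
Proof.
move=> [df [_ _ hf _ fK]] hmax [e0 j0].
pose k e := redot (f (Vertex v)) (outward_derivative (df e) v e).
pose other e := if src e == v then tgt e else src e.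
have kle e : incident v e ->
    sqabs (f (Vertex v)) + len e * k e <= sqabs (f (Vertex (other e))).
  move=> ve; have [hf1 hf2] := hf e.
  have [] := sqabs_convex (len_gt0 e) hf1 hf2.
  rewrite /edge_component chart0 chart_len /k /other /outward_derivative.
  case: eqP => [<- //|sv _].
  by case: ve => // <-; rewrite redotN mulrN.
have k0 e : incident v e -> k e <= 0.
  move=> ve; have := kle e ve; have := hmax (other e).
  have := len_gt0 e; nra.
have sumk : \sum_(e <- incseq v) - k e = 0.
  rewrite sumrN; apply/eqP; rewrite oppr_eq0; apply/eqP.
  rewrite -[RHS](redot0 (f (Vertex v))) -(fK v) fsum_incident.
  by rewrite (big_morph _ (redotD (f (Vertex v))) (redot0 _)).
have inc e : (e \in incseq v) -> incident v e.
  by rewrite mem_incseq => /orP[/eqP|/eqP]; [left|right].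
have ve0 : incident v e0.
  by case/joinsP: j0 => -[h1 h2]; [left|right].
have xe0 : other e0 = x.
  rewrite /other; case/joinsP: j0 => -[h1 h2]; first by rewrite h1 eqxx.
  by case: eqP => // h3; have := @no_loop _ _ e0; rewrite h2 h3.
have ke0 : k e0 = 0.
  have m0 : e0 \in incseq v by rewrite mem_incseq; case: ve0 => ->; rewrite eqxx ?orbT.
  have : forall e, e \in incseq v -> 0 <= - k e by move=> e /inc/k0; rewrite oppr_ge0.
  move=> h; have := sumk; rewrite big_seq => /eqP.
  rewrite psumr_eq0// => /allP/(_ e0 m0); rewrite m0 /= oppr_eq0 => /eqP.
  by [].
apply/eqP; rewrite eq_le hmax /=.
by have := kle e0 ve0; rewrite ke0 mulr0 addr0 xe0.
Qed.

(** With vanishing endpoint values the boundary terms of [energy_le] drop out, and every edge has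
    energy 0. *)
Lemma kernel_vanish_vertices (f : M -> R[i]) : ker_max_Laplacian z f ->
  (forall v, f (Vertex v) = 0) -> forall x, f x = 0.
Proof.
move=> [df [_ _ hf _ _]] f0.
suff key e t : 0 <= t <= len e -> f (chart e t) = 0.
  case=> [v|e t h]; first exact: f0.
  rewrite -(chart_inner h); apply: key.
  by case/andP: (h) => h1 h2; rewrite !ltW.
move=> tl; have [hf1 hf2] := hf e.
have inL0 : inL2 (len e) (fun t : R => 0 : R[i]) by apply/inL2P; split; exact: L2_cst.
have hf3 : derivL2 (len e) (df e) (fun t => - (z * edge_component f e t + 0)).
  by apply: eq_derivL2 hf2 => // t' _; rewrite addr0.
have en := energy_le (l0 e) s2 inL0 hf1 hf3.
rewrite [X in 2 * X]sqint0 mulr0 add0r in en.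
move: en; rewrite /edge_component chart0 chart_len !f0.
rewrite !bracket0l subrr mulr0 => en.
apply/eqP; rewrite -sqabs_eq0 eq_le sqabs_ge0 andbT.
apply: (le_trans (sqabs_sup (len_gt0 e) tl hf1)).
by apply: mulr_ge0_le0 => //; rewrite addr_ge0// invr_ge0.
Qed.

(** One small value in every component of a finite volume end is enough, since the tail of the
    energy bounds the oscillation there; this is the form of vanishing that cluster values
    provide. *)
Lemma sqabs_level_finite (f : M -> R[i]) : sobolevH1 G f ->
  (forall w, vertex_end w -> finite_volume_vertex_end w -> forall (d : R) n, 0 < d ->
     exists2 x, reach n (w n) x & sqabs (f (Vertex x)) <= d) ->
  forall eps : R, 0 < eps -> finite_set [set v | eps <= sqabs (f (Vertex v))].
Proof.
move=> fH hw eps eps0; apply: contrapT => /infinite_vertex_end[w ew infw].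
have [df [B [hf hB]]] := sobolevH1_energy fH.
pose b e := 2 * h1sq (len e) (edge_component f e) (df e).
have b0 e : 0 <= b e by rewrite mulr_ge0// h1sq_ge0.
have sb : sum_bound b (reach 0 (w 0%N)) (2 * B).
  by move=> r ur _; rewrite -mulr_sumr ler_pM2l//; exact: hB.
have e4 : 0 < eps / 4 by rewrite divr_gt0.
(* On this component |f|^2 oscillates by at most eps / 4 between vertices: starting from a value at
   least eps it stays above 3 eps / 4 at the vertices and above eps / 2 along the edges. *)
have [n _ hn] := tail_sum b0 ew sb e4.
have [x [/= xe wx]] : ([set v | eps <= sqabs (f (Vertex v))] `&` reach n (w n)) !=set0.
  by apply/set0P/eqP => h; apply: (infw n); rewrite h; exact: finite_set0.
have low y : reach n (w n) y -> 3 / 4 * eps <= sqabs (f (Vertex y)).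
  move=> wy.
  have hx : sum_bound b (reach n x) (eps / 4).
    by apply: sum_boundS hn => v xv; exact: reach_trans wx xv.
  have := @path_sum _ G (fun v => sqabs (f (Vertex v))) b n x y (eps / 4)
    (fun e p q => sqabs_edge_osc hf) hx (reach_trans (reach_sym wx) wy).
  lra.
have fw : finite_volume_vertex_end w.
  (* Each of these edges carries energy at least eps / 2 times its length. *)
  exists n, (2 / eps * B) => r ur hr.
  apply: (@le_trans _ _ (\sum_(e <- r) 2 / eps * h1sq (len e) (edge_component f e) (df e))); last first.
    by rewrite -mulr_sumr; apply: ler_wpM2l (hB r ur); rewrite divr_ge0// ltW.
  rewrite big_seq [leRHS]big_seq; apply: ler_sum => e /hr te.
  have be := sum_bound1 hn te.
  have [c cl cv] : exists2 c, 0 <= c <= len e & 3 / 4 * eps <= sqabs (edge_component f e c).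
    case: te => /low h.
      by exists 0; rewrite ?lexx ?l0// /edge_component chart0.
    by exists (len e); rewrite ?lexx ?l0// /edge_component chart_len.
  have lowt t : 0 <= t <= len e -> eps / 2 <= sqabs (edge_component f e t).
    by move=> tl; have := sqabs_osc2 cl tl (hf e); move: be; rewrite /b; lra.
  have : eps / 2 * len e <= h1sq (len e) (edge_component f e) (df e).
    apply: le_trans (sqint_le_h1sq (l0 e) (hf e)).
    have -> : eps / 2 * len e = \int[@lebesgue_measure R]_(t in `[0, len e]) (cst (eps / 2) t).
      by rewrite Rintegral_cst_itv0// len_gt0.
    apply: le_Rintegral => //.
    - exact: (L2_int (L2_cst (len e) (eps / 2))).
    - exact: inL2_sq (derivL2_inL2 (l0 e) (hf e)).
  move=> h; rewrite -(ler_pM2l (_ : 0 < eps / 2)) ?divr_gt0//.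
  apply: (le_trans h); rewrite le_eqVlt; apply/orP; left; apply/eqP.
  by field; rewrite gt_eqF.
have e2 : 0 < eps / 2 by rewrite divr_gt0.
have [y wy hy] := hw w ew fw (eps / 2) n e2.
by have := low y wy; lra.
Qed.

(** At a nonzero level there are finitely many vertices, so a maximum of |f|^2 exists;
    [sqabs_max_adjacent] spreads it over the connected graph, whose infinitely many vertices then
    all reach that level. *)
Lemma kernel_vanish (f : M -> R[i]) : ker_max_Laplacian z f -> sobolevH1 G f ->
  (forall w, vertex_end w -> finite_volume_vertex_end w -> forall (d : R) n, 0 < d ->
     exists2 x, reach n (w n) x & sqabs (f (Vertex x)) <= d) ->
  forall x, f x = 0.
Proof.
move=> fker fH hw; apply: kernel_vanish_vertices => // v0.
apply: contrapT => /eqP; rewrite -sqabs_eq0 => fv0.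
have eps0 : 0 < sqabs (f (Vertex v0)) by rewrite lt_neqAle eq_sym fv0 sqabs_ge0.
have fin := sqabs_level_finite fH hw eps0.
have [v hv] : exists v, forall y, sqabs (f (Vertex y)) <= sqabs (f (Vertex v)).
  have /finite_seqP[r hr] := fin.
  have v0r : v0 \in r by suff : [set` r] v0 by []; rewrite -hr /=.
  have [v vmax] : exists v, forall y, y \in r -> sqabs (f (Vertex y)) <= sqabs (f (Vertex v)).
    elim: (r) => [|a r' [v ih]]; first by exists v0.
    have [h|h] := leP (sqabs (f (Vertex a))) (sqabs (f (Vertex v))).
      by exists v => y; rewrite inE => /predU1P[->//|/ih].
    exists a => y; rewrite inE => /predU1P[->//|/ih h']; exact: le_trans (ltW h).
  exists v => y; have [h|/ltW h] := leP (sqabs (f (Vertex v0))) (sqabs (f (Vertex y))).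
    by apply: vmax; suff : [set` r] y by []; rewrite -hr.
  exact: le_trans h (vmax _ v0r).
have all_max y : sqabs (f (Vertex y)) = sqabs (f (Vertex v)).
  have [_ [p [pp <-]]] := reach0 v y.
  have : forall u, path (step 0) u p -> sqabs (f (Vertex u)) = sqabs (f (Vertex v)) ->
      sqabs (f (Vertex (last u p))) = sqabs (f (Vertex v)).
    elim: p {pp} => //= x p ih u /andP[/andP[/asboolP ux _] pp] fu.
    apply: ih => //; rewrite -fu; apply: sqabs_max_adjacent => // y'.
    by rewrite fu.
  by apply.
apply: (@infinite_vertex _ G); apply: sub_finite_set fin => y _ /=.
by rewrite (all_max y) -(all_max v0).
Qed.

(** Joint cluster values of the [v i] along the m ends form a k by m matrix. If k > m, a nontrivial
    combination has cluster value 0 at every end, and [kernel_vanish] makes it 0. *)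
Lemma dependent_kernel m k (w : 'I_m -> nat -> V) (v : 'I_k -> M -> R[i]) :
  (forall i, vertex_end (w i)) ->
  (forall w', vertex_end w' -> finite_volume_vertex_end w' ->
     exists i, end_class w' = end_class (w i)) ->
  (forall i, ker_max_Laplacian z (v i)) -> (forall i, sobolevH1 G (v i)) ->
  (forall c : 'I_k -> R[i], (forall x, \sum_(i < k) c i * v i x = 0) ->
     forall i, c i = 0) -> (k <= m)%N.
Proof.
move=> ew hw kv Hv ind; rewrite leqNgt; apply/negP => mk.
have /choice[C hC] := fun i => sobolevH1_bounded (Hv i).
pose a n (ijb : 'I_k * 'I_m * bool) :=
  let y := v ijb.1.1 (Vertex (w ijb.1.2 n)) in
  if ijb.2 then complex.Re y else complex.Im y.
have [b hb] := @cluster_family R _ a (fun ijb => 1 + C ijb.1.1) (fun=> 0%N)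
  (fun ijb n _ => match ijb as ijb return `|a n ijb| <= 1 + C ijb.1.1 with
   | (i, j, true) => Re_le_sqabs (hC i (w j n))
   | (i, j, false) => Im_le_sqabs (hC i (w j n)) end).
pose A : 'M[R[i]]_(k, m) := \matrix_(i, j) (b (i, j, true) +i* b (i, j, false))%C.
have : kermx A != 0.
  rewrite kermx_eq0 /row_free neq_ltn; apply/orP; left.
  by apply: leq_ltn_trans (rank_leq_col A) mk.
move=> /rowV0Pn[c /sub_kermxP cA c0].
pose f x := \sum_(i < k) c 0 i * v i x.
have [K K0 hK] := sum_sqabs_small (index_enum 'I_k) (fun i => c 0 i).
have f0 : forall x, f x = 0.
  apply: kernel_vanish.
  - exact: ker_max_Laplacian_sum.
  - exact: sobolevH1_sum.
  move=> w' ew' fw' d n d0; have [j wj] := hw w' ew' fw'.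
  pose r := Num.min 1 (d / (2 * (K + 1))).
  have K1 : 0 < 2 * (K + 1) by rewrite mulr_gt0// ltr_wpDl.
  have r0 : 0 < r by rewrite lt_min ltr01 divr_gt0.
  have r1 : r <= 1 by rewrite ge_min lexx.
  have r2 : r <= d / (2 * (K + 1)) by rewrite ge_min lexx orbT.
  have [N' nN' hN'] := hb ([seq (i, j, true) | i <- enum 'I_k] ++
    [seq (i, j, false) | i <- enum 'I_k]) r n r0.
  exists (w j N').
    apply: reach_trans (vertex_end_le ew' nN') _.
    by apply: reach_le nN' _; exact: (end_class_eq ew' (ew j) wj N').
  (* [c] annihilates [A], so the cluster values may be subtracted. *)
  have -> : f (Vertex (w j N')) = \sum_(i < k) c 0 i * (v i (Vertex (w j N')) - A i j).
    under [RHS]eq_bigr do rewrite mulrBr.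
    rewrite sumrB -[LHS]subr0; congr (_ - _); move/rowP: cA => /(_ j).
    by rewrite !mxE => ->.
  apply: le_trans (hK _ (2 * r) _ _) _.
  - by rewrite mulr_ge0// ltW.
  - move=> i; apply: sqabs_small; first by rewrite ltW.
      rewrite raddfB mxE /=; apply: ltW; apply: (hN' (i, j, true)).
      by rewrite mem_cat (map_f (fun i => (i, j, true))) ?mem_enum.
    rewrite raddfB mxE /=; apply: ltW; apply: (hN' (i, j, false)).
    by rewrite mem_cat (map_f (fun i => (i, j, false))) ?mem_enum ?orbT.
  move: r2; rewrite ler_pdivlMr//; have := ltW r0; nra.
case/negP: c0; apply/eqP/rowP => i; rewrite mxE.
exact: (ind (fun i => c 0 i) f0).
Qed.

End upper_bound.

(** * Deficiency indices *)

Section deficiency.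
Context {R : realType} (G : metric_graph R) (s : R).
Hypothesis s2 : s ^+ 2 = 1.
Local Notation V := (vertex G).
Local Notation M := (mpoint G).
Local Notation z := (0 +i* s)%C.

Definition independent (n : nat) (v : 'I_n -> M -> R[i]) : Prop :=
  forall c : 'I_n -> R[i], (forall x, \sum_(i < n) c i * v i x = 0) ->
    forall i, c i = 0.

Lemma cdim_ge (W : set (M -> R[i])) n (v : 'I_n -> M -> R[i]) :
  (forall i, W (v i)) -> independent v -> (n%:R%:E <= cdim W)%E.
Proof. by move=> hv iv; apply: ereal_sup_ubound; exists n => //; exists v. Qed.

Lemma cdim_le (W : set (M -> R[i])) m :
  (forall n (v : 'I_n -> M -> R[i]), (forall i, W (v i)) -> independent v -> (n <= m)%N) ->
  (cdim W <= m%:R%:E)%E.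
Proof.
move=> h; apply: ge_ereal_sup => _ [n [v hv iv] <-].
by rewrite lee_fin ler_nat; exact: h iv.
Qed.

(** A nontrivial relation must involve [u], placed at the last index, because the other functions
    are independent; dividing by its coefficient solves for [u]. *)
Lemma independent_rcons n (v : 'I_n -> M -> R[i]) (u : M -> R[i]) : independent v ->
  (exists c : 'I_n -> R[i], u = fun x => \sum_(i < n) c i * v i x) \/
  independent (fun i : 'I_n.+1 => if unlift ord_max i is Some j then v j else u).
Proof.
move=> iv; pose vu (i : 'I_n.+1) := if unlift ord_max i is Some j then v j else u.
have vuS c x : \sum_(i < n.+1) c i * vu i x =
    \sum_(i < n) c (lift ord_max i) * v i x + c ord_max * u x.
  rewrite big_ord_recr /=; congr (_ + _); last by rewrite /vu unlift_none.
  apply: eq_bigr => i _; have -> : widen_ord (leqnSn n) i = lift ord_max i.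
    by apply: val_inj; rewrite /= /bump leqNgt ltn_ord add0n.
  by rewrite /vu liftK.
have [|nind] := pselect (independent vu); first by right.
left; have [c hc [i ci]] : exists2 c : 'I_n.+1 -> R[i],
    (forall x, \sum_(i < n.+1) c i * vu i x = 0) & exists i, c i <> 0.
  apply: contrapT => h; apply: nind => c hc i; apply: contrapT => ci.
  by apply: h; exists c => //; exists i.
have cm : c ord_max != 0.
  apply/eqP => cm; apply: ci; case: (unliftP ord_max i) => [j|] ->//.
  apply: (iv (fun j => c (lift ord_max j))) => x.
  by have := hc x; rewrite vuS cm mul0r addr0.
exists (fun i => - (c (lift ord_max i) / c ord_max)); apply/funext => x.
have := hc x; rewrite vuS => /eqP; rewrite addrC addr_eq0 => /eqP h.
have -> : u x = (c ord_max)^-1 * (c ord_max * u x) by rewrite mulKf.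
rewrite h mulrN mulr_sumr -sumrN; apply: eq_bigr => j _.
by field.
Qed.

Lemma enumerate_ends (X : seq (set (nat -> set M))) : uniq X ->
  (forall gamma, gamma \in X -> finite_volume_end G gamma) ->
  exists w : 'I_(size X) -> nat -> V,
    [/\ forall i, vertex_end (w i), forall i, finite_volume_vertex_end (w i) &
        forall i, end_class (w i) = tnth (in_tuple X) i].
Proof.
move=> uX hX; have /choice[w hw] : forall i : 'I_(size X), exists w : nat -> V,
    vertex_end w /\ tnth (in_tuple X) i = end_class w.
  move=> i; have [h _] := hX _ (mem_tnth i (in_tuple X)).
  by have [w ew ->] := topological_end_class h; exists w.
exists w; split => i; have [ew wE] := hw i => //.
apply/(finite_volume_endP ew); rewrite -wE; apply: hX; exact: (mem_tnth i (in_tuple X)).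
Qed.

Lemma ends_kernel (X : seq (set (nat -> set M))) : uniq X ->
  (forall gamma, gamma \in X -> finite_volume_end G gamma) ->
  exists v : 'I_(size X) -> M -> R[i],
    [/\ forall i, ker_max_Laplacian z (v i), forall i, sobolevH1 G (v i) &
        independent v].
Proof.
move=> uX hX; have [w [ew fw wE]] := enumerate_ends uX hX.
apply: (independent_kernel s2 ew fw) => i j; rewrite !wE => /eqP.
rewrite !(tnth_nth set0) /= nth_uniq// => /eqP; exact: val_inj.
Qed.

(** The equation for [D] lets both indices be supplied although their spectral parameters are
    written differently from [z]. *)
Lemma deficiency_ends (D : \bar R) : D = cdim (@ker_max_Laplacian R G z) ->
  (num_finite_volume_ends G <= D)%E /\
  (D = num_finite_volume_ends G <->
     num_finite_volume_ends G = +oo%E \/ dom_max_Laplacian G `<=` sobolevH1 G).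
Proof.
move=> ->; rewrite /num_finite_volume_ends /counting.
case: asboolP => [fin|inf]; last first.
  suff -> : cdim (@ker_max_Laplacian R G z) = +oo%E by split => //; split => // _; left.
  (* Any finite number of ends yields as many independent kernel elements, so the dimension is at
     least every real number. *)
  apply/eqyP => A A0.
  have [X XF AX] := infinite_set_fset (Num.truncn A).+1 inf.
  have [v [kv _ iv]] := ends_kernel (fset_uniq X) XF.
  apply: le_trans (cdim_ge kv iv); rewrite lee_fin.
  apply: (@le_trans _ _ (Num.truncn A).+1%:R); last by rewrite ler_nat.
  by apply/ltW; exact: truncnS_gt.
set X := fset_set _; have XF gamma : gamma \in X -> finite_volume_end G gamma.
  by rewrite in_fset_set// => /set_mem.
have [v [kv Hv iv]] := ends_kernel (fset_uniq X) XF.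
have low := cdim_ge kv iv.
split; first exact: low.
split=> [DX|[//|domH]].
  (* As [f - u] is in H^1, only [u] matters; were it independent of the H^1 elements [v] attached to
     the ends, the dimension would exceed their number. *)
  right=> f fd; have [u [ku fuH _]] := dirichlet_solution s2 fd.
  suff uH : sobolevH1 G u.
    by have := sobolevH1D fuH uH; under eq_fun do rewrite subrK.
  have [[c ->]|iu] := independent_rcons u iv; first exact: sobolevH1_sum.
  exfalso; have : ((size X).+1%:R%:E <= cdim (@ker_max_Laplacian R G z))%E.
    by apply: cdim_ge iu => i; case: (unlift _ _).
  by rewrite DX lee_fin ler_nat ltnn.
(* Under the inclusion every element of ker(H - z) is in H^1, where [dependent_kernel] bounds the
   dimension. *)
apply/eqP; rewrite eq_le low andbT; apply: cdim_le => n u ku iu.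
have [w [ew fw wE]] := enumerate_ends (fset_uniq X) XF.
apply: (dependent_kernel s2 ew _ ku _ iu).
  move=> w' ew' fw'; have : end_class w' \in in_tuple X.
    by rewrite [_ \in _](in_fset_set fin); apply/mem_set/finite_volume_endP.
  move=> /tnthP[i hi].
  by exists i; rewrite wE.
by move=> i; apply: domH; eexists; exact: ku.
Qed.

End deficiency.

Lemma deficiency_minusE (R : realType) (G : metric_graph R) :
  deficiency_minus G = cdim (@ker_max_Laplacian R G (0 +i* (-1))%C).
Proof.
by congr (cdim (ker_max_Laplacian _)); apply/eqP; rewrite eq_complex /= oppr0 !eqxx.
Qed.

Local Open Scope ereal_scope.

Theorem theorem4p1 (R : realType) (G : metric_graph R) :
  (num_finite_volume_ends G <= deficiency_plus G /\
   num_finite_volume_ends G <= deficiency_minus G) /\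
  (deficiency_plus G = num_finite_volume_ends G <->
     num_finite_volume_ends G = +oo \/
     dom_max_Laplacian G `<=` sobolevH1 G) /\
  (deficiency_minus G = num_finite_volume_ends G <->
     num_finite_volume_ends G = +oo \/
     dom_max_Laplacian G `<=` sobolevH1 G).
Proof.
have p2 : ((1 : R) ^+ 2 = 1)%R by rewrite expr1n.
have m2 : ((- 1 : R) ^+ 2 = 1)%R by rewrite sqrrN expr1n.
have [hp1 hp2] := deficiency_ends p2 (erefl (deficiency_plus G)).
by have [hm1 hm2] := deficiency_ends m2 (deficiency_minusE G).
Qed.
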